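(* Let $(H,\Sigma,\Upsilon,\Phi)$ be any gluing data with parameters $m,k\ge 2$, and let $\mathcal R=\mathcal R_{(H,\Sigma,\Upsilon,\Phi)}$ be the associated graph recursion. Then: (1) $\mathcal R$ induces (for each $\lambda\in\mathbb C\setminus\{0\}$) a dynamical system $F:\mathbb C^{(2^k)}\to\mathbb C^{(2^k)}$ given by a homogeneous polynomial map of degree $m$, meaning that for every graph $G$ with $k$ distinct marked vertices labeled $1,\dots,k$, $F$ maps the vector $(Z_G(\lambda,\mathbf x))_{\mathbf x\in\{0,1\}^k}$ to the vector $(Z_{\mathcal R(G)}(\lambda,\mathbf x))_{\mathbf x\in\{0,1\}^k}$ (the explicit formula for $F$ is given in the context). The resulting rational map $\widehat F$ on $\mathbb P^{(2^k-1)}$ leaves invariant a manifold $\mathcal M$ of dimension $k$; this manifold depends only on the reduced gluing data $(H,\Phi)$. (2) Furthermore, if the gluing data is stable and expanding, then there is a submanifold $\mathcal M_0\subset\mathcal M$ and an iterate $n$ such that $\mathcal M_0$ consists of fixed points for $\widehat F^n$ and $\mathcal M_0$ is normally superattracting. (3) As a consequence, if the gluing data is stable and expanding, then for any maximally independent starting graph $G_0$ (with $k$ marked vertices labeled $1,\dots,k$), the zeros of the independence polynomials of the recursive graph sequence $(G_n)_{n\ge0}$, $G_{n+1}=\mathcal R(G_n)$, are bounded: there is a constant $C>0$ such that for all $n\ge 0$ every zero $\lambda\in\mathbb C$ of $Z_{G_n}$ satisfies $|\lambda|\le C$.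
   Context: **Graphs and independence polynomials.** A graph $G$ is a finite multi-graph with vertex set $V(G)$ and edge multi-set $E(G)$ of unordered pairs of vertices. A vertex assignment $\sigma:V(G)\to\{0,1\}$ is independent if no two vertices of $\sigma^{-1}(1)$ form an edge. The independence polynomial is $Z_G(\lambda)=\sum_\sigma\lambda^{\#\sigma^{-1}(1)}$, summed over independent assignments. If $G$ has marked vertices $v_1,\dots,v_k$ labeled $1,\dots,k$ and $\mathbf x=(x_1,\dots,x_k)\in\{0,1\}^k$, then $Z_G(\lambda,\mathbf x)$ is the same sum restricted to independent $\sigma$ with $\sigma(v_j)=x_j$ for all $j$. **Gluing data** with parameters $m,k\ge2$ is a quadruple $(H,\Sigma,\Upsilon,\Phi)$: - $H$ is a multi-hypergraph with vertex set $V(H)=\{w_1,\dots,w_m\}$ and edge multi-set $E(H)$ of non-empty subsets of $V(H)$ (a subset may occur several times). Each edge $e$ has a label $\ell(e)\in\{1,\dots,k\}$; each vertex lies in exactly $k$ edges, and these have distinct labels (so for each $j$ the edges labeled $j$ partition $V(H)$). - $\Sigma=(\Sigma_e)_{e\in E(H)}$ is a collection of non-empty connected multi-graphs (connecting graphs), each with a distinguished vertex $v_e\in V(\Sigma_e)$, the root. - $\Upsilon=(\Upsilon_e)_{e\in E(H)}$ is a collection of (not necessarily injective) maps $\Upsilon_e:e\to V(\Sigma_e)$. - $\Phi:\{1,\dots,k\}\to E(H)$ is an injective map. The pair $(H,\Phi)$ is the reduced gluing data. **Graph recursion $\mathcal R$.** Given $G$ with $k$ distinct marked vertices labeled $1,\dots,k$: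 take copies $G(1),\dots,G(m)$ of $G$, with $G(i)$ associated to $w_i$. For each $e=\{w_{i_1},\dots,w_{i_s}\}\in E(H)$, identify the marked vertices labeled $\ell(e)$ in $G(i_1),\dots,G(i_s)$ with the vertices $\Upsilon_e(w_{i_1}),\dots,\Upsilon_e(w_{i_s})$ of $\Sigma_e$, respectively. In the resulting graph, give the label $j\in\{1,\dots,k\}$ to the vertex corresponding to the root of $\Sigma_{\Phi(j)}$. The resulting marked graph is $\mathcal R(G)$. **The map $F$.** Fix $\lambda\in\mathbb C\setminus\{0\}$. Denote the coordinates on $\mathbb C^{(2^k)}$ by $(\mathbf x)$, $\mathbf x\in\{0,1\}^k$. The map $F$ sends the point with coordinates $(\mathbf x)_n$ to the point with coordinates $$(\mathbf x)_{n+1}=\sum_{\mathbf Y=(\mathbf y(1),\dots,\mathbf y(m))\in\{0,1\}^{mk}}\Big(\prod_{i=1}^m(\mathbf y(i))_n\Big)\Big(\prod_{e\in E(H)}\frac{Z_e(\lambda,\mathbf Y,\mathbf x)}{\lambda^{\|\mathbf Y|_e\|}}\Big).$$ Here, for $e\in E(H)$ with label $\ell=\ell(e)$, $\mathbf Y|_e=(y_\ell(i))_{w_i\in e}$ and $\|\mathbf Y|_e\|$ is its number of entries equal to $1$. $Z_e(\lambda,\mathbf Y,\mathbf x)=\sum_\sigma\lambda^{\#\sigma^{-1}(1)}$ is summed over independent vertex assignments $\sigma$ on $\Sigma_e$ with $\sigma(\Upsilon_e(w_i))=y_\ell(i)$ for all $w_i\in e$ and, if $e=\Phi(j)$ for some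 $j$, also $\sigma(v_e)=x_j$ (it is $0$ if these conditions are inconsistent). $\widehat F$ denotes the rational self-map of $\mathbb P^{(2^k-1)}$ induced by $F$; it may have indeterminacy points. Statements on invariance, fixed points and Jacobians of $\widehat F$ and its iterates are understood in the affine chart where the coordinate $(0,\dots,0)$ is non-zero, at points where the rational map is defined with values in this chart. **Dynamics on labels.** $\Lambda:\{1,\dots,k\}\to\{1,\dots,k\}$, $\Lambda(j)=\ell(\Phi(j))$. A label $j$ is periodic if $\Lambda^p(j)=j$ for some $p\ge1$, and critical if $\#\Phi(j)\ge2$. The gluing data is *non-degenerate* if there are no periodic critical labels, and *stable* if it is non-degenerate and $\Sigma_{\Phi(j)}$ is a singleton graph (one vertex) for each periodic label $j$. **Iterates and expansion.** The $n$-th iterate $\mathcal R^n$ is itself the graph recursion of a gluing data $(H_n,\Sigma_n,\Upsilon_n,\Phi_n)$ with parameters $m^n,k$, obtained by repeated composition. The composition of an outer gluing data $(H,\Sigma,\Upsilon,\Phi)$ with an inner one $(H',\Sigma',\Upsilon',\Phi')$ has vertex set $V(H)\times V(H')$ and the following edges: (a) for each $w\in V(H)$ and each $e'\in E(H')$ not in the image of $\Phi'$, the edge $\{w\}\times e'$ with label $\ell'(e')$, connecting graph $\Sigma'_{e'}$, and attaching map and root inherited from $e'$; (b) for each $f\in E(H)$, with $e'=\Phi'(\ell(f))$, the edge $f\times e'$ with label $\ell'(e')$. In case (b) the connecting graph is obtained from $\Sigma_f$ by attaching for each $w\in f$ a copy of $\Sigma'_{e'}$, identifying its root with $\Upsilon_f(w)$;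 the attaching map sends $(w,w')$ to $\Upsilon'_{e'}(w')$ in the copy associated to $w$; the root is $v_f$. The labeling map sends $j$ to the edge of type (b) given by $f=\Phi(j)$. Thus, as a subset of $V(H_n)=V(H)^n$, $\Phi_n(j)=\Phi(j)\times\Phi(\Lambda(j))\times\cdots\times\Phi(\Lambda^{n-1}(j))$. The gluing data is *expanding* if there is $n\ge1$ such that $\Phi_n(j)$ and $\Phi_n(\ell)$ are disjoint subsets of $V(H_n)$ for all distinct labels $j,\ell$. **Normally superattracting.** A $d$-dimensional submanifold $\mathcal M_0$ of fixed points of $\widehat F^n$ is normally superattracting (for $\widehat F^n$) if at each $\xi\in\mathcal M_0$ the Jacobian matrix $J$ of $\widehat F^n$ has spectrum $\{0,1\}$, the generalized eigenspace for the eigenvalue $1$ is $d$-dimensional and equals the tangent space of $\mathcal M_0$ at $\xi$, and $\ker J$ has dimension $2^k-1-d$. **Maximally independent.** For a graph $G$ with marked vertices labeled $1,\dots,k$ and $\mathbf x\in\{0,1\}^k$, an independent set $I\subset V(G)$ agrees with $\mathbf x$ if for each $j$ the marked vertex labeled $j$ lies in $I$ if and only if $x_j=1$. $G$ is maximally independent if for each $\mathbf x\in\{0,1\}^k$ there is among all independent sets agreeing with $\mathbf x$ a unique one $I(\mathbf x)$ of maximal cardinality, and $\#I(1,\dots,1)-\#I(0,\dots,0)=k$. *)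

(* Defs.v *)
From HB Require Import structures.
From mathcomp Require Import all_boot all_order all_algebra.
From mathcomp Require mpoly.

Set Implicit Arguments.
Unset Strict Implicit.
Unset Printing Implicit Defensive.

Import Order.TTheory GRing.Theory Num.Theory.

Local Open Scope ring_scope.

(* Edges are unordered pairs of (distinct) vertices; distinct elements of
   [edge] may have the same ends, which encodes the edge multi-set. *)
Record multigraph := Multigraph {
  vertex : finType;
  edge : finType;
  ends : edge -> {set vertex};
  card_ends : forall a, #|ends a| = 2 }.

Definition adjacent (G : multigraph) : rel (vertex G) :=
  fun u v => [exists a : edge G, ends a == [set u; v]].

Definition connected_graph (G : multigraph) : Prop :=
  forall u v : vertex G, connect (@adjacent G) u v.

(* A vertex assignment sigma : V(G) -> {0,1} is given by the set
   sigma^-1(1). *)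
Definition independent (G : multigraph) (S : {set vertex G}) : bool :=
  [forall a : edge G, ~~ (ends a \subset S)].

Definition indep_poly (A : comPzRingType) (G : multigraph) (lam : A) : A :=
  \sum_(S : {set vertex G} | independent S) lam ^+ #|S|.

Definition cube (k : nat) := {ffun 'I_k -> bool}.

Record marked_graph (k : nat) := MarkedGraph {
  graph_of :> multigraph;
  mark : 'I_k -> vertex graph_of;
  mark_inj : injective mark }.

Definition agrees (k : nat) (G : marked_graph k) (x : cube k)
    (S : {set vertex G}) : bool :=
  [forall j, (mark G j \in S) == x j].

Definition indep_poly_at (A : comPzRingType) (k : nat) (G : marked_graph k)
    (lam : A) (x : cube k) : A :=
  \sum_(S : {set vertex G} | independent S && agrees x S) lam ^+ #|S|.

Definition maximal_agreeing (k : nat) (G : marked_graph k) (x : cube k)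
    (S : {set vertex G}) : Prop :=
  [/\ independent S, agrees x S &
      forall S' : {set vertex G}, independent S' -> agrees x S' ->
        (#|S'| <= #|S|)%N].

Definition maximally_independent (k : nat) (G : marked_graph k) : Prop :=
  exists I : cube k -> {set vertex G},
    (forall x S, maximal_agreeing x S <-> S = I x) /\
    #|I [ffun=> true]| = (#|I [ffun=> false]| + k)%N.

(* The reduced gluing data (H, Phi); the number m of vertices of H is
   #|hvertex|. *)
Record reduced_data (k : nat) := ReducedData {
  hvertex : finType;
  hedge : finType;
  hset : hedge -> {set hvertex};
  label : hedge -> 'I_k;
  phi : 'I_k -> hedge;
  hset_neq0 : forall e, hset e != set0;
  hdegree : forall w, #|[set e | w \in hset e]| = k;
  label_inj : forall w (e f : hedge),
    w \in hset e -> w \in hset f -> label e = label f -> e = f;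
  phi_inj : injective phi }.

(* The remaining data (Sigma, Upsilon). *)
Record connecting_data (k : nat) (r : reduced_data k) := ConnectingData {
  cgraph : hedge r -> multigraph;
  cgraph_connected : forall e, connected_graph (cgraph e);
  croot : forall e, vertex (cgraph e);
  attach : forall e, {w : hvertex r | w \in hset e} -> vertex (cgraph e) }.

Lemma edge_at_exists (k : nat) (r : reduced_data k) (w : hvertex r)
    (j : 'I_k) : exists e : hedge r, (w \in hset e) && (label e == j).
Proof.
pose A := [set e : hedge r | w \in hset e].
have inj : {in A &, injective (@label k r)}.
  by move=> e f; rewrite !inE => ew fw; apply: label_inj ew fw.
have : [set label e | e in A] = [set: 'I_k].
  apply/eqP; rewrite eqEcard subsetT /= cardsT card_ord.
  by rewrite card_in_imset // hdegree.
move/setP/(_ j); rewrite in_setT => /imsetP[e].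
by rewrite inE => ew ->; exists e; rewrite ew eqxx.
Qed.

Definition edge_at (k : nat) (r : reduced_data k) (w : hvertex r) (j : 'I_k) :
  hedge r := xchoose (edge_at_exists w j).

Lemma edge_at_in (k : nat) (r : reduced_data k) (w : hvertex r) (j : 'I_k) :
  w \in hset (edge_at w j).
Proof. by case/andP: (xchooseP (edge_at_exists w j)). Qed.

Lemma label_edge_at (k : nat) (r : reduced_data k) (w : hvertex r)
  (j : 'I_k) : label (edge_at w j) = j.
Proof. by case/andP: (xchooseP (edge_at_exists w j)) => _ /eqP. Qed.

Lemma edge_at_degree (k : nat) (V E : finType) (h : E -> {set V})
    (l : E -> 'I_k) (w : V) :
  (forall j, exists2 e, w \in h e & l e = j) ->
  (forall e f, w \in h e -> w \in h f -> l e = l f -> e = f) ->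
  #|[set e | w \in h e]| = k.
Proof.
move=> ex inj; rewrite -[RHS]card_ord -cardsT.
rewrite -(@card_in_imset _ _ l); last first.
  by move=> e f; rewrite !inE; apply: inj.
congr #|pred_of_set _|; apply/setP => j; rewrite in_setT.
by case: (ex j) => e ew <-; apply: imset_f; rewrite inE.
Qed.

(* Each equivalence class of identified vertices contains either one unmarked
   vertex of one copy of G, or exactly one vertex of one connecting graph.
   So no quotient is needed: [glued_vertex] is the set of classes and
   [glue w v] the class of the vertex v of the copy of G indexed by w. *)
Section Recursion.
Variables (k : nat) (r : reduced_data k) (c : connecting_data r).
Variable G : marked_graph k.

Definition glued_vertex : finType :=
  ((hvertex r * {v : vertex G | v \notin codom (mark G)})
   + {e : hedge r & vertex (cgraph c e)})%type.

Definition connecting_vertex (e : hedge r) (v : vertex (cgraph c e)) :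
  glued_vertex := inr (Tagged (fun e => vertex (cgraph c e)) v).

Definition glue (w : hvertex r) (v : vertex G) : glued_vertex :=
  match decP (@idP (v \in codom (mark G))) with
  | left marked =>
      let j := iinv marked in
      connecting_vertex (attach c (exist _ w (edge_at_in w j)))
  | right unmarked => inl (w, exist _ v (introN idP unmarked))
  end.

Definition glued_edge : finType :=
  ((hvertex r * edge G) + {e : hedge r & edge (cgraph c e)})%type.

Definition glued_ends (a : glued_edge) : {set glued_vertex} :=
  match a with
  | inl (w, b) => [set glue w v | v in ends b]
  | inr b =>
      [set connecting_vertex v | v in ends (tagged b)]
  end.

Lemma connecting_vertex_inj e : injective (@connecting_vertex e).
Proof. by move=> u v [] /eqP; rewrite eq_Tagged => /eqP. Qed.

Lemma glue_inj w : injective (glue w).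
Proof.
move=> u v; rewrite /glue.
case: decP => mu; case: decP => mv //=.
- move=> /(congr1 (fun z => if z is inr t then label (tag t) else
    label (phi r (iinv mu)))) /=.
  rewrite !label_edge_at => eq_iinv.
  by rewrite -(f_iinv mu) -(f_iinv mv) eq_iinv.
- by case.
Qed.

Lemma card_glued_ends a : #|glued_ends a| = 2.
Proof.
case: a => [[w b]|b] /=.
  by rewrite (card_imset _ (@glue_inj w)) card_ends.
by rewrite (card_imset _ (@connecting_vertex_inj _)) card_ends.
Qed.

Definition glued_graph : multigraph := Multigraph card_glued_ends.

Definition glued_mark (j : 'I_k) : vertex glued_graph :=
  connecting_vertex (croot c (phi r j)).

Lemma glued_mark_inj : injective glued_mark.
Proof.
move=> i j.
move=> /(congr1 (fun z : glued_vertex =>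
  if z is inr t then tag t else phi r i)) /=.
exact: phi_inj.
Qed.

Definition recursion : marked_graph k := MarkedGraph glued_mark_inj.

End Recursion.

Definition label_map (k : nat) (r : reduced_data k) (j : 'I_k) : 'I_k :=
  label (phi r j).

Definition periodic_label (k : nat) (r : reduced_data k) (j : 'I_k) : Prop :=
  exists2 p, (0 < p)%N & iter p (label_map r) j = j.

Definition critical_label (k : nat) (r : reduced_data k) (j : 'I_k) : Prop :=
  (2 <= #|hset (phi r j)|)%N.

Definition non_degenerate (k : nat) (r : reduced_data k) : Prop :=
  forall j, ~ (periodic_label r j /\ critical_label r j).

Definition stable (k : nat) (r : reduced_data k) (c : connecting_data r) :
    Prop :=
  non_degenerate r /\
  forall j, periodic_label r j -> #|vertex (cgraph c (phi r j))| = 1.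

(* Composition of the outer data [r] with the inner data [s]. *)
Section Composition.
Variables (k : nat) (r s : reduced_data k).

Definition comp_vertex : finType := (hvertex r * hvertex s)%type.

Definition comp_edge : finType :=
  ((hvertex r * {e : hedge s | e \notin codom (phi s)}) + hedge r)%type.

Definition comp_set (a : comp_edge) : {set comp_vertex} :=
  match a with
  | inl (w, e) => setX [set w] (hset (val e))
  | inr f => setX (hset f) (hset (phi s (label f)))
  end.

Definition comp_label (a : comp_edge) : 'I_k :=
  match a with
  | inl (_, e) => label (val e)
  | inr f => label (phi s (label f))
  end.

Definition comp_phi (j : 'I_k) : comp_edge := inr (phi r j).

Lemma comp_set_neq0 a : comp_set a != set0.
Proof.
case: a => [[w e]|f] /=.
  have /set0Pn[u eu] := hset_neq0 (val e).
  by apply/set0Pn; exists (w, u); rewrite in_setX set11.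
have /set0Pn[w fw] := hset_neq0 f.
have /set0Pn[u eu] := hset_neq0 (phi s (label f)).
by apply/set0Pn; exists (w, u); rewrite in_setX fw.
Qed.

Lemma comp_label_inj w (a b : comp_edge) :
  w \in comp_set a -> w \in comp_set b -> comp_label a = comp_label b ->
  a = b.
Proof.
case: w => w u; case: a => [[w1 e1]|f1]; case: b => [[w2 e2]|f2] /=;
  rewrite !in_setX /= ?in_set1.
- move=> /andP[/eqP <- ue1] /andP[/eqP <- ue2] /(label_inj ue1 ue2) e12.
  by congr (inl (_, _)); apply: val_inj.
- move=> /andP[_ ue1] /andP[_ ue2] /(label_inj ue1 ue2) e1E.
  by have := valP e1; rewrite /= e1E codom_f.
- move=> /andP[_ ue1] /andP[_ ue2] /(label_inj ue1 ue2) e2E.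
  by have := valP e2; rewrite /= -e2E codom_f.
- move=> /andP[wf1 ue1] /andP[wf2 ue2] /(label_inj ue1 ue2) /phi_inj.
  by move=> /(label_inj wf1 wf2) ->.
Qed.

Lemma comp_degree w : #|[set a | w \in comp_set a]| = k.
Proof.
apply: (@edge_at_degree _ _ _ _ comp_label); last exact: comp_label_inj.
case: w => w u j; pose e := edge_at u j.
case: (boolP (e \in codom (phi s))) => [/codomP[i ei]|nphi].
  exists (inr (edge_at w i)) => /=.
    by rewrite in_setX edge_at_in label_edge_at -ei edge_at_in.
  by rewrite label_edge_at -ei label_edge_at.
exists (inl (w, exist _ e nphi)) => /=; last exact: label_edge_at.
by rewrite in_setX set11 edge_at_in.
Qed.

Lemma comp_phi_inj : injective comp_phi.
Proof. by move=> i j [] /phi_inj. Qed.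

Definition compose_data : reduced_data k :=
  @ReducedData k comp_vertex comp_edge comp_set comp_label comp_phi
    comp_set_neq0 comp_degree comp_label_inj comp_phi_inj.

End Composition.

(* (H_n, Phi_n), for n >= 1. *)
Definition iterate_data (k : nat) (r : reduced_data k) (n : nat) :
  reduced_data k := iter n.-1 (compose_data r) r.

Definition expanding (k : nat) (r : reduced_data k) : Prop :=
  exists2 n, (0 < n)%N & forall j l, j != l ->
    [disjoint hset (phi (iterate_data r n) j)
            & hset (phi (iterate_data r n) l)].

(* The notations of mpoly clash with those of the analysis library required
   below, so mpoly is imported in this module only. *)
Module PolynomialMap.
Import mpoly.

Definition homogeneous_polynomial_map (C : comNzRingType) (T : finType)
    (m : nat) (f : {ffun T -> C} -> {ffun T -> C}) : Prop :=
  exists P : T -> {mpoly C[#|T|]},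
    (forall x, P x \is m.-homog) /\
    forall v x, f v x = (P x).@[fun i => v (enum_val i)].

End PolynomialMap.
Export PolynomialMap.

(* Required only here, so that [set0], [setX] and so on denote finite sets in
   the combinatorial part above. *)
From mathcomp Require Import boolp classical_sets functions reals topology.
From mathcomp Require Import normedtype landau derive.
From mathcomp Require Import complex.

Import numFieldNormedType.Exports.

Local Open Scope classical_set_scope.

Section Dynamics.
Variables (K : numFieldType) (k : nat) (r : reduced_data k).
Variable c : connecting_data r.
Variable lam : K.

Definition Z_edge (e : hedge r) (Y : {ffun hvertex r -> cube k})
    (x : cube k) : K :=
  \sum_(S : {set vertex (cgraph c e)} |
      [&& independent S,
          [forall w : {w : hvertex r | w \in hset e},
             (attach c w \in S) == Y (val w) (label e)] &
          [forall j, (phi r j == e) ==> ((croot c e \in S) == x j)]])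
    lam ^+ #|S|.

Definition F (v : {ffun cube k -> K}) : {ffun cube k -> K} :=
  [ffun x => \sum_(Y : {ffun hvertex r -> cube k})
     (\prod_(w : hvertex r) v (Y w)) *
     \prod_(e : hedge r)
       (Z_edge e Y x / lam ^+ #|[set w in hset e | Y w (label e)]%SET|)].

End Dynamics.

Definition cube0 (k : nat) : cube k := [ffun=> false].
Definition nzcube (k : nat) := {x : cube k | x != cube0 k}.

(* C^(2^k - 1), with coordinates indexed by the non-zero elements of
   {0,1}^k through [enum_val] and [enum_rank]. *)
Definition chart (K : numFieldType) (k : nat) := 'rV[K]_#|{: nzcube k}|.

Definition homogenize (K : numFieldType) (k : nat) (xi : chart K k) :
    {ffun cube k -> K} :=
  [ffun x => if insub x is Some u then xi ord0 (enum_rank (u : nzcube k))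
             else 1].

Definition dehomogenize (K : numFieldType) (k : nat) (v : {ffun cube k -> K}) :
    chart K k :=
  \row_i (v (val (enum_val i)) / v (cube0 k)).

(* The n-th iterate of the rational map induced by F is defined at xi, with
   value in the chart. *)
Definition Fhat_defined (K : numFieldType) (k : nat) (r : reduced_data k)
    (c : connecting_data r) (lam : K) (n : nat) (xi : chart K k) : Prop :=
  iter n (F c lam) (homogenize xi) (cube0 k) != 0.

(* Meaningful only where [Fhat_defined] holds. *)
Definition Fhat (K : numFieldType) (k : nat) (r : reduced_data k)
    (c : connecting_data r) (lam : K) (n : nat) (xi : chart K k) :
    chart K k :=
  dehomogenize (iter n (F c lam) (homogenize xi)).

(* These definitions are used with K the field of complex numbers;
   [differentiable] is over K, so it then means holomorphic on open sets. *)
Definition biholomorphic_on (K : numFieldType) (N : nat)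
    (U : set 'rV[K]_N) (f : 'rV[K]_N -> 'rV[K]_N) : Prop :=
  [/\ open U, open (f @` U), {in U, forall p, differentiable f p} &
      exists g : 'rV[K]_N -> 'rV[K]_N,
        {in U, forall p, g (f p) = p} /\
        {in f @` U, forall q, differentiable g q}].

Definition submanifold (K : numFieldType) (N : nat) (d : nat)
    (M : set 'rV[K]_N) : Prop :=
  (d <= N)%N /\
  forall p, M p -> exists (U : set 'rV[K]_N) f,
    [/\ U p, biholomorphic_on U f &
        forall q, U q ->
          (M q <-> forall i : 'I_N, (d <= i)%N -> f q ord0 i = 0)].

(* Velocities at p of the holomorphic curves in M through p. *)
Definition tangent_space (K : numFieldType) (N : nat) (M : set 'rV[K]_N)
    (p : 'rV[K]_N) : set 'rV[K]_N :=
  [set v | exists g : K -> 'rV[K]_N,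
     [/\ g 0 = p,
         \forall t \near (0 : K), M (g t) /\ derivable g t 1 &
         'D_1 g 0 = v]].

(* The Jacobian matrix acts on row vectors on the right: v *m 'J f p is the
   image of v by the differential of f at p. *)
Definition normally_superattracting (K : numFieldType) (k : nat)
    (f : chart K k -> chart K k) (d : nat) (M0 : set (chart K k)) : Prop :=
  forall xi, M0 xi ->
    let J := 'J f xi in
    [/\ differentiable f xi,
        forall a, eigenvalue J a <-> a = 0 \/ a = 1,
        \rank (geigenspace J 1) = d,
        tangent_space M0 xi = [set v | (v <= geigenspace J 1)%MS] &
        \rank (kermx J) = (2 ^ k - 1 - d)%N].

(* Main.v *)
Require Import Defs.
From HB Require Import structures.
From mathcomp Require Import all_boot all_order all_algebra.
From mathcomp Require Import fingroup perm.
From mathcomp Require Import ring lra.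
From mathcomp Require mpoly.

Set Implicit Arguments.
Unset Strict Implicit.
Unset Printing Implicit Defensive.

Import Order.TTheory GRing.Theory Num.Theory.

Local Open Scope ring_scope.

(** Give every edge [e] of the hypergraph the weight [W e S b]: the sum over the
    independent sets of its connecting graph for which [S] is the set of the
    copies that are attached at an occupied vertex and [b] is the bit of the
    root, divided by [lam ^+ #|S|]. The recursion then becomes a sum over
    patterns, one at each vertex of the hypergraph, of a product of vertex
    terms and edge weights ([F_weighted], [F_recursion]).
    Each vertex meets each label in exactly one edge, and an edge reads only
    the bits at its own label. Hence at a tensor, [x] going to the product of
    the [a j (x j)], the sum factors over the edges, and the result is a
    constant times a tensor whose [j]-th factor is the edge sum at [phi j]
    ([polarized_tensorE]). So the tensors, in the chart a graph over the [k]
    coordinates at the patterns with a single bit, form the invariant manifold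
    ([segre_submanifold], [segre_set_invariant]); no weight enters its
    definition.

    Composing gluing data composes the maps ([weighted_map_compose]), so an
    iterate of the recursion has the same form as the recursion itself. If the
    data are expanding, a high iterate has pairwise disjoint marked edges, and
    the exponent can be chosen such that the label map of the iterate is
    idempotent ([expanding_idempotent_iterate]). Disjointness means that one
    copy of the input influences at most one factor of the output; therefore
    the derivative at a tensor, in whatever direction, only changes the
    factors one at a time, that is, it is tangent to the tensors
    ([linearized_tensorE], [diff_chart_map_tangent]). The [j]-th factor of the
    image of a tensor depends only on the factor at the label that [j] is
    mapped to, and by stability the factors at fixed labels are passed on
    unchanged ([stable_identity_edge]). So on tensors the iterate is a
    retraction onto its fixed points, which are a graph over the coordinates
    at the fixed labels ([fixed_set_submanifold]). At such a point the
    differential first maps into the tangent space of the tensors and then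
    acts as the differential of a retraction. Its square is thus idempotent,
    with the tangent space of the fixed points as its image, which is normal
    superattraction of the doubled iterate ([fixed_point_superattracting]).

    For the zeros, let the parameter go to infinity. The independence sums of
    a maximally independent graph have as leading terms a constant times the
    tensor with factors 1 and [lam] ([maximally_independent_near]). Follow this
    tensor under the recursion and divide it out. All quantities are Laurent
    polynomials with nonnegative coefficients, so they do not cancel
    ([positive_laurent_dominate]), the normalized weights stay bounded
    ([kernel_bounded]), and the constant vector 1 becomes a fixed point. By
    stability the reference tensor is stationary after finitely many steps, so
    from then on a single map is iterated. Near the constant vector, the
    deviation from the tensors decays quadratically, and the drift of the
    factors at fixed labels is linear in this deviation, hence summable
    ([local_step], [local_dynamics]). So, for all large parameters at once,
    the normalized vectors stay near a nonzero constant vector, and the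
    independence polynomial, which is their sum against the reference tensor,
    does not vanish ([sum_near_neq0], [independence_zeros_bounded]). *)

(** * Weighted sums over a gluing pattern *)

Section Kernel.
Variables (A : comNzRingType) (k : nat).

Definition tensor (a : 'I_k -> bool -> A) : {ffun cube k -> A} :=
  [ffun x : cube k => \prod_j a j (x j)].

Variable r : reduced_data k.

(** Edges outside the image of [phi] get the bit [false], so that one type of
    weights serves edges with and without a root condition. *)
Definition root_bit (x : cube k) (e : hedge r) : bool :=
  [exists j, (phi r j == e) && x j].

Definition column (Y : {ffun hvertex r -> cube k}) (e : hedge r) :
  {set hvertex r} := [set w in hset e | Y w (label e)].

(** The set consists of the vertices of the edge whose bit at its label is 1;
    the last argument is the bit of the root. *)
Definition weight := hedge r -> {set hvertex r} -> bool -> A.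

Variable W : weight.

(** Different arguments at different vertices are needed both to compose two
    such maps and to differentiate one. *)
Definition polarized_map (u : hvertex r -> {ffun cube k -> A}) :
    {ffun cube k -> A} :=
  [ffun x => \sum_(Y : {ffun hvertex r -> cube k})
     (\prod_w u w (Y w)) * \prod_e W e (column Y e) (root_bit x e)].

Definition weighted_map (v : {ffun cube k -> A}) : {ffun cube k -> A} :=
  polarized_map (fun=> v).

Definition edge_sum (e : hedge r) (u : hvertex r -> bool -> A) (b : bool) : A :=
  \sum_(S : {set hvertex r} | S \subset hset e)
    (\prod_(w in hset e) u w (w \in S)) * W e S b.

Lemma root_bit_phi x j : root_bit x (phi r j) = x j.
Proof.
apply/existsP/idP => [[i /andP[/eqP/phi_inj -> //]]|xj].
by exists j; rewrite eqxx.
Qed.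

Lemma root_bit_nphi x e : e \notin codom (phi r) -> root_bit x e = false.
Proof.
move=> ne; apply/existsP => -[i /andP[/eqP ei _]].
by move: ne; rewrite -ei codom_f.
Qed.

Lemma edge_at_label (w : hvertex r) (e : hedge r) :
  w \in hset e -> edge_at w (label e) = e.
Proof.
move=> we; apply: (label_inj (edge_at_in _ _) we).
exact: label_edge_at.
Qed.

(** A pair of a vertex and a label is the same as an incidence between a vertex
    and an edge, because the edges at a vertex have each label once. *)
Lemma prod_labels_edges (B : comNzRingType) (g : hvertex r -> 'I_k -> B) :
  \prod_w \prod_j g w j = \prod_e \prod_(w in hset e) g w (label e).
Proof.
rewrite [RHS](exchange_big_dep predT) //=; apply: eq_bigr => w _.
rewrite [RHS](reindex_onto (fun j => edge_at w j) (fun e => label e)) /=.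
  apply: eq_big => [j|j _]; first by rewrite edge_at_in label_edge_at eqxx.
  by rewrite label_edge_at.
by move=> e we; exact: edge_at_label.
Qed.

Lemma column_sub Y e : column Y e \subset hset e.
Proof. by apply/subsetP => w; rewrite inE => /andP[]. Qed.

(** Choosing a pattern at every vertex amounts to choosing, independently for
    every edge, the set of its vertices whose bit at its label is 1;
    distributivity then gives a product over the edges. *)
Lemma polarized_tensor (u : hvertex r -> 'I_k -> bool -> A) x :
  polarized_map (fun w => tensor (u w)) x =
  \prod_e edge_sum e (fun w => u w (label e)) (root_bit x e).
Proof.
rewrite ffunE.
transitivity (\sum_(Y : {ffun hvertex r -> cube k}) \prod_e
  ((\prod_(w in hset e) u w (label e) (w \in column Y e)) *
    W e (column Y e) (root_bit x e))).
  apply: eq_bigr => Y _; rewrite big_split /=; congr (_ * _).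
  transitivity (\prod_w \prod_j u w j (Y w j)).
    by apply: eq_bigr => w _; rewrite ffunE.
  rewrite prod_labels_edges; apply: eq_bigr => e _; apply: eq_bigr => w we.
  by rewrite inE we.
rewrite /edge_sum (big_distr_big_dep set0) /=.
(* The bit of w at label j is read off the edge through w labeled j. *)
pose toY (f : {ffun hedge r -> {set hvertex r}}) : {ffun hvertex r -> cube k} :=
  [ffun w => [ffun j => w \in f (edge_at w j)]].
rewrite [RHS](reindex_onto (fun Y => [ffun e => column Y e]) toY) /=.
  apply: eq_big => [Y|Y _]; last first.
    by apply: eq_bigr => e _; rewrite ffunE.
  symmetry; apply/andP; split.
    apply/pfamilyP; split; first by apply/subsetP.
    by move=> e _; rewrite ffunE unfold_in column_sub.
  apply/eqP/ffunP => w; apply/ffunP => j.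
  by rewrite !ffunE inE edge_at_in label_edge_at.
move=> f /pfamilyP[_ fP]; apply/ffunP => e; rewrite ffunE.
apply/setP => w; rewrite inE !ffunE.
have := fP e isT; rewrite unfold_in => /subsetP fe.
apply/andP/idP => [[we]|wf]; first by rewrite edge_at_label.
by have we := fe _ wf; split => //; rewrite edge_at_label.
Qed.

Lemma prod_root_bit (G : hedge r -> bool -> A) x :
  \prod_e G e (root_bit x e) =
  (\prod_(e | e \notin codom (phi r)) G e false) * \prod_j G (phi r j) (x j).
Proof.
rewrite (bigID (mem (codom (phi r)))) /= mulrC; congr (_ * _).
  by apply: eq_bigr => e ne; rewrite root_bit_nphi.
rewrite (eq_bigl (mem (phi r @: setT))) => [|e]; last first.
  by apply/codomP/imsetP => [[j ->]|[j _ ->]]; exists j.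
rewrite big_imset => [|i j _ _ /phi_inj //].
by apply: eq_big => [j|j _]; rewrite ?in_setT ?root_bit_phi.
Qed.

Definition unrooted_factor (u : hvertex r -> 'I_k -> bool -> A) : A :=
  \prod_(e | e \notin codom (phi r)) edge_sum e (fun w => u w (label e)) false.

Definition root_factor (u : hvertex r -> 'I_k -> bool -> A) (j : 'I_k) :
    bool -> A :=
  edge_sum (phi r j) (fun w => u w (label_map r j)).

(** The bit [x j] is seen by the edge [phi j] only, so tensors are mapped to a
    constant times a tensor. *)
Lemma polarized_tensorE (u : hvertex r -> 'I_k -> bool -> A) :
  polarized_map (fun w => tensor (u w)) =
  [ffun x => unrooted_factor u * tensor (root_factor u) x].
Proof.
apply/ffunP => x; rewrite polarized_tensor ffunE.
by rewrite (prod_root_bit (fun e => edge_sum e (fun w => u w (label e)))) ffunE.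
Qed.

Lemma edge_sum_eq e u1 u2 b :
  (forall w, w \in hset e -> u1 w =1 u2 w) -> edge_sum e u1 b = edge_sum e u2 b.
Proof.
move=> eu; apply: eq_bigr => S _; congr (_ * _).
by apply: eq_bigr => w we; rewrite eu.
Qed.

End Kernel.

Section Compose.
Variables (A : comNzRingType) (k : nat) (r s : reduced_data k).
Variables (W : weight A r) (W' : weight A s).

Definition slice (S : {set comp_vertex r s}) (w : hvertex r) :
  {set hvertex s} := [set u | (w, u) \in S].

(** An inner root that is glued to the outer structure passes its weight, as a
    function of its bit, to the outer edge as an input. *)
Definition compose_weight : weight A (compose_data r s) :=
  fun (a : comp_edge r s) (S : {set comp_vertex r s}) b =>
  match a with
  | inl (w, e) => W' (val e) (slice S w) b
  | inr f => edge_sum W f (fun w => W' (phi s (label f)) (slice S w)) b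
  end.

(** Once the patterns of all inner copies are chosen, the weights of the inner
    marked edges are a tensor as a function of the outer pattern, so the sum
    over the outer patterns factors by [polarized_tensor]. *)
Lemma weighted_map_compose v :
  weighted_map compose_weight v = weighted_map W (weighted_map W' v).
Proof.
apply/ffunP => x; rewrite 2!ffunE.
transitivity (\sum_(Y : {ffun hvertex r -> cube k})
  \sum_(T : {ffun hvertex r -> {ffun hvertex s -> cube k}})
    \prod_w ((\prod_u v (T w u)) *
     ((\prod_(e | e \notin codom (phi s)) W' e (column (T w) e) false) *
     \prod_j W' (phi s j) (column (T w) (phi s j)) (Y w j))) *
     \prod_e W e (column Y e) (root_bit x e)); last first.
  apply: eq_bigr => Y _; rewrite -big_distrl /=; congr (_ * _).
  rewrite -(bigA_distr_bigA (fun w (T : {ffun hvertex s -> cube k}) =>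
    (\prod_u v (T u)) *
     ((\prod_(e | e \notin codom (phi s)) W' e (column T e) false) *
     \prod_j W' (phi s j) (column T (phi s j)) (Y w j)))).
  apply: eq_bigr => w _; rewrite ffunE; apply: eq_bigr => T _.
  by rewrite (prod_root_bit (fun e => W' e (column T e))).
rewrite exchange_big /=.
pose cur (Y : {ffun hvertex (compose_data r s) -> cube k}) :
  {ffun hvertex r -> {ffun hvertex s -> cube k}} :=
  [ffun w => [ffun u => Y (w, u)]].
pose unc (T : {ffun hvertex r -> {ffun hvertex s -> cube k}}) :
  {ffun hvertex (compose_data r s) -> cube k} :=
  [ffun p : comp_vertex r s => T p.1 p.2].
have uncK : cancel unc cur.
  by move=> T; apply/ffunP => w; apply/ffunP => u; rewrite !ffunE.
have curK : cancel cur unc.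
  by move=> Y; apply/ffunP => -[w u]; rewrite !ffunE.
rewrite (reindex unc) /=; last by exists cur => ? _.
apply: eq_bigr => T _.
under [RHS]eq_bigr => Y _ do rewrite 2!big_split /= -!mulrA.
rewrite -!big_distrr /=; congr (_ * _).
  rewrite pair_big /=; apply: eq_big => [[w u] //|[w u] _].
  by rewrite ffunE.
have colE w (e : hedge s) (S : {set comp_vertex r s}) :
    (forall u, ((w, u) \in S) = (u \in hset e) && T w u (label e)) ->
    slice S w = column (T w) e.
  by move=> SE; apply/setP => u; rewrite !inE SE.
have -> : \sum_(Y : {ffun hvertex r -> cube k})
      (\prod_w \prod_j W' (phi s j) (column (T w) (phi s j)) (Y w j)) *
      \prod_e W e (column Y e) (root_bit x e) =
   polarized_map W (fun w => tensor
     (fun j => W' (phi s j) (column (T w) (phi s j)))) x.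
  rewrite [RHS]ffunE; apply: eq_bigr => Y _; congr (_ * _).
  by apply: eq_bigr => w _; rewrite ffunE.
rewrite polarized_tensor big_sumType /=; congr (_ * _).
  pose G w (e : {e : hedge s | e \notin codom (phi s)}) :=
    W' (val e) (slice (column (unc T) (inl (w, e))) w)
      (root_bit x (inl (w, e) : hedge (compose_data r s))).
  transitivity (\prod_w \prod_e G w e).
    by rewrite pair_big; apply: eq_big => -[].
  apply: eq_bigr => w _.
  rewrite [RHS](reindex_omap
    (fun e : {e : hedge s | e \notin codom (phi s)} => val e) insub) /=.
    apply: eq_big => [e|e _]; first by rewrite (valP e) valK eqxx.
    rewrite /G root_bit_nphi; last by apply/codomP => -[].
    congr (W' _ _ _); apply: colE => u.
    by rewrite inE ffunE /= in_setX in_set1 eqxx.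
  by move=> e ne; rewrite insubT.
apply: eq_bigr => f _.
have -> : root_bit x (inr f : hedge (compose_data r s)) = root_bit x f.
  by apply: eq_existsb => j.
apply: edge_sum_eq => w wf b; congr (W' _ _ _).
apply: colE => u; rewrite inE ffunE /= in_setX wf.
by rewrite -/(label_map s (label f)).
Qed.

(** An edge consisting of one vertex whose weight forces the root bit to be
   the bit of this vertex passes its input on unchanged. *)
Definition identity_edge (q : reduced_data k) (U : weight A q) (e : hedge q) :=
  exists w, hset e = [set w] /\ forall S b, U e S b = ((w \in S) == b)%:R.

Lemma edge_sum_identity (q : reduced_data k) (U : weight A q) e :
  identity_edge U e ->
  exists2 w, w \in hset e & forall u b, edge_sum U e u b = u w b.
Proof.
move=> [w [ew UE]]; exists w; first by rewrite ew set11.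
move=> u b; rewrite /edge_sum.
rewrite (bigD1 (if b then [set w] else set0)) /=; last first.
  by rewrite ew; case: b; rewrite ?subxx ?sub0set.
rewrite [X in _ + X]big1 => [|S /andP[Sw SN]].
  by rewrite addr0 ew big_set1 UE; case: b; rewrite ?set11 ?in_set0 eqxx mulr1.
rewrite UE; case: eqP => [wS|]; last by rewrite mulr0.
case/negP: SN; apply/eqP/setP => v.
move: Sw; rewrite ew => /subsetP Sw.
case: b wS => wS; rewrite ?inE.
  by apply/idP/eqP => [/Sw /set1P //|->].
by apply/idP => vS; move: wS; rewrite -(set1P (Sw v vS)) vS.
Qed.

Lemma identity_edge_compose f :
  identity_edge W f -> identity_edge W' (phi s (label f)) ->
  identity_edge compose_weight (inr f : hedge (compose_data r s)).
Proof.
move=> Wf [w' [ew' W'E]].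
have [w0 w0f WfE] := edge_sum_identity Wf.
case: Wf => w [ew _]; move: w0f; rewrite ew => /set1P ?; subst w0.
exists (w, w'); split.
  by apply/setP => -[u u']; rewrite /= ew ew' in_setX !inE xpair_eqE.
by move=> S b; rewrite /= WfE W'E inE.
Qed.

End Compose.

(** * Iterates *)

Section Iterate.
Variables (A : comNzRingType) (k : nat) (r : reduced_data k).

(** As for [iter n (compose_data r) r], the index [n] stands for [n.+1]
    applications of the recursion. *)
Fixpoint iterate_weight (W : weight A r) (n : nat) :
    weight A (iter n (compose_data r) r) :=
  match n return weight A (iter n (compose_data r) r) with
  | 0 => W
  | n'.+1 => compose_weight W (@iterate_weight W n')
  end.
Arguments iterate_weight : clear implicits.

Lemma iterate_weightE W n v :
  weighted_map (iterate_weight W n) v = iter n.+1 (weighted_map W) v.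
Proof.
elim: n v => [//|n IHn] v.
by rewrite [iterate_weight _ _]/= weighted_map_compose IHn.
Qed.

Lemma label_map_iterate n j :
  label_map (iter n (compose_data r) r) j = iter n.+1 (label_map r) j.
Proof.
elim: n j => [//|n IHn] j.
by rewrite [RHS]iterSr -IHn.
Qed.

Lemma periodic_label_map j : periodic_label r j -> periodic_label r (label_map r j).
Proof. by case=> p p0 pj; exists p => //; rewrite -iterSr iterS pj. Qed.

Lemma identity_edge_iterate W n :
  (forall j, periodic_label r j -> identity_edge W (phi r j)) ->
  forall j, periodic_label r j ->
    identity_edge (iterate_weight W n) (phi (iter n (compose_data r) r) j).
Proof.
move=> Wid; elim: n => [//|n IHn] j pj.
by apply: identity_edge_compose; [exact: Wid|exact/IHn/periodic_label_map].
Qed.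

Definition separated (s : reduced_data k) :=
  forall j l, j != l -> [disjoint hset (phi s j) & hset (phi s l)].

(** Two distinct edges with the same label never meet, so composing on the
   outside cannot destroy disjointness. *)
Lemma separated_compose s : separated s -> separated (compose_data r s).
Proof.
move=> sep j l jl; apply/pred0P => -[w u] /=; rewrite !in_setX /=.
apply/negP => /andP[/andP[wj uj] /andP[wl ul]].
have [eq_lab|/sep/disjointFr/(_ uj)] := eqVneq (label (phi r j)) (label (phi r l)).
  by move/negP: jl; apply; apply/eqP/(@phi_inj k r)/(label_inj wj wl).
by rewrite ul.
Qed.

Lemma expanding_separated : expanding r ->
  exists N, forall n, (N <= n)%N -> separated (iter n (compose_data r) r).
Proof.
case=> -[//|N] _ sepN; exists N => n /subnK <-.
by elim: (n - N)%N => [|d IHd]; [exact: sepN|exact: separated_compose].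
Qed.

(** Two of the iterates coincide; an exponent beyond the smaller one and
    divisible by their difference gives an idempotent iterate. *)
Lemma iter_idempotent (T : finType) (f : T -> T) N :
  exists2 n, (N <= n)%N & forall x, iter n.+1 f (iter n.+1 f x) = iter n.+1 f x.
Proof.
pose g (i : 'I_(#|{ffun T -> T}|.+1)) : {ffun T -> T} := [ffun x => iter i f x].
have /injectivePn[a [b ab gab]] : ~~ injectiveb g.
  by apply/injectiveP => /leq_card; rewrite card_ord ltnn.
wlog ltab : a b ab gab / (a < b)%N.
  move=> H; case: (ltngtP a b) => [|/(H b a)|/val_inj/eqP]; first exact: H.
  - by apply => //; rewrite eq_sym.
  - by rewrite (negbTE ab).
have per i x : (a <= i)%N -> iter (i + (b - a)) f x = iter i f x.
  move=> /subnK <-; rewrite -addnA subnKC ?(ltnW ltab) //.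
  rewrite !iterD; congr iter.
  by move/ffunP/(_ x): gab; rewrite !ffunE.
have perM i x q : (a <= i)%N -> iter (i + q * (b - a)) f x = iter i f x.
  move=> ai; elim: q => [|q IHq]; first by rewrite mul0n addn0.
  by rewrite mulSn addnA addnAC per ?IHq // (leq_trans ai) // leq_addr.
have ba0 : (0 < b - a)%N by rewrite subn_gt0.
pose n := ((a + N.+1) * (b - a))%N.
have nge : (a + N.+1 <= n)%N by rewrite leq_pmulr.
have n0 : (0 < n)%N by rewrite (leq_trans _ nge) // addnS.
exists n.-1 => [|x].
  by rewrite -ltnS prednK // (leq_trans _ nge) // addnS ltnS leq_addl.
rewrite prednK // -iterD [in (n + n)%N]/n perM //.
by rewrite (leq_trans _ nge) // leq_addr.
Qed.

Lemma expanding_idempotent_iterate : expanding r ->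
  exists n, separated (iter n (compose_data r) r) /\
    forall j, let s := label_map (iter n (compose_data r) r) in s (s j) = s j.
Proof.
case/expanding_separated => N sepN.
have [n Nn idem] := iter_idempotent (label_map r) N.
by exists n; split; [exact: sepN|move=> j /=; rewrite !label_map_iterate idem].
Qed.

Lemma fixed_label_periodic n j :
  label_map (iter n (compose_data r) r) j = j -> periodic_label r j.
Proof. by rewrite label_map_iterate => fj; exists n.+1. Qed.

End Iterate.

(** * Linearization at a tensor *)

Section Linearization.
Variables (A : comNzRingType) (k : nat) (r : reduced_data k) (W : weight A r).

Definition linearized_map (v h : {ffun cube k -> A}) : {ffun cube k -> A} :=
  [ffun x => \sum_(Y : {ffun hvertex r -> cube k})
     (\sum_w h (Y w) * \prod_(u | u != w) v (Y u)) *
     \prod_e W e (column Y e) (root_bit x e)].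

Definition delta (z : cube k) : 'I_k -> bool -> A := fun j b => (b == z j)%:R.

(** The family in which the tensor [a] is replaced, at the vertex [w], by the
    indicator of the pattern [z]. *)
Definition spike (a : 'I_k -> bool -> A) (w : hvertex r) (z : cube k)
    (u : hvertex r) : 'I_k -> bool -> A :=
  if u == w then delta z else a.

(** The first-order change of the [j]-th factor, multiplied by the constant. If
    [own w] is [j] then the other marked edges avoid [w], so a change at [w]
    enters only the constant and the [j]-th factor. *)
Definition slope (own : hvertex r -> 'I_k) (a : 'I_k -> bool -> A)
    (h : {ffun cube k -> A}) (j : 'I_k) (b : bool) : A :=
  \sum_(w | own w == j) \sum_z h z *
    (unrooted_factor W (spike a w z) * root_factor W (spike a w z) j b).

Lemma tensor_delta z x : tensor (delta z) x = (x == z)%:R.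
Proof.
rewrite ffunE; case: eqP => [->|/eqP xz].
  by rewrite big1 // => j _; rewrite /delta eqxx.
have [j xj] : exists j, x j != z j.
  apply/existsP; apply: contraR xz; rewrite negb_exists => /forallP xz.
  by apply/eqP/ffunP => j; apply/eqP; have := xz j; rewrite negbK.
by rewrite (bigD1 j) //= /delta (negbTE xj) mul0r.
Qed.

Lemma linearized_tensor a h x :
  linearized_map (tensor a) h x =
  \sum_w \sum_z h z * polarized_map W (fun u => tensor (spike a w z u)) x.
Proof.
rewrite ffunE; under eq_bigr => Y _ do rewrite big_distrl /=.
rewrite exchange_big /=; apply: eq_bigr => w _.
under [RHS]eq_bigr => z _ do rewrite ffunE big_distrr /=.
rewrite exchange_big /=; apply: eq_bigr => Y _.
have E z : \prod_u tensor (spike a w z u) (Y u) =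
    (Y w == z)%:R * \prod_(u | u != w) tensor a (Y u).
  rewrite (bigD1 w) //= /spike eqxx tensor_delta; congr (_ * _).
  by apply: eq_bigr => u /negbTE ->.
rewrite (bigD1 (Y w)) //= [X in _ + X]big1 ?addr0 => [|z zY]; rewrite E.
  by rewrite eqxx mul1r mulrA.
by rewrite eq_sym (negbTE zY) !mul0r mulr0.
Qed.

(** If each vertex lies in at most one marked edge then changing the input at one
    vertex changes the constant and a single factor of the output, the others
    being those at [a]; the derivative is the sum of these changes. *)
Lemma linearized_tensorE own a h x :
  (forall w i, i != own w -> w \notin hset (phi r i)) ->
  linearized_map (tensor a) h x =
  \sum_j slope own a h j (x j) *
    \prod_(i | i != j) root_factor W (fun=> a) i (x i).
Proof.
move=> ownP; rewrite linearized_tensor (partition_big own predT) //=.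
apply: eq_bigr => j _; rewrite big_distrl /=; apply: eq_bigr => w /eqP wj.
rewrite big_distrl /=; apply: eq_bigr => z _.
rewrite polarized_tensorE !ffunE -!mulrA; congr (_ * (_ * _)).
rewrite (bigD1 j) //=; congr (_ * _); apply: eq_bigr => i ij.
apply: edge_sum_eq => u ui; rewrite /spike; case: eqP => // uw.
by have := ownP w i; rewrite wj ij -uw ui => /(_ isT).
Qed.

End Linearization.

Lemma separated_owner (k : nat) (r : reduced_data k) : (0 < k)%N ->
  separated r -> exists own : hvertex r -> 'I_k,
    forall w i, i != own w -> w \notin hset (phi r i).
Proof.
move=> k0 sep; exists (fun w =>
  odflt (Ordinal k0) [pick j | w \in hset (phi r j)]) => w i.
case: pickP => [j wj|none] /=; last by rewrite none.
by move=> /sep/disjointFr ij; apply/negP => /ij; rewrite wj.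
Qed.

(** * The graph recursion as a weighted sum *)

(** The parts of a set in the colour classes can be chosen independently. *)
Lemma sum_colored (A : comNzRingType) (X I : finType) (col : X -> I)
    (g : I -> {set X} -> A) :
  \sum_(S : {set X}) \prod_i g i (S :&: col @^-1: [set i]) =
  \prod_i \sum_(B : {set X} | B \subset col @^-1: [set i]) g i B.
Proof.
rewrite (big_distr_big_dep set0) /=.
rewrite [RHS](reindex_onto
  (fun S : {set X} => [ffun i => S :&: col @^-1: [set i]])
  (fun f : {ffun I -> {set X}} => [set x | x \in f (col x)])) /=.
  apply: eq_big => [S|S _]; last by apply: eq_bigr => i _; rewrite ffunE.
  symmetry; apply/andP; split.
    apply/pfamilyP; split; first by apply/subsetP.
    by move=> i _; rewrite ffunE unfold_in subsetIr.
  by apply/eqP/setP => x; rewrite inE ffunE !inE eqxx andbT.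
move=> f /pfamilyP[_ fP]; apply/ffunP => i; rewrite ffunE.
apply/setP => x; rewrite !inE.
have := fP i isT; rewrite unfold_in => /subsetP fi.
apply/andP/idP => [[xf /eqP <-] //|xf].
by have := fi _ xf; rewrite !inE => /eqP ->; split.
Qed.

Section IndependenceWeight.
Variables (K : numFieldType) (k : nat) (r : reduced_data k).
Variables (c : connecting_data r) (lam : K).

Definition compatible (e : hedge r) (S : {set hvertex r}) (b : bool)
    (T : {set vertex (cgraph c e)}) : bool :=
  [&& independent T,
      [forall w : {w : hvertex r | w \in hset e},
         (attach c w \in T) == (val w \in S)] &
      (e \in codom (phi r)) ==> ((croot c e \in T) == b)].

(** A vertex to which copies are glued is counted once by the connecting graph
    and once by each of these copies, whence the division. *)
Definition indep_weight : weight K r := fun e S b =>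
  (\sum_(T : {set vertex (cgraph c e)} | compatible S b T) lam ^+ #|T|) / lam ^+ #|hset e :&: S|.

Lemma Z_edgeE e Y x :
  Z_edge c lam e Y x =
  \sum_(T : {set vertex (cgraph c e)} |
     compatible (column Y e) (root_bit x e) T) lam ^+ #|T|.
Proof.
apply: eq_bigl => T; congr [&& _, _ & _].
  by apply: eq_forallb => w; rewrite inE (valP w).
move: (croot c e \in T) => P; apply/forallP/implyP => [H /codomP[j ej]|H j].
  by have := H j; rewrite ej eqxx root_bit_phi.
by apply/implyP => /eqP ej; have := H; rewrite -ej codom_f root_bit_phi; apply.
Qed.

Lemma F_weighted v : F c lam v = weighted_map indep_weight v.
Proof.
apply/ffunP => x; rewrite !ffunE; apply: eq_bigr => Y _; congr (_ * _).
apply: eq_bigr => e _; rewrite /indep_weight Z_edgeE; congr (_ / _ ^+ _).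
by rewrite (setIidPr (column_sub _ _)).
Qed.

Lemma iter_F_weighted n v : iter n (F c lam) v = iter n (weighted_map indep_weight) v.
Proof. by elim: n => //= n ->; rewrite F_weighted. Qed.

(** At a periodic label the edge has a single vertex, by non-degeneracy, and its
    connecting graph is a point; the vertex attached there is the root. *)
Lemma stable_identity_edge : lam != 0 -> stable c ->
  forall j, periodic_label r j -> identity_edge indep_weight (phi r j).
Proof.
move=> lam0 [nondeg single] j pj.
have /eqP/cards1P[w ew] : #|hset (phi r j)| = 1.
  have := nondeg j; have := hset_neq0 (phi r j); rewrite -card_gt0 /critical_label.
  by case: #|_| => [//|[//|n]] _ [].
have /eqP/fintype1P[v0 vE] := single j pj.
exists w; split=> // S b; rewrite /indep_weight.
have wj : w \in hset (phi r j) by rewrite ew set11.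
have compE T : @compatible (phi r j) S b T =
    ((v0 \in T) == (w \in S)) && ((w \in S) == b).
  rewrite /compatible; have -> : [forall u : {u : hvertex r | u \in hset (phi r j)},
         (attach c u \in T) == (val u \in S)] = ((v0 \in T) == (w \in S)).
    apply/forallP/idP => [/(_ (exist _ w wj))|vT u]; first by rewrite [attach _ _]vE.
    rewrite [attach _ _]vE; case: u => u uj /=.
    by move: (uj); rewrite ew => /set1P ->.
  have -> : independent T.
    apply/forallP => a; have := card_ends a; have := max_card (mem (ends a)).
    by rewrite single // => + e2; rewrite e2.
  rewrite codom_f /= [croot _ _]vE.
  by case: eqP => // ->.
have [wb|wb] := eqVneq (w \in S) b; last first.
  by rewrite big_pred0 ?mul0r // => T; rewrite compE (negbTE wb) andbF.
rewrite (big_pred1 (if b then [set v0] else finset.set0)); last first.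
  move=> T; rewrite compE wb eqxx andbT /=.
  apply/eqP/eqP => [vT|->]; last by case: (b); rewrite ?set11 ?inE.
  by apply/setP => u; rewrite (vE u) vT; case: (b); rewrite ?set11 ?inE.
rewrite ew; have -> : [set w] :&: S = if b then [set w] else finset.set0.
  apply/setP => u; rewrite !inE; case: eqP => [->|uw].
    by rewrite wb; case: (b); rewrite ?set11 ?inE.
  by case: (b); rewrite ?inE //; apply/esym/eqP.
by case: (b); rewrite ?cards1 ?cards0 divff ?expf_neq0.
Qed.

End IndependenceWeight.

Section RecursionMap.
Variables (K : numFieldType) (k : nat) (r : reduced_data k).
Variables (c : connecting_data r) (lam : K) (lam0 : lam != 0).
Variable G : marked_graph k.

Local Notation gvertex := (glued_vertex c G).

Lemma glue_mark w j :
  glue c w (mark G j) =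
  connecting_vertex G (attach c (exist _ w (edge_at_in w j))) :> gvertex.
Proof.
rewrite /glue; case: decP => [m|n]; last by exfalso; apply: n; rewrite codom_f.
by have /mark_inj -> := f_iinv m.
Qed.

Lemma glue_mark_label w e (we : w \in hset e) :
  glue c w (mark G (label e)) =
  connecting_vertex G (attach c (exist _ w we)) :> gvertex.
Proof.
rewrite glue_mark; have E := edge_at_label we.
move: (edge_at_in w (label e)); rewrite E => we'.
by rewrite (bool_irrelevance we' we).
Qed.

Lemma glue_unmarked w (u : {v : vertex G | v \notin codom (mark G)}) :
  glue c w (val u) = inl (w, u) :> gvertex.
Proof.
rewrite /glue; case: decP => [m|n]; first by case/negP: (valP u).
by congr (inl (_, _)); apply: val_inj.
Qed.

(** These are the colours to which [sum_colored] is applied. *)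
Definition piece (z : gvertex) : hvertex r + hedge r :=
  match z with inl p => inl p.1 | inr t => inr (tag t) end.

(** The marked vertices of a copy belong to connecting graphs; taking their bits
    from the pattern [Y] makes the conditions on the pieces independent. *)
Definition copy_part (Y : cube k) (w : hvertex r) (B : {set gvertex}) :
    {set vertex G} :=
  [set v | if [pick j | mark G j == v] is Some j then Y j else glue c w v \in B].

Definition connecting_part (e : hedge r) (B : {set gvertex}) :
    {set vertex (cgraph c e)} :=
  [set v | connecting_vertex G v \in B].

Lemma copy_part_mark Y w B j : (mark G j \in copy_part Y w B) = Y j.
Proof.
rewrite inE; case: pickP => [i /eqP/mark_inj -> //|/(_ j)].
by rewrite eqxx.
Qed.

Lemma copy_part_unmarked Y w B (u : {v : vertex G | v \notin codom (mark G)}) :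
  (val u \in copy_part Y w B) = (inl (w, u) \in B).
Proof.
rewrite inE; case: pickP => [i /eqP iu|_]; last by rewrite glue_unmarked.
by have := valP u; rewrite /= -iu codom_f.
Qed.

Lemma vertex_cases (P : vertex G -> Prop) :
  (forall j, P (mark G j)) ->
  (forall u : {v : vertex G | v \notin codom (mark G)}, P (val u)) ->
  forall v, P v.
Proof.
move=> Pm Pu v; have [/codomP[j ->] //|nv] := boolP (v \in codom (mark G)).
exact: (Pu (exist _ v nv)).
Qed.

(** The sets [B] miss the marked vertices of the copy, whose contribution is the
    product of powers on the left. *)
Lemma sum_copy Y w :
  (\sum_(B : {set gvertex} | (B \subset piece @^-1: [set inl w]) &&
      independent (copy_part Y w B)) lam ^+ #|B|) * \prod_j lam ^+ Y j =
  indep_poly_at G lam Y.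
Proof.
pose h (T : {set vertex G}) : {set gvertex} :=
  [set z | if z is inl p then (p.1 == w) && (val p.2 \in T) else false].
have hK (B : {set gvertex}) : B \subset piece @^-1: [set inl w] -> h (copy_part Y w B) = B.
  move=> /subsetP sB; apply/setP => -[[w1 u]|t]; rewrite !inE /=.
    have [->|w1w] := eqVneq; first by have := copy_part_unmarked Y w B u; rewrite inE.
    by apply/esym/negP => /sB; rewrite !inE => /eqP[/eqP]; rewrite (negbTE w1w).
  by apply/esym/negP => /sB; rewrite !inE.
have hK' T : (copy_part Y w (h T) == T) = agrees Y T.
  apply/eqP/forallP => [<- j|yT]; first by rewrite copy_part_mark.
  apply/setP; apply: vertex_cases => [j|u].
    by rewrite copy_part_mark; apply/esym/eqP/yT.
  by rewrite copy_part_unmarked inE eqxx.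
rewrite (reindex_onto h (copy_part Y w)) /=; last by move=> B /andP[/hK].
have him T : h T = [set (inl (w, u) : gvertex) | u in [set u | val u \in T]].
  apply/setP => -[[w1 u]|t]; rewrite !inE /=; apply/idP/imsetP.
  - by case/andP => /eqP -> uT; exists u; rewrite ?inE.
  - by case=> u'; rewrite inE => uT [-> ->]; rewrite eqxx.
  - by [].
  - by case.
have cardh T : agrees Y T -> (#|h T| + \sum_j Y j)%N = #|T|.
  move=> /forallP yT.
  rewrite him card_imset; last by move=> u u' [].
  rewrite -(cardsID (mark G @: finset.setT) T) addnC; congr (_ + _)%N.
    rewrite -sum1_card [RHS](eq_bigl (fun v => (v \in mark G @: finset.setT) && (v \in T))); last first.
      by move=> v; rewrite inE andbC.
    rewrite big_mkcondr [RHS]big_imset => [|i j _ _ /mark_inj //].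
    apply: eq_big => [j|j _]; rewrite ?in_setT // (eqP (yT j)).
    by case: (Y j).
  rewrite -(card_imset _ val_inj); apply: eq_card => v; apply/imsetP/idP.
    case=> u; rewrite inE => uT ->; rewrite inE uT andbT.
    by apply/imsetP => -[j _ uj]; have := valP u; rewrite /= uj codom_f.
  rewrite inE => /andP[nv vT]; have nv' : v \notin codom (mark G).
    by apply: contra nv => /codomP[j ->]; rewrite imset_f ?in_setT.
  by exists (exist _ v nv'); rewrite ?inE.
rewrite big_distrl /=; apply: eq_big => [T|T /andP[_]].
  rewrite hK'; have [aT|] := boolP (agrees Y T); rewrite ?andbT ?andbF //.
  have := hK' T; rewrite aT => /eqP ->; rewrite andb_idl // => _.
  by apply/subsetP => -[[w1 u]|t]; rewrite !inE //= => /andP[/eqP ->].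
by rewrite hK' => /cardh <-; rewrite exprD expr_sum.
Qed.

Lemma sum_connecting x Y e :
  (\sum_(B : {set gvertex} | (B \subset piece @^-1: [set inr e]) &&
      compatible (column Y e) (root_bit x e) (connecting_part e B))
     lam ^+ #|B|) =
  \sum_(T : {set vertex (cgraph c e)} |
      compatible (column Y e) (root_bit x e) T) lam ^+ #|T|.
Proof.
pose h (T : {set vertex (cgraph c e)}) : {set gvertex} :=
  @connecting_vertex _ _ c G e @: T.
have hK' T : connecting_part e (h T) = T.
  apply/setP => v; rewrite inE mem_imset //; exact: connecting_vertex_inj.
rewrite (reindex_onto h (connecting_part e)) /=.
  apply: eq_big => [T|T _]; rewrite ?card_imset //; last exact: connecting_vertex_inj.
  rewrite hK' eqxx andbT andb_idl // => _.
  by apply/subsetP => z /imsetP[v _ ->]; rewrite !inE.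
move=> B /andP[/subsetP sB _]; apply/setP => z; apply/imsetP/idP.
  by case=> v; rewrite inE => vB ->.
move=> zB; have := sB z zB; rewrite !inE; case: z zB => [//|[e' v] zB] /= /eqP[ee].
by subst e'; exists v; rewrite ?inE.
Qed.

Definition copy_pattern (S : {set gvertex}) : {ffun hvertex r -> cube k} :=
  [ffun w => [ffun j => glue c w (mark G j) \in S]].

Lemma glued_independent (S : {set gvertex}) :
  @independent (glued_graph c G) S =
  [forall w, independent (glue c w @^-1: S)] &&
  [forall e, independent (connecting_part e S)].
Proof.
apply/forallP/andP => [H|[/forallP H1 /forallP H2]].
  split; [apply/forallP => w|apply/forallP => e]; apply/forallP => a.
    apply: contra (H (inl (w, a))) => /subsetP sa; apply/subsetP => z.
    by case/imsetP => v /sa; rewrite inE => vS ->.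
  apply: contra (H (inr (Tagged (fun e => edge (cgraph c e)) a))) => /subsetP sa; apply/subsetP => z.
  by case/imsetP => v /sa; rewrite inE => vS ->.
case=> [[w a]|[e a]].
  apply: contra (forallP (H1 w) a) => /subsetP sa; apply/subsetP => v va.
  by rewrite inE sa //; apply: imset_f.
apply: contra (forallP (H2 e) a) => /subsetP sa; apply/subsetP => v va.
by rewrite inE sa //; apply: imset_f.
Qed.

Definition piece_condition (x : cube k) (Y : {ffun hvertex r -> cube k})
    (i : hvertex r + hedge r) (B : {set gvertex}) : bool :=
  match i with
  | inl w => independent (copy_part (Y w) w B)
  | inr e => compatible (column Y e) (root_bit x e) (connecting_part e B)
  end.

(** For a fixed pattern on the copies, being independent and agreeing with [x]
    is a condition on each piece separately. *)
Lemma glued_condition x Y (S : {set gvertex}) :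
  [&& @independent (glued_graph c G) S, @agrees _ (recursion c G) x S &
    copy_pattern S == Y] =
  [forall i, piece_condition x Y i (S :&: piece @^-1: [set i])].
Proof.
have connI e : connecting_part e (S :&: piece @^-1: [set inr e]) = connecting_part e S.
  by apply/setP => v; rewrite !inE eqxx andbT.
have copyI w : copy_pattern S = Y ->
    copy_part (Y w) w (S :&: piece @^-1: [set inl w]) = glue c w @^-1: S.
  move=> SY; apply/setP; apply: vertex_cases => [j|u].
    by rewrite copy_part_mark !inE -SY !ffunE.
  by rewrite copy_part_unmarked !inE eqxx andbT glue_unmarked.
apply/and3P/forallP => [[]|H].
  rewrite glued_independent => /andP[/forallP H1 /forallP H2] /forallP xS /eqP SY.
  case=> [w|e] /=; first by rewrite copyI.
  rewrite connI; apply/and3P; split=> //.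
    apply/forallP => -[w we] /=.
    by rewrite !inE we -SY !ffunE glue_mark_label.
  apply/implyP => /codomP[j ej]; have := xS j.
  by rewrite /= /glued_mark inE; subst e; rewrite root_bit_phi.
have SY : copy_pattern S = Y.
  apply/ffunP => w; apply/ffunP => j; rewrite !ffunE.
  have /and3P[_ /forallP/(_ (exist _ w (edge_at_in w j))) + _] :=
    H (inr (edge_at w j)).
  by rewrite /= connI !inE glue_mark edge_at_in label_edge_at => /eqP.
split; last exact/eqP.
  rewrite glued_independent; apply/andP; split; [apply/forallP => w|apply/forallP => e].
    by have := H (inl w); rewrite /= copyI.
  by have := H (inr e); rewrite /= connI => /and3P[].
apply/forallP => j; have /and3P[_ _] := H (inr (phi r j)).
by rewrite connI codom_f root_bit_phi inE.
Qed.

(** Sort the independent sets by their pattern on the copies; for a fixed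
    pattern the sum is a product over the pieces. The powers that the copies
    miss at their marked vertices are those by which the edge weights are
    divided. *)
Theorem F_recursion :
  F c lam [ffun x => indep_poly_at G lam x] =
  [ffun x => indep_poly_at (recursion c G) lam x].
Proof.
rewrite F_weighted; apply/ffunP => x; rewrite !ffunE.
symmetry; rewrite /indep_poly_at (partition_big copy_pattern predT) //=.
apply: eq_bigr => Y _.
transitivity (\sum_(S : {set gvertex}) \prod_i
  (let B := S :&: piece @^-1: [set i] in
   (piece_condition x Y i B)%:R * lam ^+ #|B|)).
  rewrite big_mkcond /=; apply: eq_bigr => S _.
  rewrite big_split /= -(big_morph (fun n => lam ^+ n) (@exprD _ lam) (expr0 lam)).
  have -> : (\sum_i #|S :&: piece @^-1: [set i]| = #|S|)%N.
    rewrite -[RHS]sum1_card (partition_big piece predT) //=.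
    apply: eq_bigr => i _; rewrite -sum1_card; apply: eq_bigl => z.
    by rewrite !inE.
  rewrite -andbA glued_condition; case: forallP => [H|H].
    by rewrite big1 ?mul1r // => i _; rewrite H.
  have /forallPn[i Hi] : ~~ [forall i, piece_condition x Y i (S :&: piece @^-1: [set i])].
    exact/forallP.
  by rewrite (bigD1 i) //= (negbTE Hi) !mul0r.
rewrite (sum_colored piece (fun i B => (piece_condition x Y i B)%:R * lam ^+ #|B|)).
rewrite big_sumType /=.
under eq_bigr => w _.
  rewrite (eq_bigr (fun B => if independent (copy_part (Y w) w B) then lam ^+ #|B| else 0)); last first.
    by move=> B _; case: ifP; rewrite ?mul1r ?mul0r.
  rewrite -big_mkcondr /=; over.
under [X in _ * X]eq_bigr => e _.
  rewrite (eq_bigr (fun B => if compatible (column Y e) (root_bit x e) (connecting_part e B) then lam ^+ #|B| else 0)); last first.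
    by move=> B _; case: ifP; rewrite ?mul1r ?mul0r.
  rewrite -big_mkcondr /= sum_connecting; over.
under [X in _ = X * _]eq_bigr => w _ do rewrite ffunE -/(indep_poly_at G lam (Y w)) -(sum_copy _ w).
rewrite big_split /= prod_labels_edges -mulrA; congr (_ * _).
rewrite -big_split /=; apply: eq_bigr => e _.
rewrite /indep_weight mulrC.
have -> : \prod_(w in hset e) lam ^+ Y w (label e) = lam ^+ #|hset e :&: column Y e|.
  rewrite (setIidPr (column_sub _ _)) -sum1_card (big_morph _ (@exprD _ lam) (expr0 lam)).
  rewrite [RHS](eq_bigl (fun w => (w \in hset e) && Y w (label e))); last first.
    by move=> w; rewrite inE.
  by rewrite big_mkcondr; apply: eq_bigr => w _; case: (Y w _).
by rewrite divfK // expf_neq0.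
Qed.

End RecursionMap.

(** * Homogeneity *)

Module HomogeneousMap.
Import mpoly.

Lemma weighted_map_homogeneous (C : comNzRingType) (k : nat)
    (r : reduced_data k) (W : weight C r) :
  homogeneous_polynomial_map #|hvertex r| (weighted_map W).
Proof.
exists (fun x => \sum_(Y : {ffun hvertex r -> cube k})
  (\prod_e W e (column Y e) (root_bit x e)) *:
  \prod_w 'X_(enum_rank (Y w))); split => [x|v x].
  apply: rpred_sum => Y _; apply: rpredZ.
  have -> : #|hvertex r| = (\sum_(w : hvertex r) 1)%N by rewrite sum1_card.
  apply: (big_ind2 (fun (p : {mpoly C[_]}) d => p \is d.-homog)).
  - exact: dhomog1.
  - by move=> p d q e; exact: dhomogM.
  - by move=> w _; rewrite dhomogX /= mdeg1.
rewrite ffunE raddf_sum; apply: eq_bigr => Y _.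
rewrite [RHS]mevalZ mulrC; congr (_ * _).
rewrite [RHS](big_morph _ (mevalM _) (meval1 _)).
by apply: eq_bigr => w _; rewrite mevalXU enum_rankK.
Qed.

End HomogeneousMap.
Export HomogeneousMap.

(** * Absolute values and perturbed products *)

(** The values lie in a field [R] of their own because the order of the complex
    numbers is partial. *)
Record absolute_value (R : realFieldType) (K : fieldType) (N : K -> R) : Prop :=
  AbsoluteValue {
    abs_ge0 : forall x, 0 <= N x;
    abs0 : N 0 = 0;
    abs1 : N 1 = 1;
    absN : forall x, N (- x) = N x;
    absM : forall x y, N (x * y) = N x * N y;
    absD : forall x y, N (x + y) <= N x + N y;
    abs_eq0 : forall x, N x = 0 -> x = 0 }.

Section Estimates.
Variables (R : realFieldType) (K : fieldType) (N : K -> R).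
Hypothesis av : absolute_value N.

Lemma abs_prod (I : finType) (P : pred I) (F : I -> K) :
  N (\prod_(i | P i) F i) = \prod_(i | P i) N (F i).
Proof. exact: (big_morph N (absM av) (abs1 av)). Qed.

Lemma abs_sum (I : finType) (P : pred I) (F : I -> K) :
  N (\sum_(i | P i) F i) <= \sum_(i | P i) N (F i).
Proof.
apply: (big_ind2 (fun x y => N x <= y)) => //; first by rewrite (abs0 av).
by move=> x1 x2 y1 y2 h1 h2; rewrite (le_trans (absD av _ _)) ?lerD.
Qed.

Lemma abs_sum_le (I : finType) (P : pred I) (F : I -> K) (B : R) :
  0 <= B -> (forall i, P i -> N (F i) <= B) ->
  N (\sum_(i | P i) F i) <= #|I|%:R * B.
Proof.
move=> B0 FB; apply: (le_trans (abs_sum _ _)).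
apply: (@le_trans _ _ (\sum_(i | P i) B)); first exact: ler_sum.
rewrite big_mkcond mulr_natl -sumr_const /=.
by apply: ler_sum => i _; case: ifP.
Qed.

Lemma abs_prod_le (I : finType) (P : pred I) (F : I -> K) (B : R) :
  1 <= B -> (forall i, P i -> N (F i) <= B) ->
  N (\prod_(i | P i) F i) <= B ^+ #|I|.
Proof.
move=> B1 FB; have B0 : 0 <= B by exact: le_trans B1.
rewrite abs_prod big_mkcond /= -prodr_const.
apply: ler_prod => i _; case: ifP => Pi; last by rewrite ler01.
by rewrite (abs_ge0 av) FB.
Qed.

Lemma abs_sub x y : N (x - y) <= N x + N y.
Proof. by rewrite (le_trans (absD av _ _)) // (absN av). Qed.

Lemma abs_ge_sub x y : N x - N y <= N (x + y).
Proof.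
by have := abs_sub (x + y) y; rewrite addrK; lra.
Qed.

Lemma abs_neq0 x : 0 < N x -> x != 0.
Proof. by move=> x0; apply: contraTneq x0 => ->; rewrite (abs0 av) ltxx. Qed.

Lemma abs_gt0 x : x != 0 -> 0 < N x.
Proof.
move=> x0; rewrite lt_def (abs_ge0 av) andbT.
by apply: contra x0 => /eqP/(abs_eq0 av) ->.
Qed.

Lemma absV x : x != 0 -> N x^-1 = (N x)^-1.
Proof.
move=> x0; have Nx := abs_gt0 x0.
by apply: (mulfI (lt0r_neq0 Nx)); rewrite -(absM av) !divff ?(abs1 av) ?lt0r_neq0.
Qed.

Lemma abs_div_le x y (A c : R) : 0 < c -> N x <= A -> c <= N y ->
  N (x / y) <= A / c.
Proof.
move=> c0 xA cy; have Ny : 0 < N y by exact: lt_le_trans cy.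
rewrite (absM av) absV ?abs_neq0 //.
apply: ler_pM; rewrite ?(abs_ge0 av) ?invr_ge0 ?(ltW Ny) //.
by rewrite lef_pV2 ?posrE.
Qed.

Section Perturbation.
Variables (I : finType) (P : pred I) (p q : I -> K) (B d : R).
Hypothesis B1 : 1 <= B.
Hypothesis d01 : 0 <= d <= 1.
Hypothesis pB : forall i, P i -> N (p i) <= B.
Hypothesis qd : forall i, P i -> N (q i) <= d.

(* Padding with 1 + 0 outside P lets the expansion run over all subsets of I. *)
Let p' i := if P i then p i else 1.
Let q' i := if P i then q i else 0.
Let term (J : {set I}) := \prod_i (if i \in J then q' i else p' i).

Let expand : \prod_(i | P i) (p i + q i) = \sum_(J : {set I}) term J.
Proof.
rewrite -bigA_distr big_mkcond; apply: eq_bigr => i _.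
by rewrite /p' /q'; case: (P i); rewrite /= ?add0r // [LHS]addrC.
Qed.

Let term_le (J : {set I}) n : (n <= #|J|)%N -> N (term J) <= d ^+ n * B ^+ #|I|.
Proof.
move=> nJ; have B0 : 0 <= B by exact: le_trans B1.
have [d0 d1] := andP d01.
rewrite /term abs_prod (bigID (mem J)) /=; apply: ler_pM.
- by apply: prodr_ge0 => i _; exact: (abs_ge0 av).
- by apply: prodr_ge0 => i _; exact: (abs_ge0 av).
- apply: (@le_trans _ _ (\prod_(i in J) d)).
    apply: ler_prod => i iJ; rewrite (abs_ge0 av) iJ /q'.
    by case: ifP => [/qd //|_]; rewrite (abs0 av).
  rewrite prodr_const -(subnK nJ) exprD ler_piMl ?exprn_ge0 //.
  exact: exprn_ile1.
- rewrite -prodr_const big_mkcond; apply: ler_prod => i _.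
  case: ifP => iJ; last by rewrite ler01.
  rewrite (abs_ge0 av) (negbTE iJ) /p'.
  by case: ifP => [/pB //|_]; rewrite (abs1 av).
Qed.

Let term0 : term set0 = \prod_(i | P i) p i.
Proof.
by rewrite /term [RHS]big_mkcond; apply: eq_bigr => i _; rewrite inE.
Qed.

(** Every term of the expanded product but the first has a factor [q i]. *)
Lemma prod_perturb :
  N (\prod_(i | P i) (p i + q i) - \prod_(i | P i) p i) <=
  (2 ^+ #|I| * B ^+ #|I|) * d.
Proof.
have B0 : 0 <= B by exact: le_trans B1.
have [d0 d1] := andP d01.
rewrite expand (bigD1 set0) //= term0 addrAC subrr add0r -mulrA [_ * d]mulrC.
have -> : 2 ^+ #|I| = #|{set I}|%:R :> R.
  by rewrite -[#|{set I}|]cardsT -powersetT card_powerset cardsT natrX.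
apply: abs_sum_le => [|J J0]; first by rewrite mulr_ge0 ?exprn_ge0.
by rewrite -{1}(expr1 d); apply: term_le; rewrite card_gt0.
Qed.

(** The terms with exactly one factor [q i] are the sum that is subtracted; all
    further terms have at least two such factors. *)
Lemma prod_perturb2 :
  N (\prod_(i | P i) (p i + q i) - \prod_(i | P i) p i -
     \sum_(i | P i) q i * \prod_(j | P j && (j != i)) p j) <=
  (2 ^+ #|I| * B ^+ #|I|) * d ^+ 2.
Proof.
have B0 : 0 <= B by exact: le_trans B1.
have [d0 d1] := andP d01.
rewrite expand (bigD1 set0) //= term0 [X in X - _]addrAC subrr add0r.
rewrite (bigID (fun J : {set I} => #|J| == 1%N)) /=.
have -> : \sum_(J : {set I} | (J != set0) && (#|J| == 1%N)) term J =
    \sum_(i | P i) q i * \prod_(j | P j && (j != i)) p j.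
  transitivity (\sum_(J in set1 @: [set: I]) term J).
    apply: eq_bigl => J; apply/andP/imsetP.
      by case=> _ /cards1P[i ->]; exists i; rewrite ?in_setT.
    by case=> i _ ->; rewrite -card_gt0 cards1.
  rewrite big_imset => [|i j _ _ /set1_inj //].
  rewrite [RHS]big_mkcond /=; apply: eq_big => [i|i _]; first by rewrite in_setT.
  rewrite /term (bigD1 i) //= set11 /q'; case: ifP => Pi; last by rewrite mul0r.
  congr (_ * _); rewrite big_mkcondl; apply: eq_bigr => j ji.
  by rewrite inE (negbTE ji).
rewrite [X in X - _]addrC addrK -mulrA [_ * d ^+ 2]mulrC.
have -> : 2 ^+ #|I| = #|{set I}|%:R :> R.
  by rewrite -[#|{set I}|]cardsT -powersetT card_powerset cardsT natrX.
apply: abs_sum_le => [|J /andP[J0 J1]]; first by rewrite mulr_ge0 ?exprn_ge0.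
apply: term_le; move: J0 J1; rewrite -card_gt0.
by case: #|J| => [|[|]].
Qed.

End Perturbation.

End Estimates.

(** * One step near the constant vector *)

Section Local.
Variables (R : realFieldType) (K : fieldType) (N : K -> R).
Hypothesis av : absolute_value N.
Variables (k : nat) (q : reduced_data k).
Variable own : hvertex q -> 'I_k.
Hypothesis ownP : forall w i, i != own w -> w \notin hset (phi q i).
Hypothesis idem : forall j, label_map q (label_map q j) = label_map q j.
Variables (U : weight K q) (C0 : R).
Hypothesis C01 : 1 <= C0.
Hypothesis UC : forall e S b, N (U e S b) <= C0.
Hypothesis Uid : forall j, label_map q j = j -> identity_edge U (phi q j).
Hypothesis U1 : weighted_map U [ffun=> 1] = [ffun=> 1].

(* For factors bounded by 2, B bounds the edge sums. Lower bounds are eta, for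
   the constant and the factors of the image of 1, and kap, for the scale of
   the image. Lc is a Lipschitz constant of the constant; Ds and Dg bound the
   slopes before and after division by the constant; Dr and Dq bound the
   second-order remainders. *)
Let M := #|hvertex q|.
Let E := #|hedge q|.
Let B : R := 2 ^+ M * (2 ^+ M * C0).
Let eta : R := (B ^+ E * B ^+ k)^-1.
Let Lc : R := 2 ^+ E * B ^+ E * B.
Let Ds : R := M%:R * (#|{: cube k}|%:R * (B ^+ E * B)).
Let Dg : R := Ds / (eta / 2).
Let Dr : R := #|{ffun hvertex q -> cube k}|%:R *
  (2 ^+ M * (2 ^+ k) ^+ M * C0 ^+ E).
Let Dq : R := Dr + B ^+ E * (2 ^+ k * B ^+ k * Dg ^+ 2).
Let kap : R := eta / 2 * (eta / 4) ^+ k.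
Definition step_constant : R :=
  1 + B + Lc / (eta / 2) + B / (eta / 2) + Dg + Dg / (eta / 4) + Dq / kap +
  3 * Dg / (eta / 4) + 2 * B / (eta / 4) + 2 * Dg / (eta / 4).
Local Notation D := step_constant.

Let ordX (x : R) : x ^+ k = x ^+ #|{: 'I_k}|. Proof. by rewrite card_ord. Qed.

Let one : 'I_k -> bool -> K := fun _ _ => 1.

Let pow2_ge1 n : 1 <= 2 ^+ n :> R.
Proof. by rewrite exprn_ege1 // ler1n. Qed.

Let B1 : 1 <= B.
Proof. exact: mulr_ege1 (pow2_ge1 _) (mulr_ege1 (pow2_ge1 _) C01). Qed.

Let B0 : 0 <= B. Proof. exact: le_trans B1. Qed.

Let BX1 n : 1 <= B ^+ n. Proof. exact: exprn_ege1. Qed.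

Let BX0 n : 0 <= B ^+ n. Proof. exact: le_trans (BX1 n). Qed.

Let eta_gt0 : 0 < eta.
Proof. by rewrite invr_gt0 mulr_gt0 // (lt_le_trans ltr01) ?BX1. Qed.

Let C00 : 0 <= C0. Proof. exact: le_trans C01. Qed.
Let p2 n : 0 <= 2 ^+ n :> R. Proof. exact: le_trans (pow2_ge1 n). Qed.
Let e4 : 0 < eta / 4. Proof. by have := eta_gt0; lra. Qed.
Let e2 : 0 < eta / 2. Proof. by have := eta_gt0; lra. Qed.

Let Ds0 : 0 <= Ds.
Proof. exact: mulr_ge0 (ler0n _ _) (mulr_ge0 (ler0n _ _) (mulr_ge0 (BX0 _) B0)). Qed.
Let Dg0 : 0 <= Dg. Proof. exact: divr_ge0 Ds0 (ltW e2). Qed.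
Let Lc0 : 0 <= Lc. Proof. exact: mulr_ge0 (mulr_ge0 (p2 _) (BX0 _)) B0. Qed.
Let Dr0 : 0 <= Dr.
Proof.
exact: mulr_ge0 (ler0n _ _)
  (mulr_ge0 (mulr_ge0 (p2 _) (exprn_ge0 _ (p2 _))) (exprn_ge0 _ C00)).
Qed.
Let Dq0 : 0 <= Dq.
Proof.
exact: addr_ge0 Dr0 (mulr_ge0 (BX0 _) (mulr_ge0 (mulr_ge0 (p2 _) (BX0 _)) (sqr_ge0 _))).
Qed.
Let kap0 : 0 < kap.
Proof. exact: mulr_gt0 e2 (exprn_gt0 _ e4). Qed.

Lemma step_constant_ge :
  [/\ [/\ 1 <= D, B <= D, Lc / (eta / 2) <= D & B / (eta / 2) <= D],
      [/\ Dg <= D, Dg / (eta / 4) <= D & Dq / kap <= D] &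
      3 * Dg / (eta / 4) <= D /\
      2 * B / (eta / 4) + 2 * Dg / (eta / 4) <= D].
Proof.
have h1 : 0 <= Lc / (eta / 2) := divr_ge0 Lc0 (ltW e2).
have h2 : 0 <= B / (eta / 2) := divr_ge0 B0 (ltW e2).
have h3 : 0 <= Dg / (eta / 4) := divr_ge0 Dg0 (ltW e4).
have h4 : 0 <= Dq / kap := divr_ge0 Dq0 (ltW kap0).
have h5 : 0 <= 2 * B / (eta / 4) := divr_ge0 (mulr_ge0 (ler0n _ 2) B0) (ltW e4).
have h6 : 0 <= 3 * Dg / (eta / 4) := divr_ge0 (mulr_ge0 (ler0n _ 3) Dg0) (ltW e4).
have h7 : 0 <= 2 * Dg / (eta / 4) := divr_ge0 (mulr_ge0 (ler0n _ 2) Dg0) (ltW e4).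
have := B0; have := Dg0; rewrite /step_constant => ? ?.
by do !split; lra.
Qed.

Let edge_sum_le e (u : hvertex q -> bool -> K) b :
  (forall w c, N (u w c) <= 2) -> N (edge_sum U e u b) <= B.
Proof.
move=> u2; rewrite /B.
have -> : 2 ^+ M = #|{set hvertex q}|%:R :> R.
  by rewrite -[#|{set _}|]cardsT -powersetT card_powerset cardsT natrX.
apply: (abs_sum_le av); first by rewrite mulr_ge0 ?exprn_ge0 ?(le_trans ler01 C01).
move=> S _; rewrite (absM av) -[#|{set _}|]cardsT -powersetT card_powerset cardsT.
rewrite natrX; apply: ler_pM; rewrite ?(abs_ge0 av) //.
by apply: (abs_prod_le av) => [|w _]; rewrite ?ler1n.
Qed.

Let edge_sum_lip e (u : hvertex q -> bool -> K) b d : 0 <= d <= 1 ->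
  (forall w c, w \in hset e -> N (u w c - 1) <= d) ->
  N (edge_sum U e u b - edge_sum U e (fun _ _ => 1) b) <= B * d.
Proof.
move=> d01 ud; rewrite /edge_sum -sumrB /B -mulrA.
have [d0 d1] := andP d01.
have -> : 2 ^+ M = #|{set hvertex q}|%:R :> R.
  by rewrite -[#|{set _}|]cardsT -powersetT card_powerset cardsT natrX.
apply: (abs_sum_le av); first by rewrite !mulr_ge0 ?exprn_ge0 ?(le_trans ler01 C01).
move=> S _; rewrite -mulrBl (absM av) mulrAC.
rewrite -[#|{set _}|]cardsT -powersetT card_powerset cardsT natrX.
apply: ler_pM; rewrite ?(abs_ge0 av) //.
under eq_bigr => w _ do rewrite -[u w _](subrK 1) addrC.
have := @prod_perturb R K N av _ [pred w in hset e] (fun=> 1)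
  (fun w => u w (w \in S) - 1) 1 d (lexx _) d01.
by rewrite expr1n mulr1; apply => w we; rewrite ?(abs1 av) //; exact: ud.
Qed.

Let unrooted_le (u : hvertex q -> 'I_k -> bool -> K) :
  (forall w j c, N (u w j c) <= 2) -> N (unrooted_factor U u) <= B ^+ E.
Proof. by move=> u2; apply: (abs_prod_le av) => // e _; apply: edge_sum_le. Qed.

Let unrooted_lip (u : hvertex q -> 'I_k -> bool -> K) d :
  0 <= d <= 1 -> B * d <= 1 -> (forall w j c, N (u w j c - 1) <= d) ->
  N (unrooted_factor U u - unrooted_factor U (fun=> one)) <= Lc * d.
Proof.
move=> d01 Bd ud; have [d0 d1] := andP d01.
rewrite /unrooted_factor.
under eq_bigr => e _ do rewrite -[edge_sum U e _ _](subrK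
  (edge_sum U e (fun _ _ => 1) false)) addrC.
rewrite /Lc -[_ * d]mulrA.
apply: (@prod_perturb _ _ _ av) => //.
- by rewrite mulr_ge0 ?Bd.
- by move=> e _; apply: edge_sum_le => w c; rewrite (abs1 av) ler1n.
- by move=> e _; apply: edge_sum_lip.
Qed.

Let c0 := unrooted_factor U (fun=> one).
Let b0 := root_factor U (fun=> one).

Let fixed_one (x : cube k) : c0 * \prod_j b0 j (x j) = 1.
Proof.
have -> : c0 * \prod_j b0 j (x j) = weighted_map U (tensor one) x.
  by rewrite /weighted_map polarized_tensorE ffunE [tensor _ _]ffunE.
have -> : tensor one = [ffun=> 1].
  by apply/ffunP => y; rewrite !ffunE big1.
by rewrite U1 ffunE.
Qed.

Let N2 : N 1 <= 2 :> R. Proof. by rewrite (abs1 av) ler1n. Qed.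

Let b0_le j b : N (b0 j b) <= B.
Proof. exact: edge_sum_le. Qed.

(* The constant and the factors of the image of 1 are bounded above, and their
   product is 1, so none of them is small. *)
Let c0_ge : eta <= N c0.
Proof.
have := congr1 N (fixed_one [ffun=> false]); rewrite (absM av) (abs1 av) => cb.
have Pb : N (\prod_j b0 j ([ffun=> false] j)) <= B ^+ E * B ^+ k.
  apply: (@le_trans _ _ (B ^+ k)); last by rewrite ler_peMl.
  rewrite ordX; apply: (abs_prod_le av) => // j _; exact: b0_le.
rewrite /eta -[X in X <= _]mul1r ler_pdivrMr; last by rewrite mulr_gt0 // (lt_le_trans ltr01) ?BX1.
by rewrite -cb ler_wpM2l ?(abs_ge0 av).
Qed.

Let b0_ge j b : eta <= N (b0 j b).
Proof.
have := congr1 N (fixed_one [ffun=> b]); rewrite (absM av) (abs1 av).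
rewrite (bigD1 j) //= ffunE (absM av) mulrCA => cb.
rewrite /eta -[X in X <= _]mul1r ler_pdivrMr; last by rewrite mulr_gt0 // (lt_le_trans ltr01) ?BX1.
rewrite -cb ler_wpM2l ?(abs_ge0 av) //.
apply: ler_pM; rewrite ?(abs_ge0 av) //; first exact: unrooted_le.
by rewrite ordX; apply: (abs_prod_le av) => // i _; exact: b0_le.
Qed.

(* Changing one bit changes one factor of a product that is always 1. *)
Let b0_const j : b0 j true = b0 j false.
Proof.
pose x b : cube k := [ffun i => if i == j then b else false].
have split_one c : b0 j c * (c0 * \prod_(i | i != j) b0 i false) = 1.
  rewrite -[RHS](fixed_one (x c)) /x [X in _ = _ * X](bigD1 j) //= ffunE eqxx [RHS]mulrCA; congr (_ * (_ * _)).
  by apply: eq_bigr => i /negbTE ij; rewrite ffunE ij.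
have p0 : c0 * \prod_(i | i != j) b0 i false != 0.
  apply/eqP => p0; have := split_one true.
  by rewrite p0 mulr0 => /eqP; rewrite eq_sym oner_eq0.
by apply: (mulIf p0); rewrite !split_one.
Qed.

Variables (a : 'I_k -> bool -> K) (h : {ffun cube k -> K}) (tau rho eps : R).
Hypothesis a_false : forall j, a j false = 1.
Hypothesis a_near : forall j, N (a j true - 1) <= tau.
Hypothesis a_fixed : forall j, label_map q j = j -> N (a j true - 1) <= rho.
Hypothesis h_small : forall x, N (h x) <= eps.
Hypothesis rho0 : 0 <= rho <= tau.
Hypothesis eps0 : 0 <= eps.
Hypothesis Dtau : D * tau <= 1.
Hypothesis Deps : D * eps <= 1.

Let a_near' j b : N (a j b - 1) <= tau.
Proof.
have [r0 rt] := andP rho0; case: b => //.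
by rewrite a_false subrr (abs0 av) (le_trans r0).
Qed.

Let scaled c t : 0 <= t -> c <= D -> D * t <= 1 -> c * t <= 1.
Proof. by move=> t0 cD; apply: le_trans; rewrite ler_wpM2r. Qed.

Let scaled_div c t e : 0 < e -> 0 <= t -> c / e <= D -> D * t <= 1 -> c * t <= e.
Proof.
move=> e0 t0 cD /(scaled t0 cD); rewrite mulrAC ler_pdivrMr ?mul1r //.
Qed.

Let tau0 : 0 <= tau.
Proof. by have [r0 rt] := andP rho0; exact: le_trans rt. Qed.

Let tau1 : tau <= 1.
Proof.
have [[D1 _ _ _] _ _] := step_constant_ge; rewrite -[tau]mul1r.
exact: scaled tau0 D1 Dtau.
Qed.

Let eps1 : eps <= 1.
Proof.
have [[D1 _ _ _] _ _] := step_constant_ge; rewrite -[eps]mul1r.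
exact: scaled eps0 D1 Deps.
Qed.

Let a_le j b : N (a j b) <= 2.
Proof.
rewrite -[a j b](subrK 1) (le_trans (absD av _ _)) // (abs1 av).
by have := a_near' j b; have := tau1; lra.
Qed.

(* b and c are the factors and the constant of the image of the tensor a, and p
   are these factors corrected to first order for the error h. Dividing p by
   its values at false gives a', and what is left is the error h'. *)
Let b := root_factor U (fun=> a).
Let c := unrooted_factor U (fun=> a).
Let G := slope U own a h.
Let g j x := G j x / c.
Let p j x := b j x + g j x.
Let K' := c * \prod_j p j false.
Let a' j x := p j x / p j false.
Let h' : {ffun cube k -> K} :=
  [ffun x => (weighted_map U [ffun y => tensor a y + h y] x - c * tensor p x) / K'].

Let b_le j x : N (b j x) <= B.
Proof. by apply: edge_sum_le => w e; exact: a_le. Qed.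

(* The label read by b j is fixed, so the sharper bound rho applies. *)
Let b_near j x : N (b j x - b0 j x) <= B * rho.
Proof.
have [r0 rt] := andP rho0.
apply: edge_sum_lip => [|w e _]; first by rewrite r0 (le_trans rt).
case: e; first by apply: a_fixed; exact: idem.
by rewrite a_false subrr (abs0 av).
Qed.

Let c_ge : eta / 2 <= N c.
Proof.
have [[_ BD LD _] _ _] := step_constant_ge.
have lip : N (c - c0) <= Lc * tau.
  apply: unrooted_lip => [||w j x]; [by rewrite tau0 tau1| |exact: a_near'].
    exact: scaled tau0 BD Dtau.
have := scaled_div e2 tau0 LD Dtau => Lt.
have := abs_ge_sub av c0 (c - c0); rewrite [c0 + _]addrC subrK.
by have := c0_ge; lra.
Qed.

Let b_ge j x : eta / 2 <= N (b j x).
Proof.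
have [r0 rt] := andP rho0.
have [[_ _ _ BD] _ _] := step_constant_ge.
have Bt := scaled_div e2 tau0 BD Dtau.
have Br : B * rho <= B * tau by rewrite ler_wpM2l.
have := abs_ge_sub av (b0 j x) (b j x - b0 j x); rewrite [b0 _ _ + _]addrC subrK.
by have := b_near j x; have := b0_ge j x; lra.
Qed.

Let G_le j x : N (G j x) <= Ds * eps.
Proof.
rewrite /G /slope /Ds -mulrA; apply: (abs_sum_le av) => [|w _].
  exact: mulr_ge0 (mulr_ge0 (ler0n _ _) (mulr_ge0 (BX0 _) B0)) eps0.
rewrite -mulrA; apply: (abs_sum_le av) => [|z _].
  exact: mulr_ge0 (mulr_ge0 (BX0 _) B0) eps0.
have sp2 u i y : N (spike a w z u i y) <= 2.
  rewrite /spike; case: ifP => // _; rewrite /delta.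
  by case: (y == z i); rewrite ?(abs1 av) ?(abs0 av) ?ler1n ?ler0n.
rewrite !(absM av) mulrC; apply: ler_pM; rewrite ?mulr_ge0 ?(abs_ge0 av) //.
apply: ler_pM; rewrite ?(abs_ge0 av) //; first exact: unrooted_le.
exact: edge_sum_le.
Qed.

Let g_le j x : N (g j x) <= Dg * eps.
Proof. by rewrite /Dg mulrAC; apply: (abs_div_le av e2) => //; exact: c_ge. Qed.

Let Dg_eps1 : Dg * eps <= 1.
Proof. by have [_ [DgD _ _] _] := step_constant_ge; exact: scaled. Qed.

Let p_ge j x : eta / 4 <= N (p j x).
Proof.
have [_ [_ DgD _] _] := step_constant_ge.
have := scaled_div e4 eps0 DgD Deps.
have := abs_ge_sub av (b j x) (g j x); rewrite -/(p j x).
by have := b_ge j x; have := g_le j x; lra.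
Qed.

Let K'_ge : kap <= N K'.
Proof.
rewrite /K' /kap (absM av) [N (\prod_j p j false)](abs_prod av); apply: ler_pM.
- exact: ltW.
- exact/exprn_ge0/ltW.
- exact: c_ge.
rewrite ordX -prodr_const; apply: ler_prod => j _.
by rewrite (ltW e4) p_ge.
Qed.

Let tensor_a_le x : N (tensor a x) <= 2 ^+ k.
Proof.
rewrite ffunE ordX; apply: (abs_prod_le av) => [|j _]; rewrite ?ler1n ?a_le //.
Qed.

Let first_order x :
  N (weighted_map U [ffun y => tensor a y + h y] x - weighted_map U (tensor a) x -
     linearized_map U (tensor a) h x) <= Dr * eps ^+ 2.
Proof.
rewrite !ffunE -!sumrB /Dr -mulrA; apply: (abs_sum_le av) => [|Y _].
  exact: mulr_ge0 (mulr_ge0 (mulr_ge0 (p2 _) (exprn_ge0 _ (p2 _))) (exprn_ge0 _ C00)) (sqr_ge0 _).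
rewrite -!mulrBl (absM av) mulrAC; apply: ler_pM; rewrite ?(abs_ge0 av) //.
  under eq_bigr => w _ do rewrite ffunE.
  apply: (@prod_perturb2 _ _ _ av _ predT) => //; first by rewrite eps0.
rewrite /E; exact: (abs_prod_le av).
Qed.

Let product_order x :
  N (tensor p x - tensor b x - \sum_j g j (x j) * \prod_(i | i != j) b i (x i)) <=
  2 ^+ k * B ^+ k * (Dg * eps) ^+ 2.
Proof.
rewrite !ffunE 2!ordX.
apply: (@prod_perturb2 _ _ _ av _ predT) => //.
by rewrite mulr_ge0.
Qed.

(* The first-order effect of h on the image is, by the linearization at a tensor,
   exactly the first-order difference of the tensors of p and b. *)
Let rem_le x :
  N (weighted_map U [ffun y => tensor a y + h y] x - c * tensor p x) <= Dq * eps ^+ 2.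
Proof.
have -> : weighted_map U [ffun y => tensor a y + h y] x - c * tensor p x =
  (weighted_map U [ffun y => tensor a y + h y] x - weighted_map U (tensor a) x -
     linearized_map U (tensor a) h x) -
  c * (tensor p x - tensor b x - \sum_j g j (x j) * \prod_(i | i != j) b i (x i)).
  have -> : weighted_map U (tensor a) x = c * tensor b x.
    by rewrite /weighted_map polarized_tensorE ffunE.
  rewrite (linearized_tensorE U a h x ownP).
  have -> : \sum_j slope U own a h j (x j) * \prod_(i | i != j) root_factor U (fun=> a) i (x i) =
     c * \sum_j g j (x j) * \prod_(i | i != j) b i (x i).
    rewrite big_distrr; apply: eq_bigr => j _ /=.
    by rewrite mulrA [c * _]mulrC divfK // (abs_neq0 av) // (lt_le_trans e2).
  by ring.
rewrite (le_trans (abs_sub av _ _)) // /Dq mulrDl lerD ?first_order //.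
rewrite (absM av) -!mulrA; apply: ler_pM; rewrite ?(abs_ge0 av) //.
  by apply: unrooted_le => w j y; exact: a_le.
by rewrite (le_trans (product_order x)) // [(Dg * eps) ^+ 2]exprMn !mulrA.
Qed.

(** To first order an error off the tensors changes the factors of the image one
    at a time, so it can be absorbed in these factors, and an error of second
    order remains. The factors at fixed labels only move by the absorbed error;
    the others are functions of them, up to this error. *)
Lemma local_step : exists K' a' (h' : {ffun cube k -> K}),
  [/\ K' != 0,
      weighted_map U [ffun x => tensor a x + h x] =
        [ffun x => K' * (tensor a' x + h' x)],
      forall j, a' j false = 1,
      forall j, label_map q j = j -> N (a' j true - a j true) <= D * eps &
      (forall j, N (a' j true - 1) <= D * (rho + eps)) /\
      forall x, N (h' x) <= D * eps ^+ 2].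
Proof.
have K'0 : K' != 0 by rewrite (abs_neq0 av) // (lt_le_trans kap0).
have pf0 j x : p j x != 0 by rewrite (abs_neq0 av) // (lt_le_trans e4).
have [_ [_ _ hD] [fD nD]] := step_constant_ge.
exists K', a', h'; split => //.
- apply/ffunP => x; rewrite [RHS]ffunE [h' x]ffunE mulrDr.
  rewrite [K' * (_ / K')]mulrC divfK //.
  have -> : K' * tensor a' x = c * tensor p x.
    rewrite [tensor a' x]ffunE [tensor p x]ffunE /K' -mulrA -big_split /=; congr (_ * _).
    by apply: eq_bigr => j _; rewrite /a' mulrC divfK.
  by rewrite addrC subrK.
- by move=> j; rewrite /a' divff.
- move=> j fj; have bE x : b j x = a j x.
    have [w _ bw] := edge_sum_identity (Uid fj).
    by rewrite /b /root_factor bw fj.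
  have -> : a' j true - a j true = (g j true - a j true * g j false) / p j false.
    rewrite /a'; have pj := pf0 j false; apply: (mulIf pj).
    rewrite mulrBl !divfK // {1 2}/p !bE a_false; ring.
  have bound : N (g j true - a j true * g j false) <= 3 * Dg * eps.
    rewrite (le_trans (abs_sub av _ _)) // (absM av).
    have h1 : N (a j true) * N (g j false) <= 2 * (Dg * eps).
      by apply: ler_pM; rewrite ?(abs_ge0 av).
    by have := g_le j true; lra.
  rewrite (le_trans (abs_div_le av e4 bound (p_ge j false))) //.
  by rewrite mulrAC ler_wpM2r.
split => [j|x].
  have -> : a' j true - 1 = (p j true - p j false) / p j false.
    by rewrite mulrBl divff.
  have bound : N (p j true - p j false) <= 2 * B * rho + 2 * Dg * eps.
    have -> : p j true - p j false = (b j true - b0 j true) - (b j false - b0 j false)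
       + (g j true - g j false) by rewrite /p b0_const; ring.
    rewrite (le_trans (absD av _ _)) // (le_trans (lerD (abs_sub av _ _) (abs_sub av _ _))) //.
    have := g_le j true; have := g_le j false; have := b_near j true.
    by have := b_near j false; lra.
  rewrite (le_trans (abs_div_le av e4 bound (p_ge j false))) // mulrDl.
  have [r0 _] := andP rho0.
  have h5 : 0 <= 2 * B / (eta / 4) := divr_ge0 (mulr_ge0 (ler0n _ 2) B0) (ltW e4).
  have h7 : 0 <= 2 * Dg / (eta / 4) := divr_ge0 (mulr_ge0 (ler0n _ 2) Dg0) (ltW e4).
  rewrite mulrAC [2 * Dg * eps / _]mulrAC mulrDr.
  by apply: lerD; rewrite ler_wpM2r //; lra.
rewrite ffunE (le_trans (abs_div_le av kap0 (rem_le x) K'_ge)) //.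
by rewrite mulrAC ler_wpM2r ?sqr_ge0.
Qed.

End Local.

(** * Uniform stability of the constant vector *)

Lemma weighted_map_scale (A : comNzRingType) (k : nat) (r : reduced_data k)
    (W : weight A r) (c : A) (v : {ffun cube k -> A}) :
  weighted_map W [ffun x => c * v x] =
  [ffun x => c ^+ #|hvertex r| * weighted_map W v x].
Proof.
apply/ffunP => x; rewrite !ffunE big_distrr /=; apply: eq_bigr => Y _.
under eq_bigr => w _ do rewrite ffunE.
by rewrite big_split /= prodr_const mulrA.
Qed.

Section Dynamics.
Variables (R : realFieldType) (K : fieldType) (N : K -> R).
Hypothesis av : absolute_value N.
Variables (k : nat) (q : reduced_data k).
Variable own : hvertex q -> 'I_k.
Hypothesis ownP : forall w i, i != own w -> w \notin hset (phi q i).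
Hypothesis idem : forall j, label_map q (label_map q j) = label_map q j.
Variable C0 : R.
Hypothesis C01 : 1 <= C0.

Local Notation D := (step_constant q C0).

Let D1 : 1 <= D. Proof. by have [[]] := step_constant_ge q C01. Qed.

Let D0 : 0 < D. Proof. exact: lt_le_trans D1. Qed.

(** Here [rho] bounds the deviation from 1 at the fixed labels and [eps] the
    error off the tensors. One step adds [D * eps] to [rho] and at least halves
    [eps], so [rho + 2 * D * eps] does not grow. *)
Definition near_tensor (r0 : R) (v : {ffun cube k -> K}) : Prop :=
  exists c a (h : {ffun cube k -> K}) (rho eps : R),
  [/\ c != 0 /\ v = [ffun x => c * (tensor a x + h x)],
      forall j, a j false = 1,
      forall j, label_map q j = j -> N (a j true - 1) <= rho,
      (forall j, N (a j true - 1) <= D * r0) /\ (forall x, N (h x) <= eps) &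
      [/\ 0 <= rho, 0 <= eps & rho + 2 * D * eps <= r0]].

Lemma near_tensor_step (U : weight K q) r0 (v : {ffun cube k -> K}) :
  (forall e S b, N (U e S b) <= C0) ->
  (forall j, label_map q j = j -> identity_edge U (phi q j)) ->
  weighted_map U [ffun=> 1] = [ffun=> 1] ->
  0 < r0 -> D * (D * r0) <= 1 ->
  near_tensor r0 v -> near_tensor r0 (weighted_map U v).
Proof.
move=> UC Uid U1 r00 Dr [c [a [h [rho [eps]]]]].
move=> [[c0 ->] a0 ar [ad hs] [rho0 eps0 re]].
have Deps0 : 0 <= D * eps by rewrite mulr_ge0 // ltW.
have D_eps_r0 : 2 * (D * eps) <= r0 by lra.
have r0D : r0 <= D * r0 by rewrite ler_peMl // ltW.
have rD : rho <= D * r0 by lra.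
have Dr0 : 0 <= D * r0 by exact: mulr_ge0 (ltW D0) (ltW r00).
have DDr : D * r0 <= D * (D * r0) by rewrite ler_peMl.
have Deps : D * eps <= 1 by lra.
have rho01 : 0 <= rho <= D * r0 by rewrite rho0 rD.
have [K' [a' [h' [K'0 FE a'0 a'f [a'n h'n]]]]] :=
  local_step av ownP idem C01 UC Uid U1 a0 ad ar hs rho01 eps0 Dr Deps.
exists (c ^+ #|hvertex q| * K'), a', h', (rho + D * eps), (D * eps ^+ 2).
split => //.
- split; first by rewrite mulf_neq0 // expf_neq0.
  have -> : [ffun x => c * (tensor a x + h x)] =
      [ffun x => c * [ffun x => tensor a x + h x] x].
    by apply/ffunP => x; rewrite !ffunE.
  rewrite weighted_map_scale FE; apply/ffunP => x.
  by rewrite ffunE [in LHS]ffunE [in RHS]ffunE mulrA.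
- move=> j fj; have -> : a' j true - 1 = (a j true - 1) + (a' j true - a j true) by ring.
  by rewrite (le_trans (absD av _ _)) // lerD ?ar ?a'f.
- split=> // j; rewrite (le_trans (a'n j)) // ler_pM2l //.
  have : eps <= D * eps by rewrite ler_peMl.
  by lra.
split; first by rewrite addr_ge0.
  by rewrite mulr_ge0 ?sqr_ge0 // ltW.
have : 2 * D * (D * eps ^+ 2) <= D * eps.
  have -> : 2 * D * (D * eps ^+ 2) = (2 * (D * eps)) * (D * eps) by ring.
  rewrite ler_piMl // (le_trans D_eps_r0) // (le_trans r0D) //.
  by rewrite (le_trans _ Dr) // ler_peMl // mulr_ge0 // ltW.
by lra.
Qed.

(** The constant vector 1 is a fixed point that is stable uniformly in the
    weights: the error that is not along tensors decays quadratically, so the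
    drift of the fixed labels, which is linear in this error, is summable. *)
Lemma local_dynamics kappa : 0 < kappa ->
  exists2 e0 : R, 0 < e0 & forall U : weight K q,
  (forall e S b, N (U e S b) <= C0) ->
  (forall j, label_map q j = j -> identity_edge U (phi q j)) ->
  weighted_map U [ffun=> 1] = [ffun=> 1] ->
  forall v : {ffun cube k -> K}, (forall x, N (v x - 1) <= e0) ->
  forall n, exists2 c, c != 0 &
    forall x, N (iter n (weighted_map U) v x - c) <= kappa * N c.
Proof.
move=> kap0.
pose r0 := Num.min (D * D)^-1 (kappa / (2 ^+ k * D + 1)).
have P0 : 0 < 2 ^+ k * D + 1 by rewrite addr_gt0 // mulr_gt0 // exprn_gt0.
have r00 : 0 < r0.
  by rewrite /r0 lt_min invr_gt0 mulr_gt0 //= divr_gt0.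
have Dr : D * (D * r0) <= 1.
  rewrite mulrA mulrC -ler_pdivlMr ?mulr_gt0 // mul1r /r0.
  by rewrite ge_min lexx.
have kr : (2 ^+ k * D + 1) * r0 <= kappa.
  by rewrite mulrC -ler_pdivlMr // /r0 ge_min lexx orbT.
have DD0 : 0 < 2 * D by rewrite mulr_gt0.
exists (r0 / (2 * D)) => [|U UC Uid U1 v v1 n]; first by rewrite divr_gt0.
have : near_tensor r0 (iter n (weighted_map U) v).
  elim: n => [|n IHn]; last exact: near_tensor_step.
  exists 1, (fun _ _ => 1), [ffun x => v x - 1], 0, (r0 / (2 * D)).
  split=> //=.
  - split; first exact: oner_neq0.
    apply/ffunP => x; rewrite !ffunE mul1r big1 // addrC subrK //.
  - by move=> j _; rewrite subrr (abs0 av).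
  - split=> [j|x]; last by rewrite ffunE.
    by rewrite subrr (abs0 av) mulr_ge0 // ltW.
  split=> //; first by rewrite divr_ge0 // ltW.
  by rewrite add0r mulrC divfK // lt0r_neq0.
move=> [c [a [h [rho [eps [[c0 ->] a0 _ [ad hs] [rho0 eps0 re]]]]]]].
exists c => // x; rewrite ffunE -[X in _ - X]mulr1 -mulrBr (absM av) mulrC.
rewrite ler_wpM2r ?(abs_ge0 av) // (le_trans _ kr) //.
have -> : tensor a x + h x - 1 = (tensor a x - 1) + h x by ring.
rewrite (le_trans (absD av _ _)) // mulrDl mul1r; apply: lerD; last first.
  have : eps <= D * eps by rewrite ler_peMl.
  have : 0 <= D * eps by exact: mulr_ge0 (ltW D0) eps0.
  by have := hs x; lra.
have Dr0 : 0 <= D * r0 by exact: mulr_ge0 (ltW D0) (ltW r00).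
have d01 : 0 <= D * r0 <= 1 by rewrite Dr0 (le_trans _ Dr) // ler_peMl.
have := @prod_perturb R K N av _ predT (fun=> 1)
  (fun j => a j (x j) - 1) 1 _ (lexx _) d01.
rewrite ffunE expr1n mulr1 card_ord [X in _ - X]big1 // -mulrA.
under eq_bigr => j _ do rewrite addrC subrK.
apply=> j _; first by rewrite (abs1 av).
case: (x j) => //; rewrite a0 subrr (abs0 av).
by have [] := andP d01.
Qed.

End Dynamics.

(** * Laurent polynomials without cancellation *)

Section Large.
Variables (R : realFieldType) (K : numFieldType) (N : K -> R).
Hypothesis av : absolute_value N.

Lemma absX x n : N (x ^+ n) = N x ^+ n.
Proof. by elim: n => [|n IHn]; rewrite ?(abs1 av) // !exprS (absM av) IHn. Qed.

Definition for_large (Q : K -> Prop) : Prop :=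
  exists L : R, forall x, L <= N x -> Q x.

Lemma for_large_and Q1 Q2 :
  for_large Q1 -> for_large Q2 -> for_large (fun x => Q1 x /\ Q2 x).
Proof.
move=> [L1 H1] [L2 H2]; exists (Num.max L1 L2) => x; rewrite ge_max => /andP[h1 h2].
by split; [apply: H1|apply: H2].
Qed.

Lemma for_large_mono (Q1 Q2 : K -> Prop) :
  (forall x, Q1 x -> Q2 x) -> for_large Q1 -> for_large Q2.
Proof. by move=> Q12 [L H]; exists L => x /H/Q12. Qed.

Lemma for_large_all (I : finType) (Q : I -> K -> Prop) :
  (forall i, for_large (Q i)) -> for_large (fun x => forall i, Q i x).
Proof.
move=> ev; suff [L H] : for_large (fun x => forall i, i \in enum I -> Q i x).
  by exists L => x /H Qx i; apply: Qx; rewrite mem_enum.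
elim: (enum I) => [|i s [L H]]; first by exists 0.
have [L' H'] := ev i; exists (Num.max L L') => x; rewrite ge_max => /andP[hL hL'] j.
by rewrite inE => /predU1P[->|/(H x hL)]; [exact: H'|].
Qed.

Lemma for_large_lt (Q : nat -> K -> Prop) n :
  (forall i, for_large (Q i)) -> for_large (fun x => forall i, (i < n)%N -> Q i x).
Proof.
move=> ev; have [L H] := @for_large_all 'I_n (fun i => Q i) (fun i => ev i).
by exists L => x /H Qx i ltin; have := Qx (Ordinal ltin).
Qed.

Lemma for_large_neq0 : for_large (fun x => x != 0).
Proof. by exists 1 => x x1; rewrite (abs_neq0 av) // (lt_le_trans ltr01). Qed.

Lemma bounded_family (I : finType) (F : I -> K -> K) (G : I -> K -> K) :
  (forall i, exists C : R, for_large (fun x => N (F i x) <= C * N (G i x))) ->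
  exists2 C : R, 1 <= C &
    for_large (fun x => forall i, N (F i x) <= C * N (G i x)).
Proof.
move=> bd; suff [C C1 [L H]] : exists2 C : R, 1 <= C &
    for_large (fun x => forall i, i \in enum I -> N (F i x) <= C * N (G i x)).
  by exists C => //; exists L => x /H Qx i; apply: Qx; rewrite mem_enum.
elim: (enum I) => [|i s [C C1 [L H]]]; first by exists 1 => //; exists 0.
have [C' [L' H']] := bd i; exists (Num.max C C'); first by rewrite le_max C1.
exists (Num.max L L') => x; rewrite ge_max => /andP[hL hL'] j.
rewrite inE => /predU1P[->|/(H x hL) b].
  by rewrite (le_trans (H' x hL')) // ler_wpM2r ?(abs_ge0 av) // le_max lexx orbT.
by rewrite (le_trans b) // ler_wpM2r ?(abs_ge0 av) // le_max lexx.
Qed.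

Lemma horner_le (P : {poly K}) n x : (size P <= n.+1)%N -> 1 <= N x ->
  N P.[x] <= (\sum_(i < size P) N P`_i) * N x ^+ n.
Proof.
move=> sP x1; rewrite horner_coef (le_trans (abs_sum av _ _)) // mulr_suml.
apply: ler_sum => i _; rewrite (absM av) ler_wpM2l ?(abs_ge0 av) // absX.
by rewrite ler_weXn2l // -ltnS (leq_trans (ltn_ord i)).
Qed.

(** For large arguments the lower terms sum up to at most half of the leading
    one. *)
Lemma horner_ge (S : {poly K}) : S != 0 ->
  exists2 c : R, 0 < c & for_large (fun x => c * N x ^+ (size S).-1 <= N S.[x]).
Proof.
move=> S0; set n := (size S).-1.
have lS : 0 < N (lead_coef S) by rewrite (abs_gt0 av) // lead_coef_eq0.
pose T := S - lead_coef S *: 'X^n.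
pose A := \sum_(i < size T) N T`_i.
have A0 : 0 <= A by apply: sumr_ge0 => i _; exact: (abs_ge0 av).
exists (N (lead_coef S) / 2); first by rewrite divr_gt0.
exists (Num.max 1 (2 * A / N (lead_coef S))) => x.
rewrite ge_max => /andP[x1 xA].
have SE : S.[x] = lead_coef S * x ^+ n + T.[x].
  by rewrite /T hornerD hornerN hornerZ hornerXn addrC subrK.
have sT : (size T <= n)%N.
  apply/leq_sizeP => i ni; rewrite /T coefB coefZ coefXn.
  have [->|/eqP ine] := eqVneq i n; first by rewrite mulr1 subrr.
  rewrite mulr0 subr0 nth_default //.
  rewrite /n in ni ine; move: (ni); rewrite leq_eqVlt eq_sym.
  by case: eqP => // _ /=; case: (size S).
have Tle : N T.[x] <= N (lead_coef S) / 2 * N x ^+ n.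
  case En : n sT => [|n'] sT.
    have /size_poly_leq0P -> := sT.
    by rewrite horner0 (abs0 av) mulr_ge0 ?divr_ge0 ?(abs_ge0 av) ?exprn_ge0 ?(abs_ge0 av).
  rewrite (le_trans (horner_le sT x1)) // -/A exprS mulrA.
  rewrite ler_wpM2r ?exprn_ge0 ?(abs_ge0 av) //.
  by move: xA; rewrite ler_pdivrMr // => xA; lra.
have := abs_ge_sub av (lead_coef S * x ^+ n) T.[x]; rewrite -SE (absM av) absX.
by lra.
Qed.

Lemma horner_large_neq0 (S : {poly K}) : S != 0 -> for_large (fun x => S.[x] != 0).
Proof.
move=> S0; have [c c0 [L H]] := horner_ge S0; exists (Num.max 1 L) => x.
rewrite ge_max => /andP[x1 /H]; move=> h; rewrite (abs_neq0 av) // (lt_le_trans _ h) //.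
by rewrite mulr_gt0 // exprn_gt0 // (lt_le_trans ltr01).
Qed.

Lemma horner_dominate (P S : {poly K}) : (size P <= size S)%N ->
  exists C : R, for_large (fun x => N P.[x] <= C * N S.[x]).
Proof.
have [->|S0] := eqVneq S 0.
  rewrite size_poly0 => /size_poly_leq0P ->; exists 0; exists 0 => x _.
  by rewrite horner0 (abs0 av) mulr0.
move=> sPS; have [c c0 [L H]] := horner_ge S0.
pose A := \sum_(i < size P) N P`_i.
have A0 : 0 <= A by apply: sumr_ge0 => i _; exact: (abs_ge0 av).
exists (A / c); exists (Num.max 1 L) => x; rewrite ge_max => /andP[x1 /H h].
have sP : (size P <= (size S).-1.+1)%N by rewrite prednK // size_poly_gt0.
rewrite (le_trans (horner_le sP x1)) // -/A -mulrA ler_wpM2l //.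
by rewrite mulrC ler_pdivlMr // mulrC.
Qed.

Lemma polyOver_nnegM (P Q : {poly K}) : P \is a polyOver Num.nneg ->
  Q \is a polyOver Num.nneg -> P * Q \is a polyOver Num.nneg.
Proof.
move=> /polyOverP P0 /polyOverP Q0; apply/polyOverP => i; rewrite coefM nnegrE.
by apply: sumr_ge0 => j _; rewrite mulr_ge0 // -nnegrE.
Qed.

Lemma polyOver_nnegD (P Q : {poly K}) : P \is a polyOver Num.nneg ->
  Q \is a polyOver Num.nneg -> P + Q \is a polyOver Num.nneg.
Proof.
move=> /polyOverP P0 /polyOverP Q0; apply/polyOverP => i; rewrite coefD nnegrE.
by rewrite addr_ge0 // -nnegrE.
Qed.

(** Laurent polynomials with nonnegative coefficients: in a sum of such
    functions there is no cancellation, not even of leading terms. *)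
Definition positive_laurent (f : K -> K) : Prop :=
  exists2 P : {poly K}, P \is a polyOver Num.nneg &
  exists n, forall x, x != 0 -> f x = P.[x] / x ^+ n.

Lemma positive_laurent_ext f g : (forall x, x != 0 -> f x = g x) ->
  positive_laurent f -> positive_laurent g.
Proof. by move=> fg [P P0 [n H]]; exists P => //; exists n => x x0; rewrite -fg // H. Qed.

Lemma positive_laurent_cst a : 0 <= a -> positive_laurent (fun=> a).
Proof.
move=> a0; exists a%:P; first by rewrite polyOverC.
by exists 0%N => x _; rewrite hornerC expr0 divr1.
Qed.

Lemma positive_laurentX n : positive_laurent (fun x => x ^+ n).
Proof.
exists 'X^n; first exact: polyOverXn.
by exists 0%N => x _; rewrite hornerXn expr0 divr1.
Qed.

Lemma positive_laurentVX n : positive_laurent (fun x => (x ^+ n)^-1).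
Proof.
exists 1; first by rewrite -polyC1 polyOverC nnegrE ler01.
by exists n => x _; rewrite hornerE mul1r.
Qed.

Lemma positive_laurentM f g : positive_laurent f -> positive_laurent g ->
  positive_laurent (fun x => f x * g x).
Proof.
move=> [P P0 [n fP]] [Q Q0 [m gQ]]; exists (P * Q); first exact: polyOver_nnegM.
by exists (n + m)%N => x x0; rewrite fP // gQ // hornerM exprD invfM mulrACA.
Qed.

Lemma common_denominator f g : positive_laurent f -> positive_laurent g ->
  exists P Q : {poly K}, [/\ P \is a polyOver Num.nneg, Q \is a polyOver Num.nneg &
  exists n, forall x, x != 0 -> f x = P.[x] / x ^+ n /\ g x = Q.[x] / x ^+ n].
Proof.
move=> [P P0 [n fP]] [Q Q0 [m gQ]]; exists (P * 'X^m), (Q * 'X^n).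
have XnO i : ('X^i : {poly K}) \is a polyOver Num.nneg by exact: polyOverXn.
split; [exact: polyOver_nnegM|exact: polyOver_nnegM|exists (n + m)%N => x x0].
have xn i : x ^+ i != 0 by rewrite expf_neq0.
rewrite fP // gQ // !hornerM !hornerXn exprD; split.
  by rewrite -mulf_div divff // mulr1.
by rewrite [x ^+ n * x ^+ m]mulrC -mulf_div divff // mulr1.
Qed.

Lemma positive_laurentD f g : positive_laurent f -> positive_laurent g ->
  positive_laurent (fun x => f x + g x).
Proof.
move=> pf pg; have [P [Q [P0 Q0 [n fg]]]] := common_denominator pf pg.
exists (P + Q); first exact: polyOver_nnegD.
by exists n => x x0; have [-> ->] := fg x x0; rewrite hornerD mulrDl.
Qed.

Lemma positive_laurent_sum (I : finType) (S : pred I) (F : I -> K -> K) :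
  (forall i, S i -> positive_laurent (F i)) ->
  positive_laurent (fun x => \sum_(i | S i) F i x).
Proof.
move=> FP; elim: (index_enum I) => [|i s IHs].
  by apply: positive_laurent_ext (positive_laurent_cst (lexx 0)) => x _; rewrite big_nil.
case Si : (S i); last first.
  by apply: positive_laurent_ext IHs => x _; rewrite big_cons Si.
by apply: positive_laurent_ext (positive_laurentD (FP i Si) IHs) => x _; rewrite big_cons Si.
Qed.

Lemma positive_laurent_prod (I : finType) (S : pred I) (F : I -> K -> K) :
  (forall i, S i -> positive_laurent (F i)) ->
  positive_laurent (fun x => \prod_(i | S i) F i x).
Proof.
move=> FP; elim: (index_enum I) => [|i s IHs].
  by apply: positive_laurent_ext (positive_laurent_cst ler01) => x _; rewrite big_nil.
case Si : (S i); last first.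
  by apply: positive_laurent_ext IHs => x _; rewrite big_cons Si.
by apply: positive_laurent_ext (positive_laurentM (FP i Si) IHs) => x _; rewrite big_cons Si.
Qed.

Lemma positive_laurent_ge0 f : positive_laurent f -> 0 <= f 1.
Proof.
move=> [P P0 [n ->]]; last exact: oner_neq0.
rewrite expr1n divr1 horner_coef; apply: sumr_ge0 => i _.
rewrite expr1n mulr1; have /polyOverP/(_ i) := P0.
by rewrite nnegrE.
Qed.

(** The value at 1 is the sum of the coefficients and detects the zero
    polynomial. *)
Lemma positive_laurent_neq0 f : positive_laurent f -> f 1 != 0 ->
  for_large (fun x => f x != 0).
Proof.
move=> [P P0 [n fP]] f1; have PN0 : P != 0.
  by apply: contraNneq f1 => PE; rewrite fP ?oner_neq0 // PE horner0 mul0r.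
apply: for_large_mono (for_large_and for_large_neq0 (horner_large_neq0 PN0)).
move=> x [x0 Px]; rewrite fP // mulf_neq0 // invr_eq0 expf_neq0 //.
Qed.

(** With nonnegative coefficients, the degree of a sum is at least the degree of
    each summand. *)
Lemma positive_laurent_dominate f g : positive_laurent f -> positive_laurent g ->
  exists C : R, for_large (fun x => N (f x) <= C * N (f x + g x)).
Proof.
move=> pf pg; have [P [Q [P0 Q0 [n fg]]]] := common_denominator pf pg.
have sPS : (size P <= size (P + Q)%R)%N.
  apply/leq_sizeP => i Si; have : (P + Q)`_i = 0 by rewrite nth_default.
  have /polyOverP/(_ i) := P0; have /polyOverP/(_ i) := Q0; rewrite !nnegrE => q0 p0.
  by rewrite coefD => /eqP; rewrite paddr_eq0 // => /andP[/eqP].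
have [C H] := horner_dominate sPS; exists C.
apply: for_large_mono (for_large_and for_large_neq0 H) => x [x0 h].
have [-> ->] := fg x x0; rewrite -mulrDl -hornerD !(absM av) mulrA.
by rewrite ler_wpM2r ?(abs_ge0 av).
Qed.

Lemma positive_laurent_dominate_sum (I : finType) (S : pred I) (F : I -> K -> K) i :
  (forall i, positive_laurent (F i)) -> S i ->
  exists C : R, for_large (fun x => N (F i x) <= C * N (\sum_(j | S j) F j x)).
Proof.
move=> FP Si; have [C H] := positive_laurent_dominate (FP i)
  (@positive_laurent_sum I (fun j => S j && (j != i)) F (fun j _ => FP j)).
by exists C; apply: for_large_mono H => x; rewrite [X in _ -> _ <= _ * N X](bigD1 i).
Qed.

End Large.

(** * Normalization by a reference tensor *)

Section Normalize.
Variables (K : fieldType) (k : nat) (r : reduced_data k) (W : weight K r).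
Variable a : 'I_k -> bool -> K.

Definition edge_value (e : hedge r) (b : bool) : K :=
  edge_sum W e (fun=> a (label e)) b.

(** Cutting [S] down to the edge makes every term a summand of [edge_value]. *)
Definition edge_term (e : hedge r) (S : {set hvertex r}) (b : bool) : K :=
  (\prod_(w in hset e) a (label e) (w \in S)) * W e (hset e :&: S) b.

(** The weights of the map conjugated by the tensor [a] on the input side and by
    its image on the output side. *)
Definition normalized_weight : weight K r :=
  fun e S b => edge_term e S b / edge_value e b.

Lemma edge_valueE e b :
  edge_value e b = \sum_(S : {set hvertex r} | S \subset hset e) edge_term e S b.
Proof.
by apply: eq_bigr => S /setIidPr Se; rewrite /edge_term Se.
Qed.

Hypothesis val0 : forall e b, edge_value e b != 0.

Lemma normalized_weightE (v : {ffun cube k -> K}) :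
  weighted_map W [ffun x => tensor a x * v x] =
  [ffun x => unrooted_factor W (fun=> a) *
    (tensor (root_factor W (fun=> a)) x * weighted_map normalized_weight v x)].
Proof.
apply/ffunP => x; rewrite [LHS]ffunE [RHS]ffunE mulrA.
have -> : unrooted_factor W (fun=> a) * tensor (root_factor W (fun=> a)) x =
    \prod_e edge_value e (root_bit x e).
  by rewrite [tensor _ _]ffunE (prod_root_bit edge_value).
rewrite [weighted_map _ v x]ffunE big_distrr /=; apply: eq_bigr => Y _.
under eq_bigr => w _ do rewrite ffunE.
rewrite big_split /= -mulrA mulrCA [RHS]mulrCA; congr (_ * _).
rewrite -big_split /=.
under [X in X * _]eq_bigr => w _ do rewrite ffunE.
rewrite prod_labels_edges -big_split /=; apply: eq_bigr => e _.
rewrite /normalized_weight [RHS]mulrC divfK // /edge_term (setIidPr (column_sub _ _)).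
by congr (_ * _); apply: eq_bigr => w we; rewrite inE we.
Qed.

Lemma normalized_weight1 : weighted_map normalized_weight [ffun=> 1] = [ffun=> 1].
Proof.
have := normalized_weightE [ffun=> 1].
have -> : [ffun x => tensor a x * [ffun=> 1] x] = tensor a.
  by apply/ffunP => x; rewrite !ffunE mulr1.
rewrite {1}/weighted_map polarized_tensorE.
move: (weighted_map normalized_weight _) => X /ffunP H; apply/ffunP => x.
have := H x; rewrite !ffunE mulrA -[X in X = _]mulr1 => /mulfI <- //.
rewrite -(prod_root_bit edge_value).
by apply/prodf_neq0.
Qed.

(** The value of an identity edge is the factor of [a] that it passes on, so the
    two cancel. *)
Lemma normalized_identity e : identity_edge W e ->
  identity_edge normalized_weight e.
Proof.
move=> We; have [w we WS] := edge_sum_identity We.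
case: We => w' [ew WE]; move: we; rewrite ew => /set1P ?; subst w'.
exists w; split=> // S b; rewrite /normalized_weight /edge_term ew big_set1 WE.
have := val0 e b; rewrite /edge_value WS !inE eqxx /= => ab.
by case: eqP => [->|]; rewrite ?mulr1 ?divff // mulr0 mul0r.
Qed.

End Normalize.

Section Bounds.
Variables (R : realFieldType) (K : fieldType) (N : K -> R).
Hypothesis av : absolute_value N.
Variables (k : nat) (r : reduced_data k).

Lemma iterate_weight_bounded n (C : R) : 1 <= C ->
  exists2 C' : R, 1 <= C' & forall W : weight K r,
    (forall e S b, N (W e S b) <= C) ->
    forall e S b, N (@iterate_weight K k r W n e S b) <= C'.
Proof.
move=> C1; elim: n => [|n [C' C'1 IHn]]; first by exists C.
have C0 : 0 <= C by exact: le_trans C1.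
have C'0 : 0 <= C' by exact: le_trans C'1.
pose B := #|{set hvertex r}|%:R * (C' ^+ #|hvertex r| * C).
have B0 : 0 <= B by rewrite !mulr_ge0 ?ler0n ?exprn_ge0.
exists (C' + B) => [|W WC e S b]; first by rewrite (le_trans C'1) // lerDl.
case: e => [[w e]|f] /=; first by rewrite (le_trans (IHn W WC _ _ _)) // lerDl.
rewrite (le_trans _ (_ : B <= _)) ?lerDr //.
apply: (abs_sum_le av) => [|T _]; first by rewrite mulr_ge0 // exprn_ge0.
rewrite (absM av); apply: ler_pM; rewrite ?(abs_ge0 av) //.
by apply: (abs_prod_le av) => // w _; apply: IHn.
Qed.

Lemma weighted_map_near_one (W : weight K r) (C d : R) (v : {ffun cube k -> K}) :
  1 <= C -> 0 <= d <= 1 -> (forall e S b, N (W e S b) <= C) ->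
  weighted_map W [ffun=> 1] = [ffun=> 1] ->
  (forall x, N (v x - 1) <= d) ->
  forall x, N (weighted_map W v x - 1) <=
    #|{ffun hvertex r -> cube k}|%:R * (2 ^+ #|hvertex r| * C ^+ #|hedge r|) * d.
Proof.
move=> C1 d01 WC W1 vd x; have [d0 _] := andP d01.
have C0 : 0 <= C by exact: le_trans C1.
have -> : weighted_map W v x - 1 =
    weighted_map W v x - weighted_map W [ffun=> 1] x by rewrite W1 [X in _ = _ - X]ffunE.
rewrite !ffunE -sumrB -mulrA; apply: (abs_sum_le av) => [|Y _].
  exact: mulr_ge0 (mulr_ge0 (exprn_ge0 _ (ler0n _ 2)) (exprn_ge0 _ C0)) d0.
rewrite -mulrBl (absM av) mulrAC; apply: ler_pM; rewrite ?(abs_ge0 av) //.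
  have := @prod_perturb R K N av _ predT (fun=> 1)
    (fun w : hvertex r => v (Y w) - 1) 1 d (lexx _) d01.
  rewrite expr1n mulr1.
  under eq_bigr => w _ do rewrite addrC subrK.
  under [X in _ -> N (_ - X) <= _]eq_bigr => w _ do rewrite ffunE.
  by apply => w _; rewrite ?(abs1 av).
by apply: (abs_prod_le av).
Qed.

End Bounds.

(** * Maximally independent graphs *)

Section MaximallyIndependent.
Variables (k : nat) (G : marked_graph k).

Definition zero_marks (x : cube k) : {set vertex G} := mark G @: [set j | ~~ x j].

Lemma independentS (S T : {set vertex G}) :
  S \subset T -> independent T -> independent S.
Proof.
move=> ST /forallP iT; apply/forallP => a.
by apply: contra (iT a) => aS; exact: subset_trans ST.
Qed.

Lemma mark_zero_marks x j : (mark G j \in zero_marks x) = ~~ x j.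
Proof. by rewrite mem_imset ?inE //; exact: mark_inj. Qed.

(** Deleting marked vertices from the largest independent set that contains
    them all is optimal for each pattern, because the numbers at the two
    extreme patterns leave no room. *)
Lemma maximal_cardE (I : cube k -> {set vertex G}) :
  (forall x S, maximal_agreeing x S <-> S = I x) ->
  #|I [ffun=> true]| = (#|I [ffun=> false]| + k)%N ->
  forall x, #|I x| = (#|I [ffun=> false]| + \sum_j x j)%N.
Proof.
move=> IP Itop x.
have maxI y : maximal_agreeing y (I y) by apply/IP.
apply/eqP; rewrite eqn_leq; apply/andP; split.
  pose T := I x :\: zero_marks [ffun=> false].
  have [ix /forallP ax _] := maxI x; have [_ _ mx0] := maxI [ffun=> false].
  have iT : independent T by apply: independentS ix; exact: subsetDl.
  have aT : agrees [ffun=> false] T.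
    by apply/forallP => j; rewrite inE mark_zero_marks !ffunE.
  rewrite -(cardsID (zero_marks [ffun=> false]) (I x)) addnC leq_add ?mx0 //.
  have -> : I x :&: zero_marks [ffun=> false] = mark G @: [set j | x j].
    apply/setP => v; rewrite inE; apply/andP/imsetP.
      by case=> vI /imsetP[j _ vj]; exists j => //; rewrite inE -(eqP (ax j)) -vj.
    case=> j; rewrite inE => xj ->; rewrite (eqP (ax j)); split=> //.
    by rewrite mark_zero_marks ffunE.
  rewrite card_imset; last exact: mark_inj.
  rewrite -sum1_card big_mkcond /=; apply: leq_sum => j _.
  by rewrite inE; case: (x j).
pose T := I [ffun=> true] :\: zero_marks x.
have [i1 /forallP a1 _] := maxI [ffun=> true]; have [_ _ mx] := maxI x.
have iT : independent T by apply: independentS i1; exact: subsetDl.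
have aT : agrees x T.
  by apply/forallP => j; rewrite inE mark_zero_marks negbK (eqP (a1 j)) ffunE andbT.
rewrite (leq_trans _ (mx T iT aT)) // cardsD Itop.
have -> : I [ffun=> true] :&: zero_marks x = zero_marks x.
  apply/setIidPr/subsetP => v /imsetP[j _ ->]; by rewrite (eqP (a1 j)) ffunE.
rewrite card_imset; last exact: mark_inj.
have ksum : (\sum_j x j + #|[set j | ~~ x j]| = k)%N.
  rewrite -sum1_card [X in (_ + X)%N]big_mkcond -big_split /=.
  rewrite -[RHS]card_ord -sum1_card; apply: eq_bigr => j _.
  by rewrite inE; case: (x j).
by rewrite -[X in (_ <= _ + X - _)%N]ksum addnA addnK.
Qed.

End MaximallyIndependent.

Section Base.
Variables (R : realFieldType) (K : numFieldType) (N : K -> R).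
Hypothesis av : absolute_value N.
Variables (k : nat) (G : marked_graph k).

Definition initial_factor (lam : K) : 'I_k -> bool -> K :=
  fun _ b => if b then lam else 1.

Lemma tensor_initial lam (x : cube k) :
  tensor (initial_factor lam) x = lam ^+ \sum_j x j.
Proof.
rewrite ffunE (big_morph _ (@exprD _ lam) (expr0 lam)).
by apply: eq_bigr => j _; rewrite /initial_factor; case: (x j).
Qed.

(** By [maximal_cardE] the leading monomials of the independence sums are a
    common power times those of the tensor with factors 1 and [lam]; uniqueness
    of the largest sets makes all leading coefficients 1. *)
Lemma maximally_independent_near (d : R) : maximally_independent G -> 0 < d ->
  for_large N (fun lam => exists c (v : {ffun cube k -> K}),
    [/\ c != 0,
        [ffun x => indep_poly_at G lam x] =
          [ffun x => c * (tensor (initial_factor lam) x * v x)] &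
        forall x, N (v x - 1) <= d]).
Proof.
move=> [I [IP Itop]] d0; have Icard := maximal_cardE IP Itop.
pose m : R := #|{set vertex G}|%:R.
exists (Num.max 1 (m / d)) => lam; rewrite ge_max => /andP[lam1 lamd].
have Nlam0 : 0 < N lam by rewrite (lt_le_trans ltr01).
have lam0 : lam != 0 by rewrite (abs_neq0 av).
pose a := #|I [ffun=> false]|.
exists (lam ^+ a), [ffun x : cube k =>
  indep_poly_at G lam x / (lam ^+ a * lam ^+ \sum_j x j)].
split; first by rewrite expf_neq0.
  apply/ffunP => x; rewrite ffunE [RHS]ffunE tensor_initial.
  rewrite [X in _ = _ * (_ * X)]ffunE mulrA [RHS]mulrC divfK //.
  by rewrite mulf_neq0 ?expf_neq0.
move=> x; rewrite ffunE -exprD -/a.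
have [iI aI mI] : maximal_agreeing x (I x) by apply/IP.
rewrite /a -Icard /indep_poly_at (bigD1 (I x)) /=; last by rewrite iI aI.
rewrite mulrDl divff ?expf_neq0 // addrAC subrr add0r mulr_suml.
have -> : d = m * (d / m).
  rewrite mulrC divfK // pnatr_eq0 -lt0n; apply/card_gt0P; by exists (I x).
have m0 : 0 < m by rewrite ltr0n; apply/card_gt0P; exists (I x).
apply: (abs_sum_le av) => [|S /andP[/andP[iS aS] SI]].
  by rewrite divr_ge0 // ltW.
have ltS : (#|S| < #|I x|)%N.
  rewrite ltn_neqAle mI // andbT; apply: contra SI => /eqP eqS.
  apply/eqP/IP; split=> // T iT aT; rewrite eqS; exact: mI.
rewrite (absM av) (absV av) ?expf_neq0 // !(absX av).
rewrite ler_pdivrMr ?exprn_gt0 // -[#|I x|](subnK ltS) addnC exprS.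
rewrite mulrA -[X in X <= _]mul1r; apply: ler_pM => //.
- by rewrite exprn_ge0 // ltW.
- rewrite mulrAC ler_pdivlMr // mul1r mulrC -ler_pdivrMr //.
by rewrite exprD ler_peMr ?exprn_ege1 // exprn_ge0 // ltW.
Qed.

End Base.

(** * Zeros of the independence polynomials *)

Lemma indep_poly_patterns (A : comPzRingType) (k : nat) (G : marked_graph k) (lam : A) :
  indep_poly G lam = \sum_(x : cube k) indep_poly_at G lam x.
Proof.
rewrite /indep_poly (partition_big
  (fun S : {set vertex G} => [ffun j => mark G j \in S] : cube k) predT) //=.
apply: eq_bigr => x _; apply: eq_bigl => S; congr (_ && _).
apply/eqP/forallP => [<- j|Sx]; first by rewrite ffunE.
by apply/ffunP => j; rewrite ffunE; exact/eqP/Sx.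
Qed.

(** The sum is [d * \sum_i t i] up to an error that is smaller in absolute
    value. *)
Lemma sum_near_neq0 (R : realFieldType) (K : fieldType) (N : K -> R)
    (av : absolute_value N) (I : finType) (t v : I -> K) (C kappa : R) (d : K) :
  d != 0 -> \sum_i t i != 0 -> 0 <= C -> 0 <= kappa -> #|I|%:R * (C * kappa) < 1 ->
  (forall i, N (t i) <= C * N (\sum_j t j)) ->
  (forall i, N (v i - d) <= kappa * N d) ->
  \sum_i t i * v i != 0.
Proof.
move=> d0 t0 C0 kap0 Ck tC vd.
have dt0 : 0 < N d * N (\sum_i t i) by rewrite mulr_gt0 // (abs_gt0 av).
have -> : \sum_i t i * v i = d * (\sum_i t i) + \sum_i t i * (v i - d).
  rewrite mulr_sumr -big_split /=; apply: eq_bigr => i _; ring.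
have C_ge0 : 0 <= C * N (\sum_i t i) by rewrite mulr_ge0 // (abs_ge0 av).
have : N (\sum_i t i * (v i - d)) <= #|I|%:R * (C * N (\sum_i t i) * (kappa * N d)).
  apply: (abs_sum_le av) => [|i _]; first by rewrite !mulr_ge0 // (abs_ge0 av).
  by rewrite (absM av); apply: ler_pM; rewrite ?(abs_ge0 av).
have -> : #|I|%:R * (C * N (\sum_i t i) * (kappa * N d)) =
    #|I|%:R * (C * kappa) * (N d * N (\sum_i t i)) by ring.
move=> small; apply: (abs_neq0 av); apply: lt_le_trans (abs_ge_sub av _ _).
rewrite (absM av) subr_gt0 (le_lt_trans small) //.
by rewrite -[X in _ < X]mul1r ltr_pM2r.
Qed.

Section Zeros.
Variables (R : realFieldType) (K : numFieldType) (N : K -> R).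
Hypothesis av : absolute_value N.
Variables (k : nat) (r : reduced_data k) (c : connecting_data r).
Local Notation W := (@indep_weight K k r c).

(** The factors of the tensors obtained from the initial one by the recursion,
    without the constants. *)
Fixpoint reference (lam : K) (i : nat) : 'I_k -> bool -> K :=
  if i is i'.+1 then root_factor (W lam) (fun=> reference lam i')
  else initial_factor lam.

Lemma indep_weight_laurent e S b : positive_laurent (fun lam : K => W lam e S b).
Proof.
apply: positive_laurentM; last exact: positive_laurentVX.
by apply: positive_laurent_sum => T _; exact: positive_laurentX.
Qed.

Lemma edge_term_laurent (a : K -> 'I_k -> bool -> K) e S b :
  (forall j b, positive_laurent (fun lam : K => a lam j b)) ->
  positive_laurent (fun lam : K => edge_term (W lam) (a lam) e S b).
Proof.
move=> al; apply: positive_laurentM; last exact: indep_weight_laurent.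
exact: positive_laurent_prod.
Qed.

Lemma edge_value_laurent (a : K -> 'I_k -> bool -> K) e b :
  (forall j b, positive_laurent (fun lam : K => a lam j b)) ->
  positive_laurent (fun lam : K => edge_value (W lam) (a lam) e b).
Proof.
move=> al; apply: (@positive_laurent_ext K
  (fun lam => \sum_(S : {set hvertex r} | S \subset hset e) edge_term (W lam) (a lam) e S b)).
  by move=> lam _; rewrite edge_valueE.
by apply: positive_laurent_sum => S _; exact: edge_term_laurent.
Qed.

Lemma reference_laurent i j b : positive_laurent (fun lam : K => reference lam i j b).
Proof.
elim: i j b => [|i IHi] j b /=; last first.
  exact: (@edge_value_laurent (fun lam => reference lam i) (phi r j) b).
case: b; first by exact: (positive_laurentX K 1).
exact: positive_laurent_cst ler01.
Qed.

(** The empty set and the root alone are independent, so no edge sum is empty. At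
    [lam = 1] all terms are nonnegative, and this value decides whether the
    function vanishes identically. *)
Lemma edge_value_gt0 (a : 'I_k -> bool -> K) e b :
  (forall j b, 0 < a j b) -> 0 < edge_value (W 1) a e b.
Proof.
move=> a0; pose T : {set vertex (cgraph c e)} :=
  if b then [set croot c e] else set0.
pose S : {set hvertex r} :=
  [set val w | w in [set w : {w | w \in hset e} | attach c w \in T]].
have Se : S \subset hset e.
  by apply/subsetP => w /imsetP[u _ ->]; exact: valP.
have WS : 0 < W 1 e S b.
  rewrite /indep_weight expr1n divr1 (bigD1 T) /=.
    rewrite expr1n ltr_pwDl ?ltr01 // sumr_ge0 // => T' _.
    by rewrite expr1n ler01.
  apply/and3P; split.
  - apply/forallP => a'; apply/negP => /subset_leq_card.
    by rewrite card_ends /T; case: b @T S Se => /=; rewrite ?cards1 ?cards0.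
  - apply/forallP => w; rewrite [X in _ == X]mem_imset ?inE //; exact: val_inj.
  - apply/implyP => _; rewrite /T; case: b @T S Se => /= *; rewrite ?set11 ?inE //.
rewrite edge_valueE (bigD1 S) //= ltr_pwDl //.
  by rewrite /edge_term (setIidPr Se) mulr_gt0 // prodr_gt0.
apply: sumr_ge0 => S' _; rewrite /edge_term mulr_ge0 //.
  by apply: prodr_ge0 => w _; rewrite ltW.
have := positive_laurent_ge0 (indep_weight_laurent e (hset e :&: S') b).
by [].
Qed.

Lemma reference_gt0 i j b : 0 < reference 1 i j b.
Proof.
elim: i j b => [|i IHi] j b /=; first by case: b; exact: ltr01.
exact: (@edge_value_gt0 (reference 1 i) (phi r j) b).
Qed.

Definition nonvanishing i lam :=
  forall e b, edge_value (W lam) (reference lam i) e b != 0.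

Lemma for_large_nonvanishing i : for_large N (nonvanishing i).
Proof.
have := @for_large_all R K N _ (fun p : hedge r * bool => fun lam =>
  edge_value (W lam) (reference lam i) p.1 p.2 != 0).
case=> [[e b]|L H] /=.
  apply: (positive_laurent_neq0 av).
    by apply: edge_value_laurent => j b'; exact: reference_laurent.
  by rewrite gt_eqF // edge_value_gt0 // => j b'; exact: reference_gt0.
by exists L => lam /H Hlam e b; exact: (Hlam (e, b)).
Qed.

Local Notation kernel lam i := (normalized_weight (W lam) (reference lam i)).

(** An edge term is one of the summands of the edge value, and these do not
    cancel. *)
Lemma kernel_bounded i : exists2 C : R, 1 <= C &
  for_large N (fun lam => forall e S b, N (kernel lam i e S b) <= C).
Proof.
have [p|C C1 H] := @bounded_family R K N av
  (hedge r * {set hvertex r} * bool)%type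
  (fun p lam => edge_term (W lam) (reference lam i) p.1.1 (hset p.1.1 :&: p.1.2) p.2)
  (fun p lam => edge_value (W lam) (reference lam i) p.1.1 p.2).
  have [C H] := @positive_laurent_dominate_sum R K N av _
    (fun S : {set hvertex r} => S \subset hset p.1.1)
    (fun S lam => edge_term (W lam) (reference lam i) p.1.1 S p.2)
    (hset p.1.1 :&: p.1.2)
    (fun S => edge_term_laurent p.1.1 S p.2 (reference_laurent i)) (subsetIl _ _).
  by exists C; apply: for_large_mono H => lam; rewrite edge_valueE.
exists C => //; apply: for_large_mono (for_large_and (for_large_nonvanishing i) H).
move=> lam [reg bd] e S b; have := bd (e, S, b) => /=.
have -> : edge_term (W lam) (reference lam i) e (hset e :&: S) b =
    edge_term (W lam) (reference lam i) e S b.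
  rewrite /edge_term setIA setIid; congr (_ * _).
  by apply: eq_bigr => w we; rewrite inE we.
rewrite /normalized_weight (absM av) (absV av) ?reg //.
by rewrite ler_pdivrMr // (abs_gt0 av) ?reg.
Qed.

(** The factor at [j] after [i] steps has been read off along the labels that the
    label map visits from [j]; once these are periodic, it is passed on
    unchanged. *)
Lemma reference_stationary lam i : lam != 0 -> stable c ->
  (forall j, periodic_label r (iter i (label_map r) j)) ->
  forall j b, reference lam i.+1 j b = reference lam i j b.
Proof.
move=> lam0 stab per j b; have {per} := per j.
elim: i j b => [|i IHi] j b; last first.
  rewrite iterSr => per; rewrite [LHS]/= [RHS]/=.
  by apply: edge_sum_eq => w _ b'; exact: IHi.
move=> pj; have [w _ /= H] := edge_sum_identity (stable_identity_edge lam0 stab pj).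
by rewrite /root_factor H.
Qed.

Lemma unrooted_neq0 lam i : nonvanishing i lam ->
  unrooted_factor (W lam) (fun=> reference lam i) != 0.
Proof. by move=> reg; apply/prodf_neq0 => e _; exact: reg. Qed.

Lemma kernel_step lam i a (v : {ffun cube k -> K}) : nonvanishing i lam -> a != 0 ->
  exists2 a', a' != 0 &
  weighted_map (W lam) [ffun x => a * (tensor (reference lam i) x * v x)] =
  [ffun x => a' * (tensor (reference lam i.+1) x * weighted_map (kernel lam i) v x)].
Proof.
move=> reg a0.
exists (a ^+ #|hvertex r| * unrooted_factor (W lam) (fun=> reference lam i)).
  by rewrite mulf_neq0 ?expf_neq0 ?unrooted_neq0.
have -> : [ffun x => a * (tensor (reference lam i) x * v x)] =
    [ffun x => a * [ffun x => tensor (reference lam i) x * v x] x].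
  by apply/ffunP => x; rewrite !ffunE.
rewrite weighted_map_scale normalized_weightE //.
by apply/ffunP => x; rewrite [LHS]ffunE [RHS]ffunE [X in _ * X = _]ffunE -[RHS]mulrA.
Qed.

Variable G0 : marked_graph k.
Hypothesis G0max : maximally_independent G0.

Definition pattern_vector lam i : {ffun cube k -> K} :=
  [ffun x => indep_poly_at (iter i (recursion c) G0) lam x].

Lemma pattern_vectorS lam i : lam != 0 ->
  pattern_vector lam i.+1 = weighted_map (W lam) (pattern_vector lam i).
Proof. by move=> lam0; rewrite -F_weighted F_recursion. Qed.

(** Bounded kernels that fix the constant vector 1 are continuous there,
    uniformly in the parameter; how large the parameter has to be depends
    on [i]. *)
Lemma pattern_vector_near i (d : R) : 0 < d ->
  for_large N (fun lam => exists a (v : {ffun cube k -> K}),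
    [/\ a != 0,
        pattern_vector lam i = [ffun x => a * (tensor (reference lam i) x * v x)] &
        forall x, N (v x - 1) <= d]).
Proof.
elim: i d => [|i IHi] d d0; first exact: maximally_independent_near.
have [C C1 HC] := kernel_bounded i.
pose B : R := #|{ffun hvertex r -> cube k}|%:R * (2 ^+ #|hvertex r| * C ^+ #|hedge r|) + 1.
have B0 : 0 < B.
  rewrite ltr_wpDl // !mulr_ge0 ?exprn_ge0 ?ler0n //.
  exact: le_trans C1.
pose d' := Num.min 1 (d / B).
have d'0 : 0 < d' by rewrite lt_min ltr01 divr_gt0.
have d'01 : 0 <= d' <= 1 by rewrite ltW //= ge_min lexx.
apply: for_large_mono (for_large_and (for_large_and (for_large_neq0 av)
  (for_large_nonvanishing i)) (for_large_and HC (IHi d' d'0))).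
move=> lam [[lam0 reg] [bd [a [v [a0 vE vd]]]]].
have [a' a'0 stepE] := kernel_step v reg a0.
exists a', (weighted_map (kernel lam i) v); split => //.
  by rewrite pattern_vectorS // vE.
move=> x; have := weighted_map_near_one av C1 d'01 bd (normalized_weight1 reg) vd x.
move/le_trans; apply.
apply: (@le_trans _ _ (B * d')); first by apply: ler_wpM2r; [exact: ltW|rewrite lerDl ler01].
by rewrite mulrC -ler_pdivlMr // ge_min lexx orbT.
Qed.

Lemma reference_dominate n : exists2 C : R, 1 <= C &
  for_large N (fun lam => forall i : 'I_n,
    \sum_y tensor (reference lam i) y != 0 /\ forall x,
    N (tensor (reference lam i) x) <= C * N (\sum_y tensor (reference lam i) y)).
Proof.
have tl i x : positive_laurent (fun lam : K => tensor (reference lam i) x).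
  apply: (@positive_laurent_ext K (fun lam => \prod_j reference lam i j (x j))).
    by move=> lam _; rewrite ffunE.
  by apply: positive_laurent_prod => j _; exact: reference_laurent.
have [[i x]|C C1 H] := @bounded_family R K N av ('I_n * cube k)%type
  (fun p lam => tensor (reference lam p.1) p.2)
  (fun p lam => \sum_y tensor (reference lam p.1) y).
  exact: (@positive_laurent_dominate_sum R K N av _ predT
    (fun y lam => tensor (reference lam i) y)).
exists C => //.
have nz : for_large N (fun lam => forall i : 'I_n, \sum_y tensor (reference lam i) y != 0).
  apply: for_large_all => i; apply: (positive_laurent_neq0 av).
    exact: positive_laurent_sum.
  rewrite gt_eqF // (bigD1 (cube0 k)) //= ltr_pwDl //.
    by rewrite ffunE prodr_gt0 // => j _; exact: reference_gt0.
  apply: sumr_ge0 => y _; rewrite ffunE prodr_ge0 // => j _.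
  by rewrite ltW ?reference_gt0.
apply: for_large_mono (for_large_and nz H) => lam [h1 h2] i.
by split=> // x; exact: (h2 (i, x)).
Qed.

Hypothesis k0 : (0 < k)%N.
Hypothesis stab : stable c.
Hypothesis expd : expanding r.

(** From the time at which the reference tensor is stationary, the normalized
    vectors follow one fixed map. *)
Lemma pattern_vector_follow lam s i a (v : {ffun cube k -> K}) :
  lam != 0 -> nonvanishing s lam ->
  (forall j b, reference lam s.+1 j b = reference lam s j b) ->
  a != 0 ->
  pattern_vector lam i = [ffun x => a * (tensor (reference lam s) x * v x)] ->
  forall t, exists2 a', a' != 0 & pattern_vector lam (t + i) =
    [ffun x => a' * (tensor (reference lam s) x *
      iter t (weighted_map (kernel lam s)) v x)].
Proof.
move=> lam0 reg stat a0 vE; elim=> [|t [b b0 IHt]]; first by exists a.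
have [b' b'0 H] := kernel_step (iter t (weighted_map (kernel lam s)) v) reg b0.
exists b' => //; rewrite addSn pattern_vectorS // IHt H.
apply/ffunP => x; rewrite [LHS]ffunE [RHS]ffunE; congr (_ * (_ * _)).
by rewrite !ffunE; apply: eq_bigr => j _; exact: stat.
Qed.

(** Finitely many early steps are controlled one by one. A later step differs by
    a multiple of [s] from one of the steps [s], ..., [2 * s - 1], and there
    [local_dynamics] applies to the [s]-th iterate of the stationary kernel. *)
Theorem independence_zeros_bounded :
  for_large N (fun lam => forall i, indep_poly (iter i (recursion c) G0) lam != 0).
Proof.
have [n [sep idem]] := expanding_idempotent_iterate expd.
set q := iter n (compose_data r) r in sep idem.
pose s := n.+1.
have per i j : (s <= i)%N -> periodic_label r (iter i (label_map r) j).
  move=> /subnK <-; rewrite iterD; elim: (i - s)%N => [|d IHd]; last first.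
    by rewrite iterS; exact: periodic_label_map.
  change (periodic_label r (iter n.+1 (label_map r) j)).
  rewrite -label_map_iterate.
  exact: (@fixed_label_periodic _ r n _ (idem j)).
have [C C1 HC] := kernel_bounded s.
have [C' C'1 HC'] := @iterate_weight_bounded R K N av k r n C C1.
have [own ownP] := separated_owner k0 sep.
have [A A1 HA] := reference_dominate (2 * s).
have A0 : 0 < A by exact: lt_le_trans A1.
pose T : R := #|{: cube k}|%:R.
have T0 : 0 < T by rewrite ltr0n; apply/card_gt0P; exists (cube0 k).
pose kappa := (2 * T * A)^-1.
have TA0 : 0 < 2 * T * A by rewrite !mulr_gt0.
have kappa0 : 0 < kappa by rewrite invr_gt0.
have Tk : T * (A * kappa) < 1.
  rewrite mulrA /kappa ltr_pdivrMr // mul1r -mulrA ltr_pMl ?mulr_gt0 // ltr1n //.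
have [e0 e00 He] := local_dynamics av ownP idem C'1 kappa0.
pose d := Num.min e0 kappa.
have d0 : 0 < d by rewrite lt_min e00.
have near := @for_large_lt R K N _ (2 * s) (fun i => pattern_vector_near i d0).
apply: for_large_mono (for_large_and
  (for_large_and (for_large_neq0 av) (for_large_nonvanishing s))
  (for_large_and (for_large_and HC HA) near)).
move=> lam [[lam0 reg] [[bd dom] nr]] i.
have stat i' : (s <= i')%N -> forall j b, reference lam i' j b = reference lam s j b.
  move=> /subnK <-; elim: (i' - s)%N => [//|e IHe] j b.
  by rewrite addSn reference_stationary // => j'; apply: per; rewrite leq_addl.
have finish (i' : 'I_(2 * s)) a b (v : {ffun cube k -> K}) : a != 0 -> b != 0 ->
    pattern_vector lam i = [ffun x => a * (tensor (reference lam i') x * v x)] ->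
    (forall x, N (v x - b) <= kappa * N b) ->
    indep_poly (iter i (recursion c) G0) lam != 0.
  move=> a0 b0 vE vb; have [sum0 domi] := dom i'.
  rewrite indep_poly_patterns.
  have -> : \sum_(x : cube k) indep_poly_at (iter i (recursion c) G0) lam x =
      a * \sum_(x : cube k) tensor (reference lam i') x * v x.
    rewrite mulr_sumr; apply: eq_bigr => x _.
    by have /ffunP/(_ x) := vE; rewrite !ffunE.
  rewrite mulf_neq0 //.
  exact: (sum_near_neq0 av b0 sum0 (ltW A0) (ltW kappa0) Tk domi vb).
case: (ltnP i s) => si.
  have i2s : (i < 2 * s)%N by rewrite (leq_trans si) // leq_pmull.
  have [a [v [a0 vE vd]]] := nr i i2s.
  apply: (finish (Ordinal i2s) a 1 v) => //; first exact: oner_neq0.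
  by move=> x; rewrite (abs1 av) mulr1 (le_trans (vd x)) // ge_min lexx orbT.
pose t := ((i - s) %/ s)%N; pose i0 := (s + (i - s) %% s)%N.
have iE : i = (t * s + i0)%N.
  by rewrite /i0 addnCA -divn_eq subnKC.
have i0s : (i0 < 2 * s)%N by rewrite mul2n -addnn ltn_add2l ltn_mod.
have [a [v [a0 vE vd]]] := nr i0 i0s.
have vE' : pattern_vector lam i0 = [ffun x => a * (tensor (reference lam s) x * v x)].
  rewrite vE; apply/ffunP => x; rewrite !ffunE; congr (_ * (_ * _)).
  by apply: eq_bigr => j _; rewrite stat // leq_addr.
have [a' a'0 fol] := pattern_vector_follow lam0 reg (stat _ (leqnSn s)) a0 vE' (t * s).
pose U := @iterate_weight K k r (kernel lam s) n.
have iterU v' : iter t (weighted_map U) v' = iter (t * s) (weighted_map (kernel lam s)) v'.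
  elim: {+}t v' => [//|t' IHt] v'.
  by rewrite mulSn iterD -IHt /= {1}/U iterate_weightE.
have U1 : weighted_map U [ffun=> 1] = [ffun=> 1].
  rewrite iterate_weightE; elim: n.+1 => [//|n' IHn] /=.
  by rewrite IHn normalized_weight1.
have Uid j : label_map q j = j -> identity_edge U (phi q j).
  move=> /fixed_label_periodic pj; apply: identity_edge_iterate => // l pl.
  by apply: normalized_identity => //; exact: stable_identity_edge.
have vd' x : N (v x - 1) <= e0.
  by rewrite (le_trans (vd x)) // ge_min lexx.
have [b b0 vb] := He U (HC' _ bd) Uid U1 v vd' t.
have s2s : (s < 2 * s)%N by rewrite mul2n -addnn -addn1 leq_add2l.
apply: (finish (Ordinal s2s) a' b (iter t (weighted_map U) v)) => //.
by rewrite iE fol iterU.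
Qed.

End Zeros.

From mathcomp Require Import boolp classical_sets functions reals topology.
From mathcomp Require Import normedtype landau derive.
From mathcomp Require Import complex.

Import numFieldNormedType.Exports.

Local Open Scope classical_set_scope.
Local Open Scope ring_scope.

(** * Idempotent matrices and calculus *)

Lemma sub_idempotentP (K : fieldType) (n : nat) (J : 'M[K]_n) (v : 'rV[K]_n) :
  J *m J = J -> (v <= J)%MS <-> v *m J = v.
Proof.
move=> JJ; split=> [/submxP[u ->]|<-]; last exact: submxMl.
by rewrite -mulmxA JJ.
Qed.

(** Up to sign, all positive powers of [L - 1] are equal, so the generalized
    eigenspace is the eigenspace, which is the image of [L]. *)
Lemma geigenspace_idempotent (K : fieldType) m (L : 'M[K]_m.+1) : L *m L = L ->
  (geigenspace L 1 :=: L)%MS.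
Proof.
move=> LL; rewrite geigenspaceE; apply/eqmxP/rV_eqP => v.
have pow i : (L - 1%:M) ^+ i.+1 = (-1) ^+ i *: (L - 1%:M).
  elim: i => [|i IHi]; first by rewrite expr1 expr0 scale1r.
  rewrite exprS IHi exprS -mulmxE -scalemxAr mulmxBl mul1mx mulmxBr LL mulmx1 subrr.
  by rewrite sub0r scalerN mulN1r scaleNr.
rewrite pow; apply/idP/idP.
  move/sub_kermxP; rewrite -scalemxAr => /eqP.
  rewrite scaler_eq0 signr_eq0 /= mulmxBr mulmx1 subr_eq0 => /eqP <-.
  exact: submxMl.
move=> /(sub_idempotentP _ LL) vL; apply/sub_kermxP.
by rewrite -scalemxAr mulmxBr mulmx1 vL subrr scaler0.
Qed.

Lemma eigenvalue_idempotent (K : fieldType) n (J : 'M[K]_n) : J *m J = J ->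
  (0 < \rank J < n)%N -> forall a, eigenvalue J a <-> a = 0 \/ a = 1.
Proof.
move=> JJ /andP[r0 rn] a; split.
  case/eigenvalueP => v vJ v0.
  have : (a * a) *: v = a *: v by rewrite -scalerA -vJ scalemxAl -vJ -mulmxA JJ.
  move/eqP; rewrite -subr_eq0 -scalerBl scaler_eq0 (negbTE v0) orbF.
  rewrite -[X in _ - X]mulr1 -mulrBr mulf_eq0 subr_eq0.
  by case/orP => /eqP; [left|right].
case=> ->; apply/eigenvalueP.
  have K0 : kermx J != 0 by rewrite -mxrank_eq0 mxrank_ker subn_eq0 -ltnNge.
  exists (nz_row (kermx J)); rewrite ?nz_row_eq0 // scale0r.
  by apply/sub_kermxP; exact: nz_row_sub.
have J0 : J != 0 by rewrite -mxrank_eq0 -lt0n.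
exists (nz_row J); rewrite ?nz_row_eq0 // scale1r.
by apply/(sub_idempotentP _ JJ); exact: nz_row_sub.
Qed.

Section Calculus.
Variable K : numFieldType.

Lemma differentiable_bigsum (V W : normedModType K) (I : Type) (s : seq I)
    (P : pred I) (f : I -> V -> W) (p : V) :
  (forall i, P i -> differentiable (f i) p) ->
  differentiable (fun y => \sum_(i <- s | P i) f i y) p.
Proof.
move=> df; elim: s => [|i s IHs].
  rewrite (_ : (fun _ => _) = cst 0); first exact: differentiable_cst.
  by apply/funext => y; rewrite big_nil.
case Pi : (P i); last first.
  by rewrite (_ : (fun _ => _) = (fun y => \sum_(i <- s | P i) f i y)) //;
    apply/funext => y; rewrite big_cons Pi.
rewrite (_ : (fun _ => _) = f i + (fun y => \sum_(i <- s | P i) f i y)).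
  by apply: differentiableD => //; exact: df.
by apply/funext => y; rewrite big_cons Pi.
Qed.

Lemma differentiable_bigprod (V : normedModType K) (I : Type) (s : seq I)
    (P : pred I) (f : I -> V -> K) (p : V) :
  (forall i, P i -> differentiable (f i) p) ->
  differentiable (fun y => \prod_(i <- s | P i) f i y) p.
Proof.
move=> df; elim: s => [|i s IHs].
  rewrite (_ : (fun _ => _) = cst 1); first exact: differentiable_cst.
  by apply/funext => y; rewrite big_nil.
case Pi : (P i); last first.
  by rewrite (_ : (fun _ => _) = (fun y => \prod_(i <- s | P i) f i y)) //;
    apply/funext => y; rewrite big_cons Pi.
rewrite (_ : (fun _ => _) = f i * (fun y => \prod_(i <- s | P i) f i y)).
  by apply: differentiableM => //; exact: df.
by apply/funext => y; rewrite big_cons Pi.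
Qed.

Lemma is_derive_bigsum (V W : normedModType K) (I : finType)
    (f : I -> V -> W) (df : I -> W) (p v : V) :
  (forall i, is_derive p v (f i) (df i)) ->
  is_derive p v (fun y => \sum_i f i y) (\sum_i df i).
Proof.
move=> fd; elim: (index_enum I) => [|i s IHs].
  rewrite big_nil (_ : (fun _ => _) = cst 0); first exact: is_derive_cst.
  by apply/funext => y; rewrite big_nil.
rewrite big_cons (_ : (fun _ => _) = f i + (fun y => \sum_(i <- s) f i y)).
  exact: is_deriveD.
by apply/funext => y; rewrite big_cons.
Qed.

Lemma is_derive_bigprod (V : normedModType K) (I : finType)
    (f : I -> V -> K) (df : I -> K) (p v : V) :
  (forall i, is_derive p v (f i) (df i)) ->
  is_derive p v (fun y => \prod_i f i y)
    (\sum_i df i * \prod_(j | j != i) f j p).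
Proof.
move=> fd.
suff H (s : seq I) : uniq s -> is_derive p v (fun y => \prod_(i <- s) f i y)
    (\sum_(i <- s) df i * \prod_(j <- s | j != i) f j p).
  have := H _ (index_enum_uniq I); exact.
elim: s => [_|i s IHs /= /andP[nis us]].
  rewrite big_nil (_ : (fun _ => _) = cst 1); first exact: is_derive_cst.
  by apply/funext => y; rewrite big_nil.
rewrite (_ : (fun _ => _) = f i * (fun y => \prod_(i <- s) f i y)); last first.
  by apply/funext => y; rewrite big_cons.
apply: is_derive_eq; first by apply: is_deriveM; exact: IHs.
rewrite big_cons big_cons eqxx /= addrC; congr (_ + _).
  rewrite /GRing.scale /= mulrC; congr (_ * _).
  rewrite [RHS]big_seq_cond [LHS]big_seq; apply: eq_bigl => j.
  by case js : (j \in s) => //=; apply/esym; apply: contraNneq nis => <-.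
rewrite /GRing.scale /= big_distrr /= big_seq [RHS]big_seq; apply: eq_bigr => j js.
rewrite big_cons; have -> : i != j by apply: contraNneq nis => ->.
by rewrite mulrCA.
Qed.

Lemma differentiable_rowP (V : normedModType K) n (f : V -> 'rV[K]_n) p :
  (forall i, differentiable (fun y => f y ord0 i) p) -> differentiable f p.
Proof.
move=> fd; rewrite (_ : f = fun y => \sum_i (f y ord0 i) *: delta_mx ord0 i).
  by apply: differentiable_bigsum => i _; exact: differentiableZl.
by apply/funext => y; exact: row_sum_delta.
Qed.

Lemma diff_row_coord (V : normedModType K) n (f : V -> 'rV[K]_n) p v i :
  differentiable f p ->
  ('d f p v) ord0 i = 'd (fun y => f y ord0 i) p v.
Proof.
move=> fd.
have @g : {linear 'rV[K]_n -> K}.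
  by exists (fun N : 'rV[K]_n => N ord0 i); do 2![eexists]; do ?[constructor];
     rewrite ?mxE// => ? *; rewrite ?mxE//; move=> ?; rewrite !mxE.
have gc : continuous g by exact: coord_continuous.
have gd : differentiable g (f p) by exact: linear_differentiable.
have /(congr1 (fun h : V -> K => h v)) := diff_comp fd gd.
by rewrite /= (diff_lin _ gc).
Qed.

Lemma deriveE_row (V : normedModType K) n (f : V -> 'rV[K]_n) p v (df : 'rV[K]_n) :
  differentiable f p ->
  (forall i, is_derive p v (fun y => f y ord0 i) (df ord0 i)) ->
  'd f p v = df.
Proof.
move=> fd fdi; apply/rowP => i; rewrite diff_row_coord //.
have di : differentiable (fun y => f y ord0 i) p.
  apply: (@differentiable_comp _ _ _ _ f (fun y : 'rV[K]_n => y ord0 i)) => //.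
  exact: differentiable_coord.
by rewrite -deriveE //; have := fdi i => -[_ ->].
Qed.

End Calculus.

(** * Graphs over some of the coordinates *)

(** The charts of a submanifold are to be cut out by the last coordinates. *)
Lemma perm_front N (S : {set 'I_N}) :
  exists s : 'S_N, forall i : 'I_N, (s i \in S) = (i < #|S|)%N.
Proof.
pose l := enum S ++ enum (~: S)%SET.
have sl : size l = N by rewrite size_cat -!cardE cardsC card_ord.
have ul : uniq l.
  rewrite cat_uniq !enum_uniq andbT /=; apply/hasPn => i.
  by rewrite !mem_enum inE.
have finj : injective (fun i : 'I_N => nth i l i).
  move=> i j; rewrite (set_nth_default i) ?sl // => /eqP.
  by rewrite nth_uniq ?sl // => /eqP/val_inj.
exists (perm finj) => i; rewrite permE nth_cat -cardE; case: ifP => iS.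
  by have := mem_nth i (_ : (i < size (enum S))%N); rewrite -cardE mem_enum; apply.
apply/negbTE; have : nth i (enum (~: S)%SET) (i - #|S|) \in enum (~: S)%SET.
  apply: mem_nth; rewrite -cardE ltn_subLR ?cardsC ?card_ord // leqNgt iS //.
by rewrite mem_enum inE.
Qed.

Section Shear.
Variables (K : numFieldType) (N : nat) (S : {set 'I_N}).
Variables (U M : set 'rV[K]_N) (Psi : 'rV[K]_N -> 'rV[K]_N).
Hypothesis openU : open U.
Hypothesis dPsi : forall p, U p -> differentiable Psi p.
Hypothesis locU : forall p q : 'rV[K]_N, (forall i, i \in S -> p ord0 i = q ord0 i) ->
  U p -> U q.
Hypothesis locPsi : forall p q : 'rV[K]_N, (forall i, i \in S -> p ord0 i = q ord0 i) ->
  U p -> Psi p = Psi q.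
Hypothesis secPsi : forall (p : 'rV[K]_N) i, U p -> i \in S -> Psi p ord0 i = p ord0 i.
Hypothesis MU : forall p, M p -> U p.
Hypothesis MPsi : forall p, U p -> (M p <-> p = Psi p).

(** A graph over the coordinates in S is flattened by subtracting, off S, the
    function whose graph it is; adding this function back is the inverse. *)
Lemma shear_submanifold : submanifold #|S| M.
Proof.
split; first by rewrite (leq_trans (max_card _)) ?card_ord.
have [s sS] := perm_front S.
pose f (q : 'rV[K]_N) : 'rV[K]_N := \row_i (q ord0 (s i) -
  (if s i \in S then 0 else Psi q ord0 (s i))).
pose un (y : 'rV[K]_N) : 'rV[K]_N := \row_i y ord0 ((s^-1)%g i).
pose g (y : 'rV[K]_N) : 'rV[K]_N := \row_i (un y ord0 i +
  (if i \in S then 0 else Psi (un y) ord0 i)).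
have unf q i : i \in S -> un (f q) ord0 i = q ord0 i.
  by move=> iS; rewrite !mxE permKV iS subr0.
have un_diff y : differentiable un y.
  apply: differentiable_rowP => i; rewrite (_ : (fun _ => _) =
    (fun y : 'rV[K]_N => y ord0 ((s^-1)%g i))); first exact: differentiable_coord.
  by apply/funext => z; rewrite mxE.
have gf q : U q -> g (f q) = q.
  move=> Uq; apply/rowP => i; rewrite [LHS]mxE.
  case: ifP => iS; first by rewrite unf // addr0.
  have <- : Psi q = Psi (un (f q)) by apply: locPsi Uq => j jS; rewrite unf.
  by rewrite !mxE permKV iS subrK.
have fg y : U (un y) -> f (g y) = y.
  move=> Uy; have guy i : i \in S -> un y ord0 i = g y ord0 i.
    by move=> iS; rewrite [RHS]mxE iS addr0.
  apply/rowP => i; rewrite [LHS]mxE -(locPsi guy Uy) [g _ _ _]mxE addrK.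
  by rewrite mxE permK.
have fU : f @` U = un @^-1` U.
  apply/seteqP; split=> [y [q Uq <-]|y Uy] /=.
    by apply: locU Uq => i iS; rewrite unf.
  exists (g y); last exact: fg.
  by apply: locU Uy => i iS; rewrite [RHS]mxE iS addr0.
move=> p Mp; exists U, f; split; first exact: MU.
  split=> //.
  - rewrite fU; apply: open_comp => // y _.
    exact: differentiable_continuous.
  - move=> q; rewrite inE => Uq; apply: differentiable_rowP => i.
    rewrite (_ : (fun _ => _) = (fun q : 'rV[K]_N => q ord0 (s i)) -
      (fun q => if s i \in S then 0 else Psi q ord0 (s i))); last first.
      by apply/funext => z; rewrite mxE.
    apply: differentiableB; first exact: differentiable_coord.
    case: (s i \in S); first exact: differentiable_cst.
    apply: (@differentiable_comp _ _ _ _ Psi (fun y : 'rV[K]_N => y ord0 (s i))).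
      exact: dPsi.
    exact: differentiable_coord.
  exists g; split=> [q|y]; rewrite inE; first exact: gf.
  rewrite fU /= => Uy; apply: differentiable_rowP => i.
  rewrite (_ : (fun _ => _) = (fun y => un y ord0 i) +
    (fun y => if i \in S then 0 else Psi (un y) ord0 i)); last first.
    by apply/funext => z; rewrite mxE.
  apply: differentiableD.
    apply: (@differentiable_comp _ _ _ _ un (fun y : 'rV[K]_N => y ord0 i)) => //.
    exact: differentiable_coord.
  case: (i \in S); first exact: differentiable_cst.
  apply: (@differentiable_comp _ _ _ _ (Psi \o un) (fun y : 'rV[K]_N => y ord0 i)).
    by apply: differentiable_comp => //; exact: dPsi.
  exact: differentiable_coord.
move=> q Uq; rewrite (MPsi Uq); split=> [qP i di|fq0].
  by rewrite mxE sS ltnNge di /= -qP subrr.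
apply/rowP => i; case: (boolP (i \in S)) => iS; first by rewrite secPsi.
have := fq0 ((s^-1)%g i); rewrite mxE permKV (negbTE iS) leqNgt -sS permKV iS.
by move=> /(_ isT)/eqP; rewrite subr_eq0 => /eqP.
Qed.

End Shear.

(** * Tensors in the affine chart *)

Section Chart.
Variables (K : numFieldType) (k : nat).
Implicit Types (xi : chart K k) (v : {ffun cube k -> K}) (t s : 'I_k -> K).

Lemma homogenize_val xi (u : nzcube k) :
  homogenize xi (val u) = xi ord0 (enum_rank u).
Proof. by rewrite ffunE valK. Qed.

Lemma homogenize0 xi : homogenize xi (cube0 k) = 1.
Proof. by rewrite ffunE insubF // eqxx. Qed.

Lemma cube_cases (P : cube k -> Prop) :
  P (cube0 k) -> (forall u : nzcube k, P (val u)) -> forall x, P x.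
Proof.
move=> P0 Pu x; have [-> //|x0] := eqVneq x (cube0 k).
exact: (Pu (exist _ x x0)).
Qed.

Lemma dehomogenizeK v : v (cube0 k) != 0 ->
  homogenize (dehomogenize v) = [ffun x => (v (cube0 k))^-1 * v x].
Proof.
move=> v0; apply/ffunP; apply: cube_cases => [|u].
  by rewrite homogenize0 ffunE mulVf.
by rewrite homogenize_val mxE enum_rankK ffunE mulrC.
Qed.

Lemma dehomogenize_scale (c : K) v : c != 0 ->
  dehomogenize [ffun x => c * v x] = dehomogenize v.
Proof. by move=> c0; apply/rowP => i; rewrite !mxE !ffunE -mulf_div divff // mul1r. Qed.

Definition binary t : 'I_k -> bool -> K := fun j b => if b then t j else 1.

Lemma tensor0 (b : 'I_k -> bool -> K) :
  tensor b (cube0 k) = \prod_j b j false.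
Proof. by rewrite ffunE; apply: eq_bigr => j _; rewrite ffunE. Qed.

Lemma tensor_binary0 t : tensor (binary t) (cube0 k) = 1.
Proof. by rewrite tensor0 big1. Qed.

(** The Segre embedding of [k] projective lines, in affine coordinates. *)
Definition segre t : chart K k := dehomogenize (tensor (binary t)).

Lemma homogenize_segre t : homogenize (segre t) = tensor (binary t).
Proof.
rewrite /segre dehomogenizeK tensor_binary0 ?oner_neq0 //.
by apply/ffunP => x; rewrite ffunE invr1 mul1r.
Qed.

Lemma dehomogenize_tensor (b : 'I_k -> bool -> K) :
  (forall j, b j false != 0) ->
  dehomogenize (tensor b) = segre (fun j => b j true / b j false).
Proof.
move=> b0; apply/rowP => i; rewrite [LHS]mxE [RHS]mxE tensor_binary0 divr1 tensor0.
rewrite [tensor b _]ffunE [RHS]ffunE -prodf_div; apply: eq_bigr => j _.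
by rewrite /binary; case: (val (enum_val i) j) => //; rewrite divff.
Qed.

Definition unit_cube (j : 'I_k) : cube k := [ffun i => i == j].

Lemma unit_cube_neq0 j : unit_cube j != cube0 k.
Proof. by apply/eqP => /ffunP/(_ j); rewrite !ffunE eqxx. Qed.

Definition unit_index (j : 'I_k) : 'I_#|{: nzcube k}| :=
  enum_rank (exist _ (unit_cube j) (unit_cube_neq0 j) : nzcube k).

Lemma unit_index_inj : injective unit_index.
Proof.
move=> i j /enum_rank_inj/(congr1 val)/= /ffunP/(_ i).
by rewrite !ffunE eqxx => /esym/eqP.
Qed.

Definition coordinates xi : 'I_k -> K := fun j => xi ord0 (unit_index j).

Lemma val_unit_index j : val (enum_val (unit_index j)) = unit_cube j.
Proof. by rewrite enum_rankK. Qed.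

Lemma tensor_unit_cube t j : tensor (binary t) (unit_cube j) = t j.
Proof.
rewrite ffunE (bigD1 j) //= ffunE eqxx big1 ?mulr1 // => i /negbTE ij.
by rewrite ffunE ij.
Qed.

Lemma coordinates_segre t j : coordinates (segre t) j = t j.
Proof.
by rewrite /coordinates mxE val_unit_index tensor_unit_cube tensor_binary0 divr1.
Qed.

Lemma segre_ext t s : t =1 s -> segre t = segre s.
Proof. by move=> ts; congr segre; apply/funext. Qed.

Definition segre_set : set (chart K k) := [set xi | exists t, xi = segre t].

Lemma segre_coordinates xi : segre_set xi -> xi = segre (coordinates xi).
Proof. by case=> t ->; apply: segre_ext => j; rewrite coordinates_segre. Qed.

Lemma segreE t i : segre t ord0 i = \prod_j binary t j (val (enum_val i) j).
Proof. by rewrite mxE tensor_binary0 divr1 ffunE. Qed.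

Lemma card_chart : #|{: nzcube k}| = (2 ^ k - 1)%N.
Proof.
have <- : #|{: cube k}| = (2 ^ k)%N by rewrite card_ffun card_bool card_ord.
by rewrite card_sig subn1 -(cardC1 (cube0 k)); apply: eq_card => x; rewrite !inE.
Qed.

Lemma differentiable_homogenize x xi : differentiable (fun y : chart K k => homogenize y x) xi.
Proof.
move: x; apply: cube_cases => [|u].
  rewrite (_ : (fun y : chart K k => homogenize y (cube0 k)) = cst 1); first exact: differentiable_cst.
  by apply/funext => y; rewrite homogenize0.
rewrite (_ : (fun y : chart K k => homogenize y (val u)) = (fun y => y ord0 (enum_rank u))).
  exact: differentiable_coord.
by apply/funext => y; rewrite homogenize_val.
Qed.

(** The linear part of the affine map [homogenize]. *)
Definition direction (h : chart K k) : {ffun cube k -> K} :=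
  [ffun x => if insub x is Some u then h ord0 (enum_rank (u : nzcube k)) else 0].

Lemma is_derive_homogenize x xi (h : chart K k) :
  is_derive xi h (fun y : chart K k => homogenize y x) (direction h x).
Proof.
have d := differentiable_homogenize x xi.
apply: DeriveDef; first exact: diff_derivable.
rewrite deriveE //; move: x d; apply: cube_cases => [|u] d.
  rewrite (_ : (fun y : chart K k => homogenize y (cube0 k)) = cst 1) ?diff_cst.
    by rewrite ffunE insubF ?eqxx.
  by apply/funext => y; rewrite homogenize0.
have E : (fun y : chart K k => homogenize y (val u)) = (fun y => (id y) ord0 (enum_rank u)).
  by apply/funext => y; rewrite homogenize_val.
have idd : differentiable (id : chart K k -> chart K k) xi by exact: ex_diff.
by rewrite E -diff_row_coord // diff_val ffunE valK.
Qed.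

Lemma differentiable_segre (V : normedModType K) (g : V -> 'I_k -> K) p :
  (forall j, differentiable (fun y => g y j) p) ->
  differentiable (fun y => segre (g y)) p.
Proof.
move=> gd; apply: differentiable_rowP => i.
rewrite (_ : (fun _ => _) = (fun y => \prod_j binary (g y) j (val (enum_val i) j))).
  apply: differentiable_bigprod => j _; rewrite /binary.
  by case: (val (enum_val i) j) => //; exact: differentiable_cst.
by apply/funext => y; rewrite segreE.
Qed.

(** The velocity of [segre] at [t] in the direction [s]. *)
Definition segre_tangent t s : chart K k :=
  \row_(i < #|{: nzcube k}|) \sum_j
    (if val (enum_val i : nzcube k) j then s j else 0) *
    \prod_(l | l != j) binary t l (val (enum_val i : nzcube k) l).

Definition line t s (z : K) : 'I_k -> K := fun j => t j + z * s j.

Lemma is_diff_line t s j z : differentiable (fun z => line t s z j) z.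
Proof.
have -> : (fun z => line t s z j) = cst (t j) + (id : K -> K) * cst (s j) by [].
apply: differentiableD; first exact: differentiable_cst.
by apply: differentiableM; [exact: ex_diff|exact: differentiable_cst].
Qed.

Lemma diff_segre_line t s : 'd (fun z => segre (line t s z)) 0 1 = segre_tangent t s.
Proof.
apply: deriveE_row => [|i].
  by apply: differentiable_segre => j; exact: is_diff_line.
rewrite mxE (_ : (fun y => _) = (fun z => \prod_j binary (line t s z) j (val (enum_val i) j))); last first.
  by apply/funext => z; rewrite segreE.
have lineE l : binary t l (val (enum_val i) l) = binary (line t s 0) l (val (enum_val i) l).
  by rewrite /binary /line mul0r addr0.
under eq_bigr => j _ do under eq_bigr => l _ do rewrite lineE.
apply: is_derive_bigprod => j; rewrite /binary; case: (val (enum_val i) j); last exact: is_derive_cst.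
have -> : (fun z => line t s z j) = cst (t j) + s j *: (id : K -> K).
  by apply/funext => z; rewrite /line mulrC.
have sE : s j = 0 + s j *: (1 : K) by rewrite add0r /GRing.scale /= mulr1.
rewrite [X in is_derive _ _ _ X]sE.
exact: (is_deriveD (is_derive_cst _ _ _) (is_deriveZ (s j) (is_derive_id _ _))).
Qed.

Lemma segre_tangent_unit t s j : coordinates (segre_tangent t s) j = s j.
Proof.
rewrite /coordinates mxE val_unit_index (bigD1 j) //= ffunE eqxx.
rewrite [X in s j * X]big1 => [|l lj]; last by rewrite ffunE (negbTE lj).
rewrite mulr1 big1 ?addr0 // => l lj.
by rewrite ffunE (negbTE lj) mul0r.
Qed.

Lemma segre_tangent_sum t (I : finType) (P : pred I) (a : I -> K) (s : I -> 'I_k -> K) :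
  \sum_(i | P i) a i *: segre_tangent t (s i) =
  segre_tangent t (fun j => \sum_(i | P i) a i * s i j).
Proof.
apply/rowP => l; rewrite summxE mxE.
under eq_bigr => i _ do rewrite !mxE big_distrr /=.
rewrite exchange_big /=; apply: eq_bigr => j _.
under eq_bigr => i _ do rewrite mulrA.
rewrite -big_distrl /=; congr (_ * _).
by case: ifP => // _; rewrite big1 // => i _; rewrite mulr0.
Qed.

(** The values of a normalized tensor at the patterns with a single bit are its
    parameters, so the tensors are a graph over these coordinates. *)
Theorem segre_submanifold : submanifold k segre_set.
Proof.
have kE : #|unit_index @: [set: 'I_k]%SET| = k.
  by rewrite card_imset ?cardsT ?card_ord //; exact: unit_index_inj.
have := @shear_submanifold K _ (unit_index @: [set: 'I_k]%SET) setT segre_set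
  (fun xi => segre (coordinates xi)).
rewrite kE; apply => //.
- exact: openT.
- move=> p _; apply: differentiable_segre => j; exact: differentiable_coord.
- move=> p q pq _; apply: segre_ext => j; apply: pq.
  by apply: imset_f; rewrite finset.in_setT.
- by move=> p i _ /imsetP[j _ ->]; exact: (coordinates_segre (coordinates p) j).
- move=> p _; split; first exact: segre_coordinates.
  by move=> ->; exists (coordinates p).
Qed.

End Chart.

(** * The map on the chart and its fixed tensors *)

Section Smooth.
Variables (K : numFieldType) (k : nat) (r : reduced_data k) (W : weight K r).
Variables (V : normedModType K).

Lemma differentiable_weighted_map (v : V -> {ffun cube k -> K}) p :
  (forall x, differentiable (fun y => v y x) p) ->
  forall x, differentiable (fun y => weighted_map W (v y) x) p.
Proof.
move=> vd x; have -> : (fun y => weighted_map W (v y) x) =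
    (fun y => \sum_(Y : {ffun hvertex r -> cube k})
      (fun y => (\prod_w v y (Y w)) * \prod_e W e (column Y e) (root_bit x e)) y).
  by apply/funext => y; rewrite ffunE.
apply: differentiable_bigsum => Y _.
apply: (@differentiableM _ _ (fun y => \prod_w v y (Y w)) (cst _)).
  by apply: differentiable_bigprod => w _; exact: vd.
exact: differentiable_cst.
Qed.

Lemma is_derive_weighted_map (v : V -> {ffun cube k -> K}) p h (dv : {ffun cube k -> K}) :
  (forall x, is_derive p h (fun y => v y x) (dv x)) ->
  forall x, is_derive p h (fun y => weighted_map W (v y) x)
    (linearized_map W (v p) dv x).
Proof.
move=> vd x; have -> : (fun y => weighted_map W (v y) x) =
    (fun y => \sum_(Y : {ffun hvertex r -> cube k})
      (fun y => (\prod_e W e (column Y e) (root_bit x e)) * (\prod_w v y (Y w))) y).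
  by apply/funext => y; rewrite ffunE; apply: eq_bigr => Y _; rewrite mulrC.
rewrite ffunE; apply: is_derive_bigsum => Y.
rewrite mulrC; apply: is_deriveZ.
exact: is_derive_bigprod.
Qed.

Lemma differentiable_root_factor (u : V -> 'I_k -> bool -> K) p j b :
  (forall i c, differentiable (fun y => u y i c) p) ->
  differentiable (fun y => root_factor W (fun=> u y) j b) p.
Proof.
move=> ud; apply: differentiable_bigsum => S _.
apply: (@differentiableM _ _ (fun y => \prod_(w in hset (phi r j)) u y (label_map r j) (w \in S)) (cst _)).
  by apply: differentiable_bigprod => w _; exact: ud.
exact: differentiable_cst.
Qed.

Lemma near_neq0 (f : V -> K) p : differentiable f p -> f p != 0 ->
  \forall y \near p, f y != 0.
Proof.
move=> fd fp; apply: cvgr_neq0 fp.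
exact: (differentiable_continuous fd).
Qed.

Lemma differentiable_dehomogenize (v : V -> {ffun cube k -> K}) p :
  (forall x, differentiable (fun y => v y x) p) -> v p (cube0 k) != 0 ->
  differentiable (fun y => dehomogenize (v y)) p.
Proof.
move=> vd v0; apply: differentiable_rowP => i.
have -> : (fun y => dehomogenize (v y) ord0 i) =
    (fun y => v y (val (enum_val i))) * (fun y => (v y (cube0 k))^-1).
  by apply/funext => y; rewrite mxE.
by apply: differentiableM => //; apply: differentiableV.
Qed.

End Smooth.

Section ChartDynamics.
Variables (K : numFieldType) (k : nat) (q : reduced_data k) (U : weight K q).
Variable own : hvertex q -> 'I_k.
Hypothesis ownP : forall w i, i != own w -> w \notin hset (phi q i).
Hypothesis idem : forall j, label_map q (label_map q j) = label_map q j.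
Hypothesis Uid : forall j, label_map q j = j -> identity_edge U (phi q j).
Hypothesis k0 : (0 < k)%N.

Implicit Types (xi : chart K k) (t s : 'I_k -> K).

Local Notation Phi := (weighted_map U).
Local Notation m := #|hvertex q|.

Definition chart_map xi := dehomogenize (Phi (homogenize xi)).

(** Two steps without passing through the chart in between, so that this is also
    meaningful where the first step leaves the chart. *)
Definition chart_map2 xi := dehomogenize (Phi (Phi (homogenize xi))).

Definition chart_defined xi := Phi (homogenize xi) (cube0 k) != 0.

Definition chart_defined2 xi := Phi (Phi (homogenize xi)) (cube0 k) != 0.

Definition image_factor t : 'I_k -> bool -> K := root_factor U (fun=> binary t).

Definition image_constant t : K := unrooted_factor U (fun=> binary t).

Definition image_ratio t : 'I_k -> K := fun j => image_factor t j true / image_factor t j false.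

Lemma weighted_map_tensor (b : 'I_k -> bool -> K) :
  Phi (tensor b) = [ffun x => unrooted_factor U (fun=> b) *
    tensor (root_factor U (fun=> b)) x].
Proof. exact: polarized_tensorE. Qed.

Lemma Phi_segre t : Phi (homogenize (segre t)) =
  [ffun x => image_constant t * tensor (image_factor t) x].
Proof. by rewrite homogenize_segre weighted_map_tensor. Qed.

Lemma image_factor_fixed t j b : label_map q j = j -> image_factor t j b = binary t j b.
Proof.
move=> fj; have [w _ H] := edge_sum_identity (Uid fj).
by rewrite /image_factor /root_factor H fj.
Qed.

Lemma root_factor_local (a a' : 'I_k -> bool -> K) j b :
  a (label_map q j) =1 a' (label_map q j) ->
  root_factor U (fun=> a) j b = root_factor U (fun=> a') j b.
Proof. by move=> aa'; apply: edge_sum_eq => w _; exact: aa'. Qed.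

Lemma image_factor_local t s j b : t (label_map q j) = s (label_map q j) ->
  image_factor t j b = image_factor s j b.
Proof. by move=> ts; apply: root_factor_local => c; rewrite /binary ts. Qed.

Lemma image_ratio_local t s j : t (label_map q j) = s (label_map q j) -> image_ratio t j = image_ratio s j.
Proof. by move=> ts; rewrite /image_ratio !(image_factor_local _ ts). Qed.

Lemma image_ratio_fixed t j : label_map q j = j -> image_ratio t j = t j.
Proof. by move=> fj; rewrite /image_ratio !image_factor_fixed // divr1. Qed.

(** The label read at [j] is fixed, and there the ratio has not changed. *)
Lemma image_ratio_idem t j : image_ratio (image_ratio t) j = image_ratio t j.
Proof. by apply: image_ratio_local; rewrite image_ratio_fixed. Qed.

Lemma chart_defined_segre t : chart_defined (segre t) <->
  image_constant t != 0 /\ forall j, image_factor t j false != 0.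
Proof.
rewrite /chart_defined Phi_segre ffunE tensor0 mulf_eq0 negb_or; split.
  by case/andP => -> /prodf_neq0 H; split=> // j; exact: H.
by case=> -> H; apply/prodf_neq0 => j _.
Qed.

Lemma chart_map_segre t : chart_defined (segre t) -> chart_map (segre t) = segre (image_ratio t).
Proof.
move=> /chart_defined_segre[c0 f0].
by rewrite /chart_map Phi_segre dehomogenize_scale // dehomogenize_tensor.
Qed.

Lemma segre_set_invariant xi : segre_set xi -> chart_defined xi -> segre_set (chart_map xi).
Proof. by case=> t -> /chart_map_segre ->; exists (image_ratio t). Qed.

Lemma homogenize_chart_map xi : chart_defined xi ->
  homogenize (chart_map xi) =
  [ffun x => (Phi (homogenize xi) (cube0 k))^-1 * Phi (homogenize xi) x].
Proof. exact: dehomogenizeK. Qed.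

Lemma chart_map2E xi : chart_defined xi -> chart_map2 xi = chart_map (chart_map xi).
Proof.
move=> d; rewrite -[RHS]/(dehomogenize (Phi (homogenize (chart_map xi)))).
rewrite homogenize_chart_map // weighted_map_scale.
by rewrite dehomogenize_scale // expf_neq0 // invr_eq0.
Qed.

Definition fixed_set : set (chart K k) :=
  [set xi | [/\ segre_set xi, chart_defined xi & chart_map xi = xi]].

Lemma fixed_set_defined2 xi : fixed_set xi -> chart_defined2 xi /\ chart_map2 xi = xi.
Proof.
move=> [Mxi d fxi]; split; last by rewrite chart_map2E // !fxi.
have := homogenize_chart_map d; rewrite fxi => hE.
rewrite /chart_defined2; set c := Phi (homogenize xi) (cube0 k).
have -> : Phi (homogenize xi) = [ffun x => c * homogenize xi x].
  apply/ffunP => x; have /ffunP/(_ x) hx := hE.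
  by rewrite [RHS]ffunE hx [X in _ = _ * X]ffunE mulrA divff // mul1r.
by rewrite weighted_map_scale ffunE mulf_neq0 // expf_neq0.
Qed.

(** On tensors the second step changes nothing but the scale, so a point that
    survives two steps is fixed after one. *)
Lemma fixed_set_ratio t : chart_defined2 (segre t) ->
  chart_defined (segre t) /\ fixed_set (segre (image_ratio t)).
Proof.
move=> d2; have d : chart_defined (segre t).
  move: d2; rewrite /chart_defined2 Phi_segre weighted_map_scale weighted_map_tensor.
  have m0 : (0 < m)%N.
    have /set0Pn[w _] := hset_neq0 (phi q (Ordinal k0)).
    by apply/card_gt0P; exists w.
  rewrite !ffunE !mulf_eq0 expf_eq0 m0 /= !negb_or => /and3P[c0 _ /prodf_neq0 f0].
  apply/chart_defined_segre; split=> // j; have := f0 j isT; rewrite ffunE.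
  by rewrite (@root_factor_local _ (binary t)) // => c; exact: image_factor_fixed.
have E : homogenize (segre (image_ratio t)) =
    [ffun x => (Phi (homogenize (segre t)) (cube0 k))^-1 * Phi (homogenize (segre t)) x].
  by rewrite -chart_map_segre // homogenize_chart_map.
have d' : chart_defined (segre (image_ratio t)).
  rewrite /chart_defined E weighted_map_scale ffunE mulf_neq0 //.
  by rewrite expf_neq0 // invr_eq0.
split=> //; split=> //; first by exists (image_ratio t).
rewrite chart_map_segre //; apply: segre_ext => j; exact: image_ratio_idem.
Qed.

Lemma fixed_set_coordinates xi : fixed_set xi ->
  xi = segre (coordinates xi) /\ image_ratio (coordinates xi) =1 coordinates xi.
Proof.
move=> [Mxi d fxi]; have xiE := segre_coordinates Mxi; split=> // j.
move: d fxi; rewrite {1 2}xiE => /chart_map_segre -> {2}<-.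
by rewrite coordinates_segre.
Qed.

Let P : {set 'I_k} := [set j | label_map q j == j]%SET.
Let d := #|P|.

Lemma differentiable_image_factor (V : normedModType K) (t : V -> 'I_k -> K) p j b :
  (forall i, differentiable (fun y => t y i) p) ->
  differentiable (fun y => image_factor (t y) j b) p.
Proof.
move=> td; apply: differentiable_root_factor => i c; rewrite /binary.
by case: c => //; exact: differentiable_cst.
Qed.

Lemma differentiable_ratio (V : normedModType K) (t : V -> 'I_k -> K) p j :
  (forall i, differentiable (fun y => t y i) p) -> image_factor (t p) j false != 0 ->
  differentiable (fun y => image_ratio (t y) j) p.
Proof.
move=> td i0.
apply: (@differentiableM _ _ (fun y => image_factor (t y) j true)
  (fun y => (image_factor (t y) j false)^-1)).
  exact: differentiable_image_factor.
by apply: differentiableV => //; exact: differentiable_image_factor.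
Qed.

(** Only the coordinates at fixed labels enter here. *)
Definition retraction xi : chart K k := segre (image_ratio (coordinates xi)).

Definition retraction_domain : set (chart K k) :=
  [set xi | (forall j, image_factor (coordinates xi) j false != 0) /\
            chart_defined (retraction xi)].

Lemma coordinates_differentiable xi j : differentiable (fun y : chart K k => coordinates y j) xi.
Proof. exact: differentiable_coord. Qed.

Lemma differentiable_retraction xi :
  (forall j, image_factor (coordinates xi) j false != 0) ->
  differentiable retraction xi.
Proof.
move=> i0; apply: differentiable_segre => j.
by apply: differentiable_ratio => // i; exact: coordinates_differentiable.
Qed.

Lemma near_all_neq0 (V : normedModType K) (I : finType) (f : I -> V -> K) p :
  (forall i, differentiable (f i) p) -> (forall i, f i p != 0) ->
  \forall y \near p, forall i, f i y != 0.
Proof.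
move=> fd f0; have : \forall y \near p, \prod_i f i y != 0.
  apply: near_neq0; first by apply: differentiable_bigprod => i _.
  by apply/prodf_neq0 => i _.
by apply: filterS => y /prodf_neq0 H i; exact: H.
Qed.

Lemma differentiable_Phi_homogenize (V : normedModType K) (g : V -> chart K k) p x :
  differentiable g p -> differentiable (fun y => Phi (homogenize (g y)) x) p.
Proof.
move=> gd; apply: differentiable_weighted_map => z.
apply: (@differentiable_comp _ _ _ _ g (fun y => homogenize y z)) => //.
exact: differentiable_homogenize.
Qed.

Lemma near_chart_defined (V : normedModType K) (g : V -> chart K k) p :
  differentiable g p -> chart_defined (g p) -> \forall y \near p, chart_defined (g y).
Proof.
move=> gd gp; apply: (@near_neq0 _ _ (fun y => Phi (homogenize (g y)) (cube0 k))) => //.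
exact: differentiable_Phi_homogenize.
Qed.

Lemma near_chart_defined2 (V : normedModType K) (g : V -> chart K k) p :
  differentiable g p -> chart_defined2 (g p) -> \forall y \near p, chart_defined2 (g y).
Proof.
move=> gd gp.
apply: (@near_neq0 _ _ (fun y => Phi (Phi (homogenize (g y))) (cube0 k))) => //.
by apply: differentiable_weighted_map => z; exact: differentiable_Phi_homogenize.
Qed.

Lemma open_retraction_domain : open retraction_domain.
Proof.
rewrite openE => xi [i0 dxi]; apply: filterI.
  apply: (@near_all_neq0 _ _ (fun j y => image_factor (coordinates y) j false)) => // j.
  by apply: differentiable_image_factor => i; exact: coordinates_differentiable.
exact: (@near_chart_defined _ retraction xi (differentiable_retraction i0) dxi).
Qed.

(** The fixed tensors are the graph of [retraction] over the coordinates at the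
    fixed labels. *)
Theorem fixed_set_submanifold : submanifold d fixed_set.
Proof.
have dE : #|@unit_index k @: P| = d by rewrite card_imset //; exact: unit_index_inj.
have := @shear_submanifold K _ (@unit_index k @: P) retraction_domain fixed_set retraction.
rewrite dE.
have agree (p p' : chart K k) : (forall i, i \in @unit_index k @: P -> p ord0 i = p' ord0 i) ->
    forall j, coordinates p (label_map q j) = coordinates p' (label_map q j).
  by move=> pp' j; apply: pp'; apply: imset_f; rewrite inE idem.
have retr_eq (p p' : chart K k) : (forall i, i \in @unit_index k @: P -> p ord0 i = p' ord0 i) ->
    retraction p = retraction p'.
  by move=> /agree pp'; apply: segre_ext => j; exact: image_ratio_local.
apply=> //.
- exact: open_retraction_domain.
- by move=> p [i0 _]; exact: differentiable_retraction.
- move=> p p' pp' [i0 dp]; split; last by rewrite -(retr_eq _ _ pp').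
  by move=> j; rewrite -(image_factor_local _ (agree _ _ pp' j)).
- by move=> p p' /retr_eq -> _.
- move=> p i _ /imsetP[j]; rewrite inE => /eqP fj ->.
  by rewrite -[LHS]/(coordinates (retraction p) j) coordinates_segre image_ratio_fixed.
- move=> p Mp; have [pE ratE] := fixed_set_coordinates Mp; have [_ dp _] := Mp.
  have /chart_defined_segre[_ i0] : chart_defined (segre (coordinates p)) by rewrite -pE.
  by split=> //; rewrite /retraction (segre_ext ratE) -pE.
- move=> p [i0 dp]; split=> [Mp|pE].
    by have [pE ratE] := fixed_set_coordinates Mp; rewrite /retraction (segre_ext ratE).
  rewrite pE; split=> //; first by exists (image_ratio (coordinates p)).
  by rewrite /retraction chart_map_segre //; apply: segre_ext => j; exact: image_ratio_idem.
Qed.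

Section AtFixedPoint.
Variable xi0 : chart K k.
Hypothesis Fxi0 : fixed_set xi0.

Let t := coordinates xi0.
Let xi0E : xi0 = segre t. Proof. by have [] := fixed_set_coordinates Fxi0. Qed.
Let image_ratio_t : image_ratio t =1 t. Proof. by have [] := fixed_set_coordinates Fxi0. Qed.
Let def_t : chart_defined (segre t).
Proof. by have [_ + _] := Fxi0; rewrite -xi0E. Qed.
Let def2_t : chart_defined2 (segre t).
Proof. by have [+ _] := fixed_set_defined2 Fxi0; rewrite -xi0E. Qed.
Let factor0 j : image_factor t j false != 0.
Proof. by have /chart_defined_segre[_ H] := def_t. Qed.
Let factorE j b : image_factor t j b = image_factor t j false * binary t j b.
Proof.
rewrite /binary; case: b; last by rewrite mulr1.
by rewrite -[X in _ = _ * X]image_ratio_t /image_ratio [RHS]mulrC divfK.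
Qed.

Let Q0 := Phi (tensor (binary t)) (cube0 k).
Let Q0_neq0 : Q0 != 0.
Proof. by have := def_t; rewrite /chart_defined homogenize_segre. Qed.

Let PhiE x : Phi (tensor (binary t)) x = Q0 * tensor (binary t) x.
Proof.
rewrite /Q0 !weighted_map_tensor !ffunE -mulrA; congr (_ * _).
rewrite -big_split /=; apply: eq_bigr => j _.
by rewrite -/(image_factor t) factorE ffunE.
Qed.

Lemma differentiable_chart_map : differentiable chart_map xi0.
Proof.
apply: differentiable_dehomogenize => [x|]; last by rewrite xi0E.
exact: (@differentiable_Phi_homogenize _ (id : chart K k -> chart K k)).
Qed.

Lemma differentiable_chart_map2 : differentiable chart_map2 xi0.
Proof.
apply: differentiable_dehomogenize => [x|]; last by rewrite xi0E.
apply: differentiable_weighted_map => z.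
exact: (@differentiable_Phi_homogenize _ (id : chart K k -> chart K k)).
Qed.

Lemma diff_chart_map_coord h i :
  ('d chart_map xi0 h) ord0 i =
  let L := linearized_map U (tensor (binary t)) (direction h) in
  (L (val (enum_val i)) - tensor (binary t) (val (enum_val i)) * L (cube0 k)) / Q0.
Proof.
rewrite /=; set x := val (enum_val i).
rewrite diff_row_coord; last exact: differentiable_chart_map.
have dQ y : is_derive xi0 h (fun xi => Phi (homogenize xi) y)
    (linearized_map U (homogenize xi0) (direction h) y).
  apply: is_derive_weighted_map => z; exact: is_derive_homogenize.
have ddQ y : differentiable (fun xi => Phi (homogenize xi) y) xi0.
  exact: (@differentiable_Phi_homogenize _ (id : chart K k -> chart K k)).
have hE : homogenize xi0 = tensor (binary t) by rewrite xi0E homogenize_segre.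
have Q0E : Phi (homogenize xi0) (cube0 k) = Q0 by rewrite hE.
have -> : (fun y : chart K k => chart_map y ord0 i) =
   (fun xi => Phi (homogenize xi) x) * (fun xi => (Phi (homogenize xi) (cube0 k))^-1).
  by apply/funext => y; rewrite mxE.
have dV : derivable (fun xi => (Phi (homogenize xi) (cube0 k))^-1) xi0 h.
  by apply: derivableV; [rewrite Q0E|exact: diff_derivable].
rewrite -deriveE; last first.
  by apply: differentiableM => //; apply: differentiableV => //; rewrite Q0E.
have dn y : derivable (fun xi => Phi (homogenize xi) y) xi0 h by exact: diff_derivable.
rewrite (deriveM (dn x) dV) deriveV ?Q0E //.
have [_ ->] := dQ (cube0 k); have [_ ->] := dQ x.
rewrite hE -/Q0 PhiE /GRing.scale /=; field.
exact: Q0_neq0.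
Qed.

(** By [linearized_tensorE] the first-order change of the image is a sum of
    changes of single factors, in whatever direction the tensor is perturbed. *)
Lemma diff_chart_map_tangent h :
  exists s, 'd chart_map xi0 h = segre_tangent t s.
Proof.
pose G := slope U own (binary t) (direction h).
pose be j := \prod_(i | i != j) image_factor t i false.
exists (fun j => be j * (G j true - t j * G j false) / Q0).
apply/rowP => i; rewrite diff_chart_map_coord /= mxE.
set x := val (enum_val i).
have LE y : linearized_map U (tensor (binary t)) (direction h) y =
    \sum_j G j (y j) * (be j * \prod_(l | l != j) binary t l (y l)).
  rewrite (linearized_tensorE _ _ _ _ ownP); apply: eq_bigr => j _; congr (_ * _).
  rewrite -big_split /=; apply: eq_bigr => l _; exact: factorE.
rewrite !LE big_distrr /= -sumrB big_distrl /=; apply: eq_bigr => j _.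
rewrite [X in _ - _ * (_ * (_ * X))]big1 => [|l _]; last by rewrite ffunE.
have -> : tensor (binary t) x = binary t j (x j) * \prod_(l | l != j) binary t l (x l).
  by rewrite ffunE (bigD1 j).
rewrite [cube0 k j]ffunE -/x; move: (\prod_(l | l != j) _) => p; rewrite /binary.
by case: (x j); field; exact: Q0_neq0.
Qed.

Let curve s (z : K) := segre (line t s z).

Let curve_diff s z : differentiable (curve s) z.
Proof. by apply: differentiable_segre => j; exact: is_diff_line. Qed.

Let curve0 s : curve s 0 = xi0.
Proof. by rewrite xi0E; apply: segre_ext => j; rewrite /line mul0r addr0. Qed.

Let line0 s : line t s 0 =1 t.
Proof. by move=> j; rewrite /line mul0r addr0. Qed.

Let near_curve s : \forall z \near (0 : K), chart_map (curve s z) = segre (image_ratio (line t s z)).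
Proof.
have := @near_chart_defined _ (curve s) 0 (@curve_diff s 0).
rewrite curve0 xi0E => /(_ def_t); apply: filterS => z dz.
exact: chart_map_segre.
Qed.

Let chain s : 'd (chart_map \o curve s) 0 1 = 'd chart_map xi0 (segre_tangent t s).
Proof.
rewrite diff_comp; last by rewrite curve0; exact: differentiable_chart_map.
  by rewrite /= diff_segre_line curve0.
exact: curve_diff.
Qed.

Let comp_diff s : differentiable (chart_map \o curve s) 0.
Proof.
apply: differentiable_comp; first exact: curve_diff.
by rewrite curve0; exact: differentiable_chart_map.
Qed.

(** On the tensors the map reads only the factors at fixed labels. *)
Lemma diff_chart_map_local s s' : (forall j, label_map q j = j -> s j = s' j) ->
  'd chart_map xi0 (segre_tangent t s) = 'd chart_map xi0 (segre_tangent t s').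
Proof.
move=> ss'.
have H : 'D_1 (chart_map \o curve s) (0 : K) = 'D_1 (chart_map \o curve s') 0.
  apply: near_eq_derive; apply: filterS2 (near_curve s) (near_curve s') => z /= -> ->.
  by apply: segre_ext => j; apply: image_ratio_local; rewrite /line ss'.
have e u : 'D_1 (chart_map \o curve u) (0 : K) = 'd (chart_map \o curve u) 0 1.
  exact: deriveE (comp_diff u).
exact: etrans (esym (chain s)) (etrans (esym (e s)) (etrans H (etrans (e s') (chain s')))).
Qed.

Lemma diff_chart_map_fixed s j : label_map q j = j ->
  coordinates ('d chart_map xi0 (segre_tangent t s)) j = s j.
Proof.
move=> fj.
have cd (g : K -> chart K k) : differentiable g 0 ->
    coordinates ('d g 0 1) j = 'D_1 (fun z => coordinates (g z) j) 0.
  move=> gd; rewrite /coordinates (diff_row_coord _ _ gd).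
  apply/esym/deriveE.
  apply: (@differentiable_comp _ _ _ _ g (fun y => y ord0 (unit_index j))) => //.
  exact: differentiable_coord.
have ds : 'd (curve s) 0 1 = segre_tangent t s := diff_segre_line t s.
have := cd _ (comp_diff s); rewrite (chain s) => ->.
have := cd _ (@curve_diff s 0); rewrite ds segre_tangent_unit => ->.
apply: near_eq_derive; apply: filterS (near_curve s) => z /= ->.
by rewrite !coordinates_segre image_ratio_fixed.
Qed.

Lemma diff_chart_map2 h :
  'd chart_map2 xi0 h = 'd chart_map xi0 ('d chart_map xi0 h).
Proof.
have fxi : chart_map xi0 = xi0 by have [] := Fxi0.
have d1 := differentiable_chart_map.
have d2 : differentiable chart_map (chart_map xi0) by rewrite fxi.
have cE : 'd (chart_map \o chart_map) xi0 h =
    'd chart_map xi0 ('d chart_map xi0 h).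
  have /(congr1 (fun g : chart K k -> chart K k => g h)) c1 := diff_comp d1 d2.
  have c2 := congr1 (fun p : chart K k => 'd chart_map p ('d chart_map xi0 h)) fxi.
  move: c1 c2; cbv beta; rewrite /comp => c1 c2; exact (etrans c1 c2).
have H : 'D_h chart_map2 xi0 = 'D_h (chart_map \o chart_map) xi0.
  apply: near_eq_derive.
  have idd : differentiable (id : chart K k -> chart K k) xi0 by exact: ex_diff.
  have := near_chart_defined idd.
  rewrite /= {1}xi0E => /(_ def_t); apply: filterS => y; exact: chart_map2E.
have e1 : 'D_h chart_map2 xi0 = 'd chart_map2 xi0 h.
  exact: deriveE differentiable_chart_map2.
have e2 : 'D_h (chart_map \o chart_map) xi0 = 'd (chart_map \o chart_map) xi0 h.
  exact: deriveE (differentiable_comp d1 d2).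
exact: etrans (esym e1) (etrans H (etrans e2 cE)).
Qed.

Let J := 'J chart_map2 xi0.

Let mulJ v : v *m J = 'd chart_map xi0 ('d chart_map xi0 v).
Proof. exact (etrans (mul_rV_lin1 ('d chart_map2 xi0) v) (diff_chart_map2 v)). Qed.

Let E s := 'd chart_map xi0 (segre_tangent t s).

(* Both tangent vectors have the same coordinates at the fixed labels. *)
Let E_fixed s : 'd chart_map xi0 (E s) = E s.
Proof.
have [s' Es'] := diff_chart_map_tangent (segre_tangent t s).
rewrite /E Es'; rewrite -[RHS]Es'; apply: diff_chart_map_local => j fj.
by rewrite -(segre_tangent_unit t s' j) -Es' diff_chart_map_fixed.
Qed.

Let JJ : J *m J = J.
Proof.
apply/row_matrixP => i; rewrite !row_mul; move: (row i J) (rowE i J) => v vE.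
have [u vJ] : exists u, v = u *m J by exists (delta_mx 0 i).
have [s us] := diff_chart_map_tangent u.
by rewrite {1}mulJ vJ mulJ us -/(E s) !E_fixed.
Qed.

Let E_image s : E s *m J = E s. Proof. by rewrite mulJ !E_fixed. Qed.

Let E_local s s' : (forall j, label_map q j = j -> s j = s' j) -> E s = E s'.
Proof. exact: diff_chart_map_local. Qed.

Let basis (i : 'I_d) : 'I_k -> K := fun j => (j == enum_val i)%:R.

Let A : 'M[K]_(d, #|{: nzcube k}|) := \matrix_i E (basis i).

Let labelP (i : 'I_d) : label_map q (enum_val i) = enum_val i.
Proof. by have := enum_valP i; rewrite inE => /eqP. Qed.

Let A_free : row_free A.
Proof.
apply/row_freeP.
exists (\matrix_(i < #|{: nzcube k}|, l < d) (i == unit_index (enum_val l))%:R).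
apply/matrixP => i l; rewrite [LHS]mxE (bigD1 (unit_index (enum_val l))) //=.
rewrite big1 => [|z zl]; last by rewrite [X in _ * X]mxE (negbTE zl) mulr0.
rewrite addr0 [X in _ * X]mxE eqxx mulr1 [A _ _]mxE [1%:M _ _]mxE.
rewrite -[LHS]/(coordinates (E (basis i)) (enum_val l)) diff_chart_map_fixed //.
by rewrite /basis (inj_eq enum_val_inj) eq_sym.
Qed.

Let A_J : (A :=: J)%MS.
Proof.
apply/eqmxP/andP; split; apply/row_subP => i.
  by rewrite rowK; apply/(sub_idempotentP _ JJ); exact: E_image.
have [s us] := diff_chart_map_tangent (delta_mx 0 i).
rewrite rowE mulJ us -/(E s).
have -> : E s = \sum_(l < d) s (enum_val l) *: E (basis l).
  rewrite (@E_local s (fun j => \sum_(l < d) s (enum_val l) * basis l j)).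
    rewrite /E -segre_tangent_sum linear_sum; apply: eq_bigr => l _.
    by rewrite linearZ.
  move=> j fj; have jP : j \in P by rewrite inE fj.
  rewrite (bigD1 (enum_rank_in jP j)) //= /basis enum_rankK_in // eqxx mulr1.
  rewrite big1 ?addr0 // => l lj; case: eqP => [jl|]; last by rewrite mulr0.
  by case/eqP: lj; apply: enum_val_inj; rewrite enum_rankK_in.
apply: summx_sub => l _; apply: scalemx_sub.
by rewrite -[E _](rowK (fun l => E (basis l)) l) row_sub.
Qed.

Let rankJ : \rank J = d.
Proof. by rewrite -A_J; apply/eqP; exact: A_free. Qed.

Let d_gt0 : (0 < d)%N.
Proof.
by apply/card_gt0P; exists (label_map q (Ordinal k0)); rewrite inE idem.
Qed.

Let tangent_fixed v : tangent_space fixed_set xi0 v -> v *m J = v.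
Proof.
move=> [g [g0 near_g gv]].
have g1 : derivable g 0 1 by have [] := nbhs_singleton near_g.
have gd : differentiable g 0 by apply/derivable1_diffP.
have d2 : differentiable chart_map2 (g 0) by rewrite g0; exact: differentiable_chart_map2.
have H : 'D_1 (chart_map2 \o g) 0 = 'D_1 g (0 : K).
  apply: near_eq_derive; apply: filterS near_g => z [Mz _] /=.
  by have [_] := fixed_set_defined2 Mz.
have e1 : 'D_1 (chart_map2 \o g) 0 = 'd (chart_map2 \o g) 0 1.
  exact: deriveE (differentiable_comp gd d2).
have e2 : 'D_1 g (0 : K) = 'd g 0 1 by exact: deriveE gd.
have /(congr1 (fun f : K -> chart K k => f 1)) c1 := diff_comp gd d2.
have c2 := congr1 (fun p : chart K k => 'd chart_map2 p ('d g 0 1)) g0.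
move: c1 c2; cbv beta; rewrite /comp => c1 c2; rewrite -gv.
have mE := mul_rV_lin1 ('d chart_map2 xi0) ('D_1 g 0).
have c3 := congr1 ('d chart_map2 xi0) e2.
exact (etrans mE (etrans c3 (etrans (esym c2) (etrans (esym c1) (etrans (esym e1) H))))).
Qed.

(* The image of a line of tensors is a curve of fixed points. *)
Let fixed_tangent v : v *m J = v -> tangent_space fixed_set xi0 v.
Proof.
move=> vJ; have [s0 Dv] := diff_chart_map_tangent v.
have [s vE] := diff_chart_map_tangent ('d chart_map xi0 v).
have vs : v = segre_tangent t s by rewrite -vE -mulJ.
have Ev : E s = v by rewrite /E -vs -{1}vJ mulJ Dv -/(E s0) E_fixed -[RHS]vJ mulJ Dv.
have near2 : \forall z \near (0 : K), fixed_set (segre (image_ratio (line t s z))).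
  have := @near_chart_defined2 _ (curve s) 0 (@curve_diff s 0).
  rewrite curve0 {1}xi0E => /(_ def2_t); apply: filterS => z dz.
  by have [] := fixed_set_ratio dz.
have near_factor : \forall z \near (0 : K), forall j, image_factor (line t s z) j false != 0.
  apply: (@near_all_neq0 _ _ (fun j z => image_factor (line t s z) j false)) => j.
    by apply: differentiable_image_factor => i; exact: is_diff_line.
  rewrite (_ : line t s 0 = t) //; exact/funext.
exists (fun z => segre (image_ratio (line t s z))); split.
- rewrite xi0E; apply: segre_ext => j; rewrite -[RHS]image_ratio_t; congr (image_ratio _ _).
  exact/funext.
- apply: filterS2 near2 near_factor => z Mz fz; split=> //.
  apply/derivable1_diffP; apply: differentiable_segre => j.
  by apply: differentiable_ratio => // i; exact: is_diff_line.
have H : 'D_1 (chart_map \o curve s) 0 = 'D_1 (fun z => segre (image_ratio (line t s z))) (0 : K).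
  by apply: near_eq_derive; exact: near_curve.
have e : 'D_1 (chart_map \o curve s) (0 : K) = 'd (chart_map \o curve s) 0 1.
  exact: deriveE (comp_diff s).
exact: etrans (esym H) (etrans e (etrans (chain s) Ev)).
Qed.

Hypothesis d_lt : (d < #|{: nzcube k}|)%N.

(** The differential of one step maps to the tangent space of the tensors, and on
    this space it is idempotent with the tangent space of the fixed points as
    its image. So the differential of two steps is idempotent with this image. *)
Lemma fixed_point_superattracting :
  let L := 'J chart_map2 xi0 in
  [/\ differentiable chart_map2 xi0,
      forall a, eigenvalue L a <-> a = 0 \/ a = 1,
      \rank (geigenspace L 1) = d,
      tangent_space fixed_set xi0 = [set v | (v <= geigenspace L 1)%MS] &
      \rank (kermx L) = (2 ^ k - 1 - d)%N].
Proof.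
have geJ : (geigenspace J 1 :=: J)%MS.
  have n0 : (0 < #|{: nzcube k}|)%N by exact: leq_ltn_trans d_lt.
  move: (J) JJ; case: #|_| n0 => // n _ L; exact: geigenspace_idempotent.
split.
- exact: differentiable_chart_map2.
- by apply: eigenvalue_idempotent => //; rewrite -/J rankJ d_gt0.
- by rewrite -/J geJ.
- apply/seteqP; split=> v; rewrite /= -/J geJ.
    by move=> /tangent_fixed H; apply/(sub_idempotentP _ JJ).
  by move=> /(sub_idempotentP _ JJ) /fixed_tangent.
by rewrite -/J mxrank_ker rankJ card_chart.
Qed.

End AtFixedPoint.

End ChartDynamics.

Local Open Scope complex_scope.

(** * The theorem *)

Lemma normc_absolute_value (R : realType) :
  @absolute_value R R[i] (@ComplexField.Normc.normc R).
Proof.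
split.
- by move=> [a b]; exact: sqrtr_ge0.
- exact: ComplexField.Normc.normc0.
- exact: ComplexField.Normc.normc1.
- exact: normcN.
- exact: ComplexField.Normc.normcM.
- exact: le_normcD.
- exact: ComplexField.Normc.eq0_normc.
Qed.

Lemma label_count_lt k : (2 <= k)%N -> (k < 2 ^ k - 1)%N.
Proof.
move=> k2; rewrite ltn_subRL add1n; elim: k k2 => // -[//|[//|k]] IHk _.
rewrite expnS mul2n -addnn (leq_ltn_trans (IHk isT)) //.
by rewrite -[X in (X < _)%N]addn0 ltn_add2l expn_gt0.
Qed.

Section ComplexMaps.
Variables (R : realType) (k : nat) (r : reduced_data k) (c : connecting_data r).
Variable lam : R[i].

Lemma Fhat1 xi : Fhat c lam 1 xi = chart_map (indep_weight c lam) xi.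
Proof. by rewrite /Fhat /= F_weighted. Qed.

Lemma Fhat_defined1 xi : Fhat_defined c lam 1 xi <-> chart_defined (indep_weight c lam) xi.
Proof. by rewrite /Fhat_defined /= F_weighted. Qed.

Variable n : nat.
Let U := @iterate_weight _ k r (indep_weight c lam) n.

Let iterF v : iter n.+1 (F c lam) v = weighted_map U v.
Proof. by rewrite iter_F_weighted iterate_weightE. Qed.

Lemma Fhat_iterate2 : Fhat c lam (n.+1 + n.+1) = chart_map2 U.
Proof. by apply/funext => xi; rewrite /Fhat iterD !iterF. Qed.

Lemma Fhat_defined_iterate2 xi :
  Fhat_defined c lam (n.+1 + n.+1) xi <-> chart_defined2 U xi.
Proof. by rewrite /Fhat_defined iterD !iterF. Qed.

End ComplexMaps.

Theorem theorem1p1 (R : realType) (m k : nat) (hm : (2 <= m)%N)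
    (hk : (2 <= k)%N) (r : reduced_data k) (hr : #|hvertex r| = m) :
  exists M : set (chart R[i] k),
  [/\ M !=set0, submanifold k M &
  forall c : connecting_data r,
  [/\ forall lam : R[i], lam != 0 ->
      [/\ homogeneous_polynomial_map m (F c lam),
          forall G : marked_graph k,
            F c lam [ffun x => indep_poly_at G lam x] =
            [ffun x => indep_poly_at (recursion c G) lam x] &
          forall xi, M xi -> Fhat_defined c lam 1 xi -> M (Fhat c lam 1 xi)],
      stable c -> expanding r ->
      forall lam : R[i], lam != 0 ->
      exists (n d : nat) (M0 : set (chart R[i] k)),
      [/\ (0 < n)%N, M0 `<=` M, submanifold d M0,
          forall xi, M0 xi -> Fhat_defined c lam n xi /\ Fhat c lam n xi = xi &
          normally_superattracting (Fhat c lam n) d M0 /\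
          ((forall N, exists2 xi, M xi & Fhat_defined c lam N xi) ->
           M0 !=set0)] &
      stable c -> expanding r ->
      forall G0 : marked_graph k, maximally_independent G0 ->
      exists2 C : R, 0 < C &
        forall (n : nat) (lam : R[i]),
          indep_poly (iter n (recursion c) G0) lam = 0 -> `|lam| <= C%:C]].
Proof.
have k0 : (0 < k)%N by exact: leq_trans hk.
exists (@segre_set R[i] k); split.
- by exists (segre (fun=> 0)); exists (fun=> 0).
- exact: segre_submanifold.
move=> c; split.
- move=> lam lam0; split.
  + have -> : F c lam = weighted_map (indep_weight c lam).
      by apply/funext => v; exact: F_weighted.
    rewrite -hr; exact: weighted_map_homogeneous.
  + by move=> G; exact: F_recursion.
  + move=> xi Mxi /Fhat_defined1 dxi; rewrite Fhat1.
    exact: segre_set_invariant.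
- move=> stab expd lam lam0.
  have [n [sep idem]] := expanding_idempotent_iterate expd.
  have [own ownP] := separated_owner k0 sep.
  pose U := @iterate_weight _ k r (indep_weight c lam) n.
  have Uid j : label_map (iter n (compose_data r) r) j = j ->
      identity_edge U (phi (iter n (compose_data r) r) j).
    move=> /fixed_label_periodic; apply: identity_edge_iterate => l.
    exact: stable_identity_edge.
  pose d := #|[set j | label_map (iter n (compose_data r) r) j == j]%SET|.
  have d_lt : (d < #|{: nzcube k}|)%N.
    rewrite card_chart (leq_ltn_trans _ (label_count_lt hk)) //.
    by rewrite (leq_trans (max_card _)) ?card_ord.
  exists (n.+1 + n.+1)%N, d, (fixed_set U); split.
  + by [].
  + by move=> xi [].
  + exact: fixed_set_submanifold.
  + move=> xi /fixed_set_defined2[d2 fE]; split; first exact/Fhat_defined_iterate2.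
    by rewrite Fhat_iterate2.
  split.
    rewrite Fhat_iterate2 => xi Mxi.
    exact: (fixed_point_superattracting ownP idem Uid k0 Mxi d_lt).
  move=> /(_ (n.+1 + n.+1)%N)[xi [t ->]] /Fhat_defined_iterate2 d2.
  by have [_ H] := fixed_set_ratio idem Uid k0 d2; exists (segre (image_ratio U t)).
move=> stab expd G0 G0max.
have [L H] := independence_zeros_bounded (normc_absolute_value R) G0max k0 stab expd.
exists (Num.max L 1); first by rewrite lt_max ltr01 orbT.
move=> n lam Z0.
have -> : `|lam| = (ComplexField.Normc.normc lam)%:C by [].
rewrite lecR leNgt; apply/negP; rewrite gt_max => /andP[/ltW/H/(_ n)].
by rewrite Z0 eqxx.
Qed.
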